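(* Under the mesh assumptions (A.1) and (A.2), for quadrilateral elements the discrete bilinear form $a_h^E(\cdot,\cdot)$ is $L^2$-continuous and coercive on the kernel: there exist two positive constants $\alpha_*$ and $\alpha^*$, independent of $h_E$ (uniform over all elements $E$ of all meshes $\mathcal{M}_h$ of the family), such that for every $E\in\mathcal{M}_h$ $$a_h^E(\boldsymbol\tau_h,\boldsymbol\sigma_h)\le\alpha^*\|\boldsymbol\tau_h\|_{L^2(E)}\|\boldsymbol\sigma_h\|_{L^2(E)}\qquad\forall\,\boldsymbol\tau_h,\boldsymbol\sigma_h\in\Sigma_h(E)$$ and $$a_h^E(\boldsymbol\tau_h,\boldsymbol\tau_h)\ge\alpha_*\|\boldsymbol\tau_h\|_{L^2(E)}^2\qquad\forall\,\boldsymbol\tau_h\in\Sigma_h^0(E),$$ where $\Sigma_h^0(E):=\{\boldsymbol\tau_h\in\Sigma_h(E):\operatorname{div}\boldsymbol\tau_h=0\}$.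
   Context: Meshes: $\{\mathcal{M}_h\}_h$ is a family of tessellations of a planar domain $\Omega$ made of quadrilaterals (not necessarily convex). With $h_E$ the diameter of $E$ and $\gamma>0$ a constant common to all elements of all meshes, each $E\in\mathcal{M}_h$ satisfies: (A.1) $E$ is star-shaped with respect to a ball of radius $\ge\gamma h_E$; (A.2) each edge $e$ of $\partial E$ has length $|e|\ge\gamma h_E$. $\boldsymbol n_e$ denotes the outward unit normal on the edge $e$ of $E$. Spaces: $\mathbb{P}_0$ denotes constants, and $H(\operatorname{div};E)$ is the space of $L^2(E)^2$ vector fields with divergence in $L^2(E)$. The local virtual element space is $$\Sigma_h(E):=\{\boldsymbol\tau_h\in H(\operatorname{div};E): \exists v\in H^1(E)\text{ with }\boldsymbol\tau_h=\nabla v,\ \boldsymbol\tau_h\cdot\boldsymbol n_e\in\mathbb{P}_0(e)\ \forall e\subset\partial E,\ \operatorname{div}\boldsymbol\tau_h\in\mathbb{P}_0(E)\}.$$ Projection and bilinear form: $\mathbb{P}^H_2(E)$ is the space of real harmonic polynomials of degree at most 2 on $E$. $\widehat{\Pi}_1^E:[L^2(E)]^2\to\nabla\mathbb{P}^H_2(E)$ is the $L^2(E)$-orthogonal projection, i.e. $\int_E\widehat{\Pi}_1^E\boldsymbol\tau\cdot\nabla p=\int_E\boldsymbol\tau\cdot\nabla p$ for all $p\in\mathbb{P}^H_2(E)$. The discrete local form is $$a_h^E(\boldsymbol\sigma_h,\boldsymbol\tau_h):=\int_E\widehat{\Pi}_1^E\boldsymbol\sigma_h\cdot\widehat{\Pi}_1^E\boldsymbol\tau_h.$$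 *)

(* Defs.v *)
From HB Require Import structures.
From mathcomp Require Import all_boot all_order all_algebra.
From mathcomp Require Import all_classical all_reals all_analysis.

Set Implicit Arguments.
Unset Strict Implicit.
Unset Printing Implicit Defensive.

Import Order.TTheory GRing.Theory Num.Theory.
Import numFieldNormedType.Exports.

Local Open Scope classical_set_scope.
Local Open Scope ring_scope.

Section Plane.
Variable R : realType.

(* The norm MathComp-Analysis puts on R * R is the max norm: it has the same
   topology and the same differentiable functions, but lengths, diameters and
   balls below are Euclidean. *)
Definition dot (x y : R * R) : R := x.1 * y.1 + x.2 * y.2.

Definition enorm (x : R * R) : R := Num.sqrt (dot x x).

Definition eball (c : R * R) (r : R) : set (R * R) :=
  [set x | enorm (x - c) < r].

Definition diam (A : set (R * R)) : R :=
  sup [set enorm (z.1 - z.2) | z in A `*` A].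

Definition segment (a b : R * R) : set (R * R) :=
  [set a + t *: (b - a) | t in `[0, 1]].

Definition star_shaped_ball (A : set (R * R)) (c : R * R) (r : R) : Prop :=
  forall x y, eball c r x -> A y -> segment x y `<=` A.

(* A quadrilateral is given by its four vertices, in cyclic order (in either
   orientation), together with the open region it bounds. *)
Record quad : Type := Quad {
  vertex : 'I_4 -> R * R;
  region : set (R * R) }.

Definition edge (Q : quad) (i : 'I_4) : set (R * R) :=
  segment (vertex Q i) (vertex Q (ordS i)).

Definition edge_length (Q : quad) (i : 'I_4) : R :=
  enorm (vertex Q (ordS i) - vertex Q i).

(* The four edges form a simple closed polygon.  It may be non-convex, and an
   angle equal to pi is allowed. *)
Definition simple_polygon (Q : quad) : Prop :=
  [/\ injective (vertex Q),
      forall i, edge Q i `&` edge Q (ordS i) = [set vertex Q (ordS i)]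
    & forall i, edge Q i `&` edge Q (ordS (ordS i)) = set0].

(* An open bounded set whose topological boundary is a simple closed polygon is
   the interior of this polygon, by the Jordan curve theorem. *)
Definition is_quadrilateral (Q : quad) : Prop :=
  [/\ simple_polygon Q, open (region Q), bounded_set (region Q)
    & closure (region Q) `\` region Q = \bigcup_i edge Q i].

Definition tessellation (Omega : set (R * R)) (T : set quad) : Prop :=
  [/\ finite_set T,
      forall Q, T Q -> is_quadrilateral Q,
      forall Q Q', T Q -> T Q' -> Q <> Q' -> region Q `&` region Q' = set0
    & closure Omega = \bigcup_(Q in T) closure (region Q)].

Definition mesh_star (gamma : R) (Q : quad) : Prop :=
  exists c r, gamma * diam (region Q) <= r /\ star_shaped_ball (region Q) c r.

Definition mesh_edge (gamma : R) (Q : quad) : Prop :=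
  forall i, gamma * diam (region Q) <= edge_length Q i.

Definition leb2 : set (measurableTypeR R * measurableTypeR R) -> \bar R :=
  (@lebesgue_measure R \x @lebesgue_measure R)%E.

HB.instance Definition _ := Measure.on leb2.

Definition int2 (E : set (R * R)) (f : R * R -> R) : R :=
  (\int[leb2]_(x in E) f x)%R.

Definition L2 (E : set (R * R)) (f : R * R -> R) : Prop :=
  (f \_ E : measurableTypeR R * measurableTypeR R -> R) \in Lfun leb2 2%:E.

Definition L2vec (E : set (R * R)) (tau : R * R -> R * R) : Prop :=
  L2 E (fst \o tau) /\ L2 E (snd \o tau).

Definition L2norm (E : set (R * R)) (tau : R * R -> R * R) : R :=
  Num.sqrt (int2 E (fun x => dot (tau x) (tau x))).

Definition basis (i : bool) : R * R := if i then (0, 1) else (1, 0).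

Definition partial (i : bool) (f : R * R -> R) : R * R -> R :=
  fun x => 'D_(basis i) f x.

Definition grad (f : R * R -> R) : R * R -> R * R :=
  fun x => (partial false f x, partial true f x).

Definition laplacian (f : R * R -> R) : R * R -> R :=
  fun x => partial false (partial false f) x + partial true (partial true f) x.

Definition smooth (f : R * R -> R) : Prop :=
  forall (s : seq bool) (x : R * R), differentiable (foldr partial f s) x.

Definition test_function (E : set (R * R)) (f : R * R -> R) : Prop :=
  [/\ smooth f, compact (closure [set x | f x != 0])
    & closure [set x | f x != 0] `<=` E].

Definition weak_grad (E : set (R * R)) (v : R * R -> R)
    (g : R * R -> R * R) : Prop :=
  forall f, test_function E f ->
    int2 E (fun x => v x * partial false f x) =
      - int2 E (fun x => (g x).1 * f x) /\
    int2 E (fun x => v x * partial true f x) =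
      - int2 E (fun x => (g x).2 * f x).

Definition weak_div (E : set (R * R)) (tau : R * R -> R * R)
    (d : R * R -> R) : Prop :=
  forall f, test_function E f ->
    int2 E (fun x => dot (tau x) (grad f x)) = - int2 E (fun x => d x * f x).

Definition H1 (E : set (R * R)) (v : R * R -> R) : Prop :=
  L2 E v /\ exists g, L2vec E g /\ weak_grad E v g.

Definition Hdiv (E : set (R * R)) (tau : R * R -> R * R) : Prop :=
  L2vec E tau /\ exists d, L2 E d /\ weak_div E tau d.

Definition edge_integral (Q : quad) (i : 'I_4) (f : R * R -> R) : R :=
  let a := vertex Q i in let b := vertex Q (ordS i) in
  edge_length Q i *
  (\int[@lebesgue_measure R]_(t in `[0%R, 1%R]) f (a + t *: (b - a)))%R.

(* For tau in H(div) with divergence d, the trace tau . n (n the outward unit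
   normal) is the functional
     phi |-> int_E tau . grad phi + int_E d phi
   on the traces of H^1 functions.  The predicate says that this functional is
   represented by the function equal to g i on the i-th edge.  Smooth functions
   on the plane suffice as phi: their restrictions are dense in H^1. *)
Definition normal_trace (Q : quad) (tau : R * R -> R * R) (d : R * R -> R)
    (g : 'I_4 -> R * R -> R) : Prop :=
  forall phi, smooth phi ->
    int2 (region Q) (fun x => dot (tau x) (grad phi x)) +
    int2 (region Q) (fun x => d x * phi x) =
    \sum_(i < 4) edge_integral Q i (fun x => g i x * phi x).

Definition Sigma_h (Q : quad) (tau : R * R -> R * R) : Prop :=
  [/\ Hdiv (region Q) tau,
      exists v, H1 (region Q) v /\ weak_grad (region Q) v tau
    & exists d : R, weak_div (region Q) tau (cst d) /\
      exists c : 'I_4 -> R, normal_trace Q tau (cst d) (fun i => cst (c i))].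

Definition Sigma0_h (Q : quad) (tau : R * R -> R * R) : Prop :=
  Sigma_h Q tau /\ weak_div (region Q) tau (cst 0).

Definition P2 (p : R * R -> R) : Prop :=
  exists a : 'I_3 -> 'I_3 -> R, forall x,
    p x = \sum_(i < 3) \sum_(j < 3 | (i + j <= 2)%N)
            a i j * x.1 ^+ i * x.2 ^+ j.

Definition harmonic_P2 (p : R * R -> R) : Prop :=
  P2 p /\ forall x, laplacian p x = 0.

Definition is_projection (Q : quad) (tau rho : R * R -> R * R) : Prop :=
  (exists p, harmonic_P2 p /\ rho = grad p) /\
  forall p, harmonic_P2 p ->
    int2 (region Q) (fun x => dot (rho x) (grad p x)) =
    int2 (region Q) (fun x => dot (tau x) (grad p x)).

(* The default value (the zero field) is never used: every field of L^2 has
   exactly one projection. *)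
Definition Pi_hat (Q : quad) (tau : R * R -> R * R) : R * R -> R * R :=
  xget (fun=> 0) [set rho | is_projection Q tau rho].

Definition a_h (Q : quad) (sigma tau : R * R -> R * R) : R :=
  int2 (region Q) (fun x => dot (Pi_hat Q sigma x) (Pi_hat Q tau x)).

End Plane.

(* Main.v *)
(* Let tau = grad v be divergence free with constant normal fluxes w_i through
   the four edges, so that int_E tau . grad phi = sum_i w_i A_i(phi) with A_i(phi)
   the mean of phi on the i-th edge.

   - Upper bound on |tau| by the fluxes.  Testing with mollifications of v gives
     |tau|^2 = lim sum_i w_i A_i(phi) with |grad phi| <= |tau|.  The w_i have sum
     zero, and neighbouring edge means differ by at most a constant times
     |grad phi|: both are compared with the mean on the segment from the common
     vertex to the centre c of the ball, by a trace inequality on the triangles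
     spanned by c and an edge, which lie in E and are shape regular.
   - Upper bound on the fluxes by Pi tau.  With phi a harmonic polynomial of degree
     at most 2, the right-hand side is a moment of Pi tau.  With
     w = (t + al, - t + be, t - al, - t - be) the linear moments determine al and
     be because the diagonals of the quadrilateral are transverse, and then the
     quadratic moments determine t, whose complex coefficient is the product of
     the two diagonals.  Their cross product is at least 4 gamma^2 h^2 even for
     non-convex quadrilaterals, because the triangles (c, z_i, z_(i+1)) are
     all equally oriented. *)

Require Import Defs.
From HB Require Import structures.
From mathcomp Require Import all_boot all_order all_algebra.
From mathcomp Require Import all_classical all_reals all_analysis.
From mathcomp Require Import measurable_realfun ring lra.

Set Implicit Arguments.
Unset Strict Implicit.
Unset Printing Implicit Defensive.

Import Order.TTheory GRing.Theory Num.Theory.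
Import numFieldNormedType.Exports.

Local Open Scope classical_set_scope.
Local Open Scope ring_scope.

(** * Lebesgue measure on the line and on the plane *)

Section Lebesgue.
Variable R : realType.
Notation mR := (measurableTypeR R).
Notation mu := (@lebesgue_measure R).
Local Open Scope ereal_scope.

(** The normal trace is tested with functions smooth on the whole plane, whereas the potential v is
    only in H^1(E) and E need not be convex. Averaging v over the points l x + (1 - l) y, with y
    near c, gives such a function without extending v across the boundary: for x in E these points
    stay in E by star-shapedness. Weak convergence as l tends to 1 is enough, because the gradient
    is paired with tau itself.

    The w_i are total fluxes, density times edge length; with this normalisation every estimate is
    scale invariant and h cancels. The alternating mode (1, -1, 1, -1), whose coefficient is t, is
    what forces degree 2: its linear moments vanish on every quadrilateral, since each vertex
    contributes to two consecutive edges with opposite signs.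

    The upper constant is 1, an orthogonal projection being a contraction. The lower one is K^-2,
    where K is the product of 4 / gamma (norm by fluxes) and 40 / gamma^2 + 192 / gamma^4 (fluxes by
    Pi tau). *)

Lemma measurable_affine (a b : R) : measurable_fun [set: mR] (fun x : mR => a * x + b : mR)%R.
Proof. by apply: measurable_funD => //; exact: measurable_funM. Qed.

(** Uniqueness of the Lebesgue measure: the pushforward of [mu] by the affine map, multiplied by
    [|a|], gives every half-open interval its length. For [a < 0] the preimage is closed at the
    other end, which does not change its length. *)
Lemma lebesgue_affine_preimage (a b : R) (A : set mR) : a != 0%R ->
  measurable A ->
  mu A = `|a|%:E * mu ((fun x => a * x + b)%R @^-1` A).
Proof.
move=> a0 mA.
pose phi := (fun x : mR => a * x + b : mR)%R.
have mphi : measurable_fun [set: mR] phi by exact: measurable_affine.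
pose m := measure_function_pushforward__canonical__measure_function_Measure mu mphi.
have n0 : (0 <= `|a|)%R by [].
transitivity (mscale (NngNum n0) m A) => //.
apply: lebesgue_measure_unique => // X [[x y] /= xy <-].
rewrite lebesgue_measure_itv/= lte_fin /mscale/= /m /pushforward/=.
have [a_gt0|a_le0] := ltP 0%R a.
  rewrite (_ : _ @^-1` _ = `](x - b) / a, (y - b) / a]%classic)%R; last first.
    apply/seteqP; split => z /=; rewrite !in_itv/= ltr_pdivrMr// ler_pdivlMr// ltrBlDr lerBrDr mulrC//.
  rewrite lebesgue_measure_itv/= lte_fin ltr_pM2r ?invr_gt0// ltrD2r gtr0_norm//.
  case: ltP => xy'; last by rewrite mule0.
  by rewrite -!EFinB -EFinM; congr EFin; field.
have {a_le0}a_lt0 : (a < 0)%R by rewrite lt_neqAle a0.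
rewrite (_ : _ @^-1` _ = `[(y - b) / a, (x - b) / a[%classic)%R; last first.
  apply/seteqP; split => z /=; rewrite !in_itv/= ltr_ndivlMr// ler_ndivrMr// ltrBlDr lerBrDr mulrC andbC//.
rewrite lebesgue_measure_itv/= lte_fin ltr_nM2r ?invr_lt0// ltrD2r.
rewrite ltr0_norm//; case: ltP => xy'; last by rewrite mule0.
by rewrite -!EFinB -EFinM; congr EFin; field.
Qed.

Lemma ge0_integral_affine (a b : R) (f : mR -> \bar R) : a != 0%R ->
  measurable_fun [set: mR] f -> (forall x, 0 <= f x) ->
  \int[mu]_x f x = `|a|%:E * \int[mu]_x f (a * x + b)%R.
Proof.
move=> a0 mf f0.
have n0 : (0 <= `|a|)%R by [].
pose phi := (fun x : mR => a * x + b : mR)%R.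
have mphi : measurable_fun [set: mR] phi by exact: measurable_affine.
have := @ge0_integral_pushforward _ _ _ _ R phi mphi mu [set: mR] f measurableT mf (fun y _ => f0 y).
rewrite preimage_setT => <-.
rewrite -[RHS](ge0_integral_mscale _ _ (NngNum n0))//.
apply: eq_measure_integral => A mA _.
exact: lebesgue_affine_preimage.
Qed.

End Lebesgue.

Section Plane.
Variable R : realType.
Notation mR := (measurableTypeR R).
Notation mR2 := (mR * mR)%type.
Notation mu := (@lebesgue_measure R).
Notation leb2 := (@leb2 R).

Lemma ball_prodE (x : R * R) (e : R) : ball x e = ball x.1 e `*` ball x.2 e.
Proof. by []. Qed.

(** The sigma-algebra is the product one, so an open set has to be a countable union of measurable
    rectangles: balls of the max norm with rational centre and radius 1 / (n + 1). Balls not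
    contained in [U] are replaced by the empty set, so that the union runs over a whole countable
    type. *)
Lemma open_measurable2 (U : set (R * R)) : open U -> measurable (U : set mR2).
Proof.
move=> oU.
pose B (q : rat * rat * nat) : set (R * R) :=
  ball ((ratr q.1.1, ratr q.1.2) : R * R) (q.2.+1%:R^-1 : R).
have -> : U = \bigcup_q (if `[< B q `<=` U >] then B q else set0).
  apply/seteqP; split=> [x Ux|x [q _]]; last by case: asboolP => // BU /BU.
  have /nbhs_ballP[e /= e0 xe] := open_nbhs_nbhs (conj oU Ux).
  have [n ne] : exists n, n.+1%:R^-1 < e / 2 :> R.
    have /ltr_add_invr[n] : 0 < e / 2 by rewrite divr_gt0.
    by rewrite add0r => nE; exists n.
  have n0 : 0 < n.+1%:R^-1 :> R by [].
  have dq (t : R) : exists q : rat, ball t (n.+1%:R^-1) (ratr q).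
    have tt : t - n.+1%:R^-1 < t + n.+1%:R^-1 by rewrite ltrBlDr -addrA ltrDl addr_gt0.
    have [q] := rat_in_itvoo tt.
    by rewrite in_itv/= => qt; exists q; rewrite -ball_normE/= distrC ltr_distl.
  have [q1 hq1] := dq x.1; have [q2 hq2] := dq x.2.
  exists ((q1, q2), n) => //=.
  have Bx : B ((q1, q2), n) x by split; apply: ball_sym.
  case: asboolP => // -[] y By; apply: xe.
  apply: (@le_ball _ _ _ (n.+1%:R^-1 + n.+1%:R^-1)).
    by rewrite [leRHS]splitr ltW// ltrD.
  exact: ball_triangle (ball_sym Bx) By.
apply: countable_bigcupT_measurable; first exact: countableP.
move=> q; case: asboolP => // _; rewrite /B ball_prodE.
by apply: measurableX; apply: measurable_ball.
Qed.

Lemma continuous_measurable_fun2 (D : set mR2) (f : R * R -> R) :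
  measurable D -> continuous f -> measurable_fun D f.
Proof.
move=> mD /continuousP cf; apply: (measurability _ (RGenOpens.measurableE R)) => //.
move=> _ [_ [a [b ->] <-]]; apply: measurableI => //.
by apply: open_measurable2; apply: cf; exact: interval_open.
Qed.

Local Open Scope ereal_scope.

Lemma leb2X (A B : set mR) : measurable A -> measurable B ->
  leb2 (A `*` B) = mu A * mu B.
Proof. exact: (@product_measure1E _ _ mR mR R mu mu). Qed.

(** Allows Tonelli on the product of the plane with itself, where the point and the integration
    variable of the mollifier are exchanged. *)
Lemma leb2_sigma_finite : sigma_finite setT leb2.
Proof.
have /sigma_finiteP[F [TF ndF Foo]] := sigma_finiteT mu.
exists (fun n => F n `*` F n).
  apply/seteqP; split => // -[x y] _.
  have [n _ Fnx] : (\bigcup_i F i) x by rewrite -TF.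
  have [k _ Fky] : (\bigcup_i F i) y by rewrite -TF.
  exists (maxn n k) => //; split.
  - by move: x Fnx; exact/subsetPset/ndF/leq_maxl.
  - by move: y Fky; exact/subsetPset/ndF/leq_maxr.
move=> k; have [mF Foo'] := Foo k; split; first exact: measurableX.
by rewrite leb2X// lte_mul_pinfty// ge0_fin_numE.
Qed.

HB.instance Definition _ := @Measure_isSigmaFinite.Build _ _ _ leb2 leb2_sigma_finite.

Lemma leb2_tonelli1 (f : mR2 -> \bar R) : measurable_fun setT f ->
  (forall x, 0 <= f x) -> \int[leb2]_x f x = \int[mu]_x \int[mu]_y f (x, y).
Proof. exact: (@fubini_tonelli1 _ _ mR mR R mu mu). Qed.

Lemma leb2_tonelli2 (f : mR2 -> \bar R) : measurable_fun setT f ->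
  (forall x, 0 <= f x) -> \int[leb2]_x f x = \int[mu]_y \int[mu]_x f (x, y).
Proof. exact: (@fubini_tonelli2 _ _ mR mR R mu mu). Qed.

Lemma leb2_tonelli4 (f : mR2 * mR2 -> \bar R) : measurable_fun setT f ->
  (forall x, 0 <= f x) ->
  \int[leb2]_x \int[leb2]_y f (x, y) = \int[leb2]_y \int[leb2]_x f (x, y).
Proof. exact: (@fubini_tonelli _ _ _ _ R leb2 leb2). Qed.

End Plane.

Lemma quadratic_ge0_discr (R : realFieldType) (A B C : R) :
  (forall t, 0 <= A + 2 * t * B + t ^+ 2 * C) -> B ^+ 2 <= A * C.
Proof.
move=> h; have [C0|C0] := eqVneq C 0.
  have [->|B0] := eqVneq B 0; first by rewrite C0 mulr0 expr0n.
  have := h (- (A + 1) / (2 * B)); rewrite C0 mulr0 addr0.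
  have -> : A + 2 * (- (A + 1) / (2 * B)) * B = -1 by field.
  by rewrite lerNr oppr0 ler10.
have C_gt0 : 0 < C.
  rewrite lt_neqAle eq_sym C0/=.
  rewrite leNgt; apply/negP => Cn.
  have nC : 0 < - C by rewrite oppr_gt0.
  (* For [C < 0], this [t] satisfies t (- C) = - C + |A| + 2 |B|, so the quadratic term outweighs
     the two others and the trinomial is negative. *)
  pose t := 1 + (`|A| + 2 * `|B|) / (- C).
  have t1 : 1 <= t by rewrite lerDl divr_ge0 ?addr_ge0 ?mulr_ge0// ltW.
  have := h t.
  have tC : t * - C = - C + (`|A| + 2 * `|B|).
    by rewrite /t mulrDl mul1r divfK ?lt0r_neq0.
  have -> : t ^+ 2 * C = - (t * (- C + (`|A| + 2 * `|B|))).
    by rewrite -tC; ring.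
  have : A <= t * `|A| by rewrite (le_trans (ler_norm _))// ler_peMl.
  have : t * B <= t * `|B| by rewrite ler_wpM2l ?ler_norm// (le_trans _ t1).
  have : 0 < t * - C by rewrite mulr_gt0// (lt_le_trans _ t1).
  nra.
have := h (- B / C).
have -> : A + 2 * (- B / C) * B + (- B / C) ^+ 2 * C = (A * C - B ^+ 2) / C by field.
by rewrite ler_pdivlMr// mul0r subr_ge0.
Qed.

(** * Jensen's inequality and square-integrable fields *)

Section Jensen.
Local Open Scope ereal_scope.
Context d (T : measurableType d) (R : realType) (mu : {measure set T -> \bar R}).
Variables (D : set T) (k f : T -> R).
Hypotheses (mD : measurable D) (mk : measurable_fun D k) (mf : measurable_fun D f).
Hypotheses (k0 : forall x, D x -> (0 <= k x)%R) (k1 : \int[mu]_(x in D) (k x)%:E = 1).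

(** Domination k |f| <= k + k f^2, where the weight [k] has mass one. *)
Lemma weighted_jensen_integrable : \int[mu]_(x in D) (k x * f x ^+ 2)%:E < +oo ->
  mu.-integrable D (fun x => (k x * f x)%:E).
Proof.
move=> kf2.
have mkf : measurable_fun D (fun x => k x * f x)%R by exact: measurable_funM.
have mkf2 : measurable_fun D (fun x => k x * f x ^+ 2)%R.
  by apply: measurable_funM => //; exact: measurable_funX.
have kf20 x : D x -> (0 <= k x * f x ^+ 2)%R.
  by move=> Dx; rewrite mulr_ge0 ?k0 ?sqr_ge0.
apply/integrableP; split; first exact/measurable_EFinP.
apply: (@le_lt_trans _ _ (\int[mu]_(x in D) ((k x)%:E + (k x * f x ^+ 2)%:E))).
  apply: ge0_le_integral => //.
  - by apply: measurableT_comp => //; exact/measurable_EFinP.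
  - by apply: emeasurable_funD; exact/measurable_EFinP.
  - move=> x Dx; rewrite /= lee_fin normrM (ger0_norm (k0 Dx)).
    rewrite -{2}[k x]mulr1 -mulrDr ler_wpM2l ?k0//.
    rewrite -real_normK ?num_real//; nra.
rewrite ge0_integralD//=; first by rewrite k1 lte_add_pinfty// ltry.
exact/measurable_EFinP.
exact/measurable_EFinP.
Qed.

(** With m the weighted mean of [f], expand the nonnegative integral of k (f - m)^2. The right-hand
    side is an extended real, so that the inequality can be used before finiteness is known. *)
Lemma weighted_jensen :
  ((\int[mu]_(x in D) (k x * f x)) ^+ 2)%:E <= \int[mu]_(x in D) (k x * f x ^+ 2)%:E.
Proof.
have kf20 x : D x -> (0 <= k x * f x ^+ 2)%R.
  by move=> Dx; rewrite mulr_ge0 ?k0 ?sqr_ge0.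
have [kf2|] := ltP (\int[mu]_(x in D) (k x * f x ^+ 2)%:E) +oo; last first.
  by rewrite leye_eq => /eqP ->; rewrite leey.
have ikf := weighted_jensen_integrable kf2.
have mkf2 : measurable_fun D (fun x => k x * f x ^+ 2)%R.
  by apply: measurable_funM => //; exact: measurable_funX.
have ikf2 : mu.-integrable D (fun x => (k x * f x ^+ 2)%:E).
  apply/integrableP; split; first exact/measurable_EFinP.
  by under eq_integral => x /set_mem Dx do rewrite gee0_abs ?lee_fin ?kf20//.
have ik : mu.-integrable D (fun x => (k x)%:E).
  apply/integrableP; split; first exact/measurable_EFinP.
  under eq_integral => x /set_mem Dx do rewrite gee0_abs ?lee_fin ?k0//.
  by rewrite k1 ltry.
have -> : \int[mu]_(x in D) (k x * f x ^+ 2)%:E = (\int[mu]_(x in D) (k x * f x ^+ 2))%:E.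
  by rewrite fineK// integrable_fin_num.
rewrite lee_fin; set m := (\int[mu]_(x in D) (k x * f x))%R.
set s := (\int[mu]_(x in D) (k x * f x ^+ 2))%R.
have : (0 <= \int[mu]_(x in D) ((k x * f x ^+ 2 - (2 * m) * (k x * f x)) + m ^+ 2 * k x))%R.
  apply: Rintegral_ge0 => x Dx.
  have -> : (k x * f x ^+ 2 - 2 * m * (k x * f x) + m ^+ 2 * k x =
     k x * (f x - m) ^+ 2)%R by ring.
  by rewrite mulr_ge0 ?k0 ?sqr_ge0.
have i1 : mu.-integrable D (EFin \o (fun x => (2 * m) * (k x * f x))%R).
  by have := integrableZl mD (2 * m)%R ikf; apply: eq_integrable.
have i2 : mu.-integrable D (EFin \o (fun x => m ^+ 2 * k x)%R).
  by have := integrableZl mD (m ^+ 2)%R ik; apply: eq_integrable.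
have i3 : mu.-integrable D (EFin \o (fun x => k x * f x ^+ 2 - (2 * m) * (k x * f x))%R).
  by have := integrableB mD ikf2 i1; apply: eq_integrable.
rewrite RintegralD// RintegralB// !RintegralZl//.
rewrite -/m -/s.
have -> : (\int[mu]_(x in D) k x = 1)%R by rewrite /Rintegral k1.
move=> h; rewrite -subr_ge0.
by have -> : (s - m ^+ 2 = s - 2 * m * m + m ^+ 2 * 1)%R by ring.
Qed.

End Jensen.

(** * Square-integrable functions and fields, and their inner product *)

Section L2.
Variable R : realType.
Notation mu := (@leb2 R).
Notation mR2 := (measurableTypeR R * measurableTypeR R)%type.
Implicit Types (E : set mR2) (f g : R * R -> R) (s t : R * R -> R * R).

Lemma L2_measurable E f : measurable E -> L2 E f -> measurable_fun E f.
Proof.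
by move=> mE /sub_Lfun_mfun /set_mem mf; exact/(measurable_restrictT _ mE).
Qed.

Lemma L2_integrableM E f g : measurable E -> L2 E f -> L2 E g ->
  mu.-integrable E (EFin \o (fun x => f x * g x)).
Proof.
move=> mE lf lg; have /Lfun1_integrable := Lfun2_mul_Lfun1 lf lg.
move=> fg; apply/(integrable_mkcond _ mE); move: fg; congr (_.-integrable _ _).
apply/funext => x/=; rewrite !patchE; case: ifPn => //= _; by rewrite mulr0.
Qed.

Lemma L2I E f : measurable E -> measurable_fun E f ->
  (\int[mu]_(x in E) (f x ^+ 2)%:E < +oo)%E -> L2 E f.
Proof.
move=> mE mf f2; rewrite /L2; apply/andP; split; rewrite inE/=.
  exact/(measurable_restrictT _ mE).
rewrite /finite_norm unlock /=.
apply: poweR_lty; move: f2; rewrite integral_mkcond.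
congr (_ < _)%E; apply: eq_integral => x _.
rewrite !patchE; case: ifPn => //= _; first by rewrite powR_mulrn// real_normK ?num_real.
by rewrite normr0 powR0.
Qed.

Lemma L2_lty E f : measurable E -> L2 E f ->
  (\int[mu]_(x in E) (f x ^+ 2)%:E < +oo)%E.
Proof.
move=> mE lf; have /integrableP[_] := L2_integrableM mE lf lf.
by under eq_integral => x _ do rewrite /= -expr2 ger0_norm ?sqr_ge0//.
Qed.

Lemma restrictD E f g : (f \+ g) \_ E = (f \_ E \+ g \_ E).
Proof.
by apply/funext => x/=; rewrite !patchE; case: ifPn => //; rewrite addr0.
Qed.

Lemma restrictZ E (a : R) f : (fun x => a * f x) \_ E = (a \*o (f \_ E)).
Proof.
by apply/funext => x/=; rewrite !patchE; case: ifPn => //; rewrite mulr0.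
Qed.

Lemma L2_scale E (a : R) f : L2 E f -> L2 E (fun x => a * f x).
Proof.
move=> lf; rewrite /L2 restrictZ.
have := @Lfun_scale _ _ _ mu (f \_ E) a 2 (ler1n _ 2) lf.
suff -> : a \o* f \_ E = a \*o f \_ E by [].
by apply/funext => x/=; rewrite mulrC.
Qed.

Lemma L2_add E f g : L2 E f -> L2 E g -> L2 E (fun x => f x + g x).
Proof.
move=> lf lg; rewrite /L2 (restrictD E f g).
have le12 : (1 <= 2%:E :> \bar R)%E by rewrite lee_fin ler1n.
exact: (rpredD (S := Lfun mu 2%:E) lf lg).
Qed.

Lemma L2_sub E f g : L2 E f -> L2 E g -> L2 E (fun x => f x - g x).
Proof.
move=> lf lg; have := L2_add lf (L2_scale (-1) lg).
by congr (L2 _ _); apply/funext => x; rewrite mulN1r.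
Qed.

Lemma L2_bounded E f (M : R) : measurable E -> (mu E < +oo)%E ->
  measurable_fun E f -> (forall x, E x -> `|f x| <= M) -> L2 E f.
Proof.
move=> mE Efin mf fM; apply: L2I => //.
apply: (@le_lt_trans _ _ (\int[mu]_(x in E) (cst (M ^+ 2)%:E x))%E).
  apply: ge0_le_integral => //.
  - by move=> x _; rewrite lee_fin sqr_ge0.
  - by apply/measurable_EFinP; exact: measurable_funX.
  - move=> x Ex; rewrite lee_fin -[f x ^+ 2]real_normK ?num_real// ler_sqr ?nnegrE//.
      exact: fM.
    by rewrite (le_trans _ (fM _ Ex)).
by rewrite integral_cst// lte_mul_pinfty// lee_fin sqr_ge0.
Qed.

Lemma L2_cst E (a : R) : measurable E -> (mu E < +oo)%E -> L2 E (cst a).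
Proof. by move=> mE Efin; apply: (@L2_bounded _ _ `|a|). Qed.

Lemma L2_integrable E f : measurable E -> (mu E < +oo)%E -> L2 E f ->
  mu.-integrable E (EFin \o f).
Proof.
move=> mE Efin lf; have := L2_integrableM mE lf (L2_cst 1 mE Efin).
by congr (_.-integrable _ _); apply/funext => x/=; rewrite mulr1.
Qed.

Lemma L2_ext E f g : {in E, f =1 g} -> L2 E f -> L2 E g.
Proof.
move=> fg; suff fgE : f \_ E = g \_ E by rewrite /L2 fgE.
by apply/funext => x; rewrite !patchE; case: ifPn => // /fg.
Qed.

Definition ip E s t : R := int2 E (fun x => dot (s x) (t x)).

Lemma dot_integrable E s t : measurable E -> L2vec E s -> L2vec E t ->
  mu.-integrable E (EFin \o (fun x => dot (s x) (t x))).
Proof.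
move=> mE [s1 s2] [t1 t2].
have := integrableD mE (L2_integrableM mE s1 t1) (L2_integrableM mE s2 t2).
by apply: eq_integrable.
Qed.

Lemma dotC (x y : R * R) : dot x y = dot y x.
Proof. by rewrite /dot mulrC [x.2 * _]mulrC. Qed.

Lemma dotZl (a : R) (x y : R * R) : dot (a *: x) y = a * dot x y.
Proof. by rewrite /dot mulrDr !mulrA. Qed.

Lemma dotDl (x y z : R * R) : dot (x + y) z = dot x z + dot y z.
Proof. by rewrite /dot !mulrDl addrACA. Qed.

Lemma dot_ge0 (x : R * R) : 0 <= dot x x.
Proof. by rewrite addr_ge0// -expr2 sqr_ge0. Qed.

Lemma ipC E s t : ip E s t = ip E t s.
Proof. by rewrite /ip; congr (int2 _ _); apply/funext => x; exact: dotC. Qed.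

Lemma L2vecZ E (a : R) s : L2vec E s -> L2vec E (a \*: s).
Proof. by case=> s1 s2; split; exact: L2_scale. Qed.

Lemma L2vecD E s t : L2vec E s -> L2vec E t -> L2vec E (s \+ t).
Proof. by case=> s1 s2 [t1 t2]; split; exact: L2_add. Qed.

Lemma ipZl E (a : R) s t : measurable E -> L2vec E s -> L2vec E t ->
  ip E (a \*: s) t = a * ip E s t.
Proof.
move=> mE ls lt; rewrite /ip /int2 -RintegralZl//; last exact: dot_integrable.
by apply: eq_Rintegral => x _; rewrite dotZl.
Qed.

Lemma ipDl E s s' t : measurable E -> L2vec E s -> L2vec E s' -> L2vec E t ->
  ip E (s \+ s') t = ip E s t + ip E s' t.
Proof.
move=> mE ls ls' lt; rewrite /ip /int2 -RintegralD//; try exact: dot_integrable.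
by apply: eq_Rintegral => x _; rewrite dotDl.
Qed.

Lemma ip_ge0 E s : 0 <= ip E s s.
Proof. by apply: Rintegral_ge0 => x _; exact: dot_ge0. Qed.

Lemma ip_cauchy_schwarz E s t : measurable E -> L2vec E s -> L2vec E t ->
  ip E s t ^+ 2 <= ip E s s * ip E t t.
Proof.
move=> mE ls lt; apply: quadratic_ge0_discr => a.
have := ip_ge0 E (s \+ (a \*: t)).
have la := L2vecZ a lt.
rewrite ipDl//; last exact: L2vecD.
rewrite ipZl//; last exact: L2vecD.
rewrite ![ip E _ (s \+ _)]ipC !ipDl// !ipZl// [ip E t s]ipC.
by congr (0 <= _); ring.
Qed.

Lemma L2normE E s : L2norm E s = Num.sqrt (ip E s s).
Proof. by []. Qed.

Lemma sqr_L2norm E s : L2norm E s ^+ 2 = ip E s s.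
Proof. by rewrite sqr_sqrtr ?ip_ge0. Qed.

Lemma ip_le_norm E s t : measurable E -> L2vec E s -> L2vec E t ->
  `|ip E s t| <= L2norm E s * L2norm E t.
Proof.
move=> mE ls lt; rewrite -ler_sqr ?nnegrE ?mulr_ge0 ?sqrtr_ge0//.
rewrite exprMn !sqr_L2norm real_normK ?num_real//.
exact: ip_cauchy_schwarz.
Qed.

End L2.

(** * Affine changes of variables in the plane *)

Section ChangeOfVariables.
Variable R : realType.
Notation mR := (measurableTypeR R).
Notation mR2 := (mR * mR)%type.
Notation mu := (@lebesgue_measure R).
Notation leb2 := (@leb2 R).
Implicit Type f : mR2 -> \bar R.
Local Open Scope ereal_scope.

Lemma measurable_affine2 (a b c : R) :
  measurable_fun [set: mR2] (fun x => a * x.1 + b * x.2 + c : mR)%R.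
Proof.
apply: measurable_funD => //; apply: measurable_funD => //.
  by apply: measurable_funM => //; exact: measurable_fst.
by apply: measurable_funM => //; exact: measurable_snd.
Qed.

Lemma measurable_affine_map (a b c a' b' c' : R) :
  measurable_fun [set: mR2]
    (fun x : mR2 => (a * x.1 + b * x.2 + c, a' * x.1 + b' * x.2 + c') : mR2)%R.
Proof. by apply: measurable_fun_pair; exact: measurable_affine2. Qed.

Lemma measurable_integral1 f : measurable_fun setT f -> (forall x, 0 <= f x) ->
  measurable_fun [set: mR] (fun x => \int[mu]_y f (x, y)).
Proof. by move=> mf f0; exact: (@measurable_fun_fubini_tonelli_F _ _ mR mR R mu f mf f0). Qed.

Lemma measurable_slice1 f (x : R) : measurable_fun setT f ->
  measurable_fun [set: mR] (fun y => f (x, y)).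
Proof. by move=> mf; apply: measurableT_comp => //; exact: measurable_fun_pair. Qed.

Lemma measurable_slice2 f (y : R) : measurable_fun setT f ->
  measurable_fun [set: mR] (fun x => f (x, y)).
Proof. by move=> mf; apply: measurableT_comp => //; exact: measurable_fun_pair. Qed.

Lemma leb2_scale (a : R) (b : R * R) f : a != 0%R ->
  measurable_fun setT f -> (forall x, 0 <= f x) ->
  \int[leb2]_x f x = (a ^+ 2)%:E * \int[leb2]_x f (a * x.1 + b.1, a * x.2 + b.2)%R.
Proof.
move=> a0 mf f0.
have mg : measurable_fun [set: mR2] (fun x : mR2 => f (x.1, a * x.2 + b.2)%R).
  apply: measurableT_comp => //; have := measurable_affine_map 1 0 0 0 a b.2.
  by congr (measurable_fun _ _); apply/funext => x; rewrite mul1r !mul0r !addr0 add0r.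
have mh : measurable_fun [set: mR2] (fun x : mR2 => f (a * x.1 + b.1, a * x.2 + b.2)%R).
  apply: measurableT_comp => //; have := measurable_affine_map a 0 b.1 0 a b.2.
  by congr (measurable_fun _ _); apply/funext => x; rewrite !mul0r !addr0 add0r.
rewrite (@leb2_tonelli1 _ f)// (@leb2_tonelli1 _ (fun x => f (_, _)))//=.
under eq_integral => x _.
  rewrite (ge0_integral_affine b.2 a0) => [||//]; last exact: measurable_slice1.
  over.
rewrite ge0_integralZl//=; last 2 first.
- exact: (measurable_integral1 mg).
- by move=> x _; exact: integral_ge0.
rewrite (ge0_integral_affine b.1 a0) => [||x]; last 2 first.
- exact: (measurable_integral1 mg).
- exact: integral_ge0.
by rewrite muleA -EFinM -normrM -expr2 ger0_norm ?sqr_ge0.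
Qed.

(** Two one-dimensional substitutions separated by Tonelli. At fixed abscissa the ordinate is
    measured from the line through [c] directed by [q], not vertical since [q.1 != 0]; then, at
    fixed [r], the abscissa is parametrised by [w]. The factors [- D / q.1] and [q.1] multiply to
    [- D]. *)
Lemma leb2_linear_aux (c p q : R * R) f :
  (p.1 * q.2 - p.2 * q.1)%R != 0%R -> q.1 != 0%R ->
  measurable_fun setT f -> (forall x, 0 <= f x) ->
  \int[leb2]_x f x = `|p.1 * q.2 - p.2 * q.1|%:E *
    \int[leb2]_x f (c.1 + x.1 * p.1 + x.2 * q.1, c.2 + x.1 * p.2 + x.2 * q.2)%R.
Proof.
set D := (_ - _)%R => D0 q0 mf f0.
pose a := (- D / q.1)%R; pose l x := (c.2 + q.2 * (x - c.1) / q.1)%R.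
have a0 : a != 0%R by rewrite mulf_neq0 ?oppr_eq0 ?invr_eq0.
have mg : measurable_fun [set: mR2] (fun x : mR2 => f (x.1, a * x.2 + l x.1)%R).
  apply: measurableT_comp => //.
  have := measurable_affine_map 1 0 0 (q.2 / q.1) a (c.2 - q.2 * c.1 / q.1).
  congr (measurable_fun _ _); apply/funext => x.
  by rewrite mul1r mul0r !addr0; congr pair; rewrite /l; field.
have mh : measurable_fun [set: mR2] (fun x : mR2 =>
    f (c.1 + x.1 * p.1 + x.2 * q.1, c.2 + x.1 * p.2 + x.2 * q.2)%R).
  apply: measurableT_comp => //; have := measurable_affine_map p.1 q.1 c.1 p.2 q.2 c.2.
  by congr (measurable_fun _ _); apply/funext => x; congr pair; ring.
rewrite (@leb2_tonelli1 _ f)//.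
under eq_integral => x _.
  rewrite (ge0_integral_affine (l x) a0) => [||//]; last exact: measurable_slice1.
  over.
rewrite ge0_integralZl//=; last 2 first.
- exact: (measurable_integral1 mg).
- by move=> x _; exact: integral_ge0.
have -> : \int[mu]_x \int[mu]_r f (x, a * r + l x)%R =
    \int[mu]_r \int[mu]_x f (x, a * r + l x)%R.
  by rewrite -(leb2_tonelli1 mg)// (leb2_tonelli2 mg).
under eq_integral => r _.
  rewrite (ge0_integral_affine (c.1 + r * p.1)%R q0) => [||//]; last first.
    exact: (@measurable_slice2 (fun x : mR2 => f (x.1, a * x.2 + l x.1)%R)).
  under eq_integral => w _.
    rewrite (_ : (q.1 * w + (c.1 + r * p.1), a * r + l (q.1 * w + (c.1 + r * p.1))) =
      (c.1 + r * p.1 + w * q.1, c.2 + r * p.2 + w * q.2))%R; last first.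
      by congr pair; rewrite /a /l /D; [ring|field].
    over.
  over.
rewrite ge0_integralZl//=; last 2 first.
- exact: (measurable_integral1 mh).
- by move=> x _; exact: integral_ge0.
by rewrite (leb2_tonelli1 mh)// muleA -EFinM -normrM /a divfK// normrN.
Qed.

(** If [q.1 = 0] then [q.2 != 0], and exchanging the coordinates reduces to the previous case. *)
Lemma leb2_linear (c p q : R * R) f :
  (p.1 * q.2 - p.2 * q.1)%R != 0%R ->
  measurable_fun setT f -> (forall x, 0 <= f x) ->
  \int[leb2]_x f x = `|p.1 * q.2 - p.2 * q.1|%:E *
    \int[leb2]_x f (c.1 + x.1 * p.1 + x.2 * q.1, c.2 + x.1 * p.2 + x.2 * q.2)%R.
Proof.
move=> D0 mf f0; have [q0|] := eqVneq q.1 0%R; last first.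
  by move=> q0; exact: leb2_linear_aux.
have q2 : q.2 != 0%R.
  by apply: contraNneq D0 => q2; rewrite q2 q0 !mulr0 subrr.
have mswap : measurable_fun [set: mR2] (fun x : mR2 => f (x.2, x.1)).
  by apply: measurableT_comp => //; exact: measurable_fun_pair.
rewrite (leb2_tonelli2 mf)// -(leb2_tonelli1 mswap)//.
rewrite (@leb2_linear_aux (c.2, c.1) (p.2, p.1) (q.2, q.1))//=; last first.
  by rewrite -oppr_eq0 opprB.
by rewrite distrC.
Qed.

End ChangeOfVariables.

Lemma is_diff0_quadratic (R : realType) (V W : normedModType R) (g : V -> W)
    (x : V) (C : R) :
  (forall k, `|g (k + x) - g x| <= C * `|k| ^+ 2) -> is_diff x g (\0 : V -> W).
Proof.
move=> gC.
have c0 : continuous (\0 : {linear V -> W}) by move=> y; exact: cvg_cst.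
have eqg : g \o shift x = cst (g x) + (\0 : {linear V -> W}) +o_ 0 id.
  apply/eqaddoP => e e0.
  near=> k.
  have -> : (g \o shift x - (cst (g x) + (\0 : {linear V -> W}))) k =
    g (k + x) - g x by rewrite /= !fctE /= addr0.
  rewrite (le_trans (gC k))// expr2 mulrA ler_wpM2r//.
  have C0 : 0 < `|C| + 1 by rewrite ltr_wpDl.
  apply: (@le_trans _ _ ((`|C| + 1) * `|k|)).
    by rewrite ler_wpM2r// (le_trans (ler_norm _))// lerDl.
  rewrite -ler_pdivlMl// mulrC; apply: ltW; near: k.
  by apply: nbhs0_lt; rewrite divr_gt0.
have du := diff_unique c0 eqg.
by apply: DiffDef => //; apply/diff_locallyP; rewrite du; split.
Unshelve. all: by end_near. Qed.

(** * Smooth functions *)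

Section Smooth.
Variable R : realType.
Implicit Types (f g : R * R -> R) (x k : R * R).

Lemma pair_ext x k : x.1 = k.1 -> x.2 = k.2 -> x = k.
Proof. by case: x k => a b [c d] /= -> ->. Qed.

Lemma differentiable_fst x : differentiable (@fst R R) x.
Proof.
by apply: (@linear_differentiable _ _ _ (@fst R R : {linear (R * R)%type -> R})) => y; exact: cvg_fst.
Qed.

Lemma differentiable_snd x : differentiable (@snd R R) x.
Proof.
by apply: (@linear_differentiable _ _ _ (@snd R R : {linear (R * R)%type -> R})) => y; exact: cvg_snd.
Qed.

Lemma diff_fst x k : 'd (@fst R R) x k = k.1.
Proof.
by rewrite (@diff_lin _ _ _ (@fst R R : {linear (R * R)%type -> R}))// => y; exact: cvg_fst.
Qed.

Lemma diff_snd x k : 'd (@snd R R) x k = k.2.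
Proof.
by rewrite (@diff_lin _ _ _ (@snd R R : {linear (R * R)%type -> R}))// => y; exact: cvg_snd.
Qed.

Lemma partialE i f x : differentiable f x -> partial i f x = 'd f x (Defs.basis R i).
Proof. by move=> df; rewrite /partial deriveE. Qed.

Lemma diffE_partial f x k : differentiable f x ->
  'd f x k = k.1 * partial false f x + k.2 * partial true f x.
Proof.
move=> df; rewrite !partialE//.
have {1}-> : k = k.1 *: Defs.basis R false + k.2 *: Defs.basis R true.
  by apply: pair_ext; rewrite /Defs.basis/= /GRing.scale/= !mulr0 !mulr1 ?addr0 ?add0r.
by rewrite linearD !linearZ.
Qed.

Lemma partial_fst i x : partial i fst x = (~~ i)%:R :> R.
Proof. by rewrite partialE ?diff_fst//; [case: i|exact: differentiable_fst]. Qed.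

Lemma partial_snd i x : partial i snd x = i%:R :> R.
Proof. by rewrite partialE ?diff_snd//; [case: i|exact: differentiable_snd]. Qed.

Lemma partial_cst i (a : R) x : partial i (cst a) x = 0.
Proof. by rewrite /partial derive_cst. Qed.

Lemma partialD i f g x : differentiable f x -> differentiable g x ->
  partial i (fun y => f y + g y) x = partial i f x + partial i g x.
Proof. by move=> df dg; rewrite /partial (deriveD (diff_derivable df) (diff_derivable dg)). Qed.

Lemma partialM i f g x : differentiable f x -> differentiable g x ->
  partial i (fun y => f y * g y) x = partial i f x * g x + f x * partial i g x.
Proof.
move=> df dg; rewrite /partial (deriveM (diff_derivable df) (diff_derivable dg)).
by rewrite addrC mulrC.
Qed.

Lemma partialZ i (a : R) f x : differentiable f x ->
  partial i (fun y => a * f y) x = a * partial i f x.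
Proof.
move=> df; rewrite (@partialM i (cst a) f)//.
by rewrite partial_cst mul0r add0r.
Qed.

(** Subtracting the linear form [l] leaves an increment of order |k|^2, hence a zero differential.
    Convolutions and quadratic polynomials are differentiated in this way, from an explicit Taylor
    remainder. *)
Lemma quadratic_diff f x (a b C : R) :
  (forall k, `|f (x + k) - f x - (k.1 * a + k.2 * b)| <= C * `|k| ^+ 2) ->
  [/\ differentiable f x, partial false f x = a & partial true f x = b].
Proof.
move=> fC; pose l y := a * y.1 + b * y.2; pose g y := f y - l y.
have dl : differentiable l x.
  by apply: differentiableD; apply: differentiableM => //; [exact: differentiable_fst|exact: differentiable_snd].
have dg : is_diff x g (\0 : R * R -> R).
  apply: (@is_diff0_quadratic R _ _ g x C) => k; have := fC k; rewrite [x + k]addrC.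
  by congr (`|_| <= _); rewrite /g /l/=; ring.
have fE : f = (fun y => g y + l y) by apply/funext => y; rewrite /g subrK.
have dg' : differentiable g x by [].
have pg i : partial i g x = 0 by rewrite partialE// diff_val.
have pl i : partial i l x = if i then b else a.
  rewrite /l partialD ?partialZ ?partial_fst ?partial_snd//;
    do ?[exact: differentiable_fst|exact: differentiable_snd].
  - by case: i; rewrite ?mulr1 ?mulr0 ?addr0 ?add0r.
  - by apply: differentiableM => //; exact: differentiable_fst.
  - by apply: differentiableM => //; exact: differentiable_snd.
split; first by rewrite fE; exact: differentiableD.
- by rewrite fE partialD// pg pl add0r.
- by rewrite fE partialD// pg pl add0r.
Qed.

Lemma smooth_differentiable f x : smooth f -> differentiable f x.
Proof. by move=> /(_ [::]). Qed.

Lemma smooth_partial i f : smooth f -> smooth (partial i f).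
Proof. by move=> sf s x; have := sf (rcons s i) x; rewrite foldr_rcons. Qed.

Lemma smooth_continuous f : smooth f -> continuous f.
Proof. by move=> sf x; apply: differentiable_continuous; exact: smooth_differentiable. Qed.

(** Coinduction principle: smoothness is the largest class of differentiable functions stable under
    both partial derivatives. *)
Lemma smooth_coind (C : (R * R -> R) -> Prop) :
  (forall f x, C f -> differentiable f x) ->
  (forall f i, C f -> C (partial i f)) -> forall f, C f -> smooth f.
Proof.
move=> Cd Cp f Cf s x; apply: Cd.
by elim: s => //= i s; exact: Cp.
Qed.

(* The algebra generated by smooth functions is stable under partial derivatives,
   whereas the set of products of two smooth functions is not. *)
Inductive smooth_alg : (R * R -> R) -> Prop :=
| salg_smooth f : smooth f -> smooth_alg f
| salg_add f g : smooth_alg f -> smooth_alg g -> smooth_alg (fun x => f x + g x)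
| salg_mul f g : smooth_alg f -> smooth_alg g -> smooth_alg (fun x => f x * g x).

Lemma smooth_algP f : smooth_alg f -> smooth f.
Proof.
have sd g x : smooth_alg g -> differentiable g x.
  elim=> {g} [g /smooth_differentiable //|f1 f2 _ h1 _ h2|f1 f2 _ h1 _ h2].
    exact: differentiableD.
  exact: differentiableM.
apply: smooth_coind => // g i; elim=> {g} [g sg|f1 f2 s1 h1 s2 h2|f1 f2 s1 h1 s2 h2].
- exact/salg_smooth/smooth_partial.
- rewrite (_ : partial _ _ = fun x => partial i f1 x + partial i f2 x).
    exact: salg_add.
  by apply/funext => x; rewrite partialD//; exact: sd.
- rewrite (_ : partial _ _ = fun x => partial i f1 x * f2 x + f1 x * partial i f2 x).
    by apply: salg_add; exact: salg_mul.
  by apply/funext => x; rewrite partialM//; exact: sd.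
Qed.

Lemma smoothD f g : smooth f -> smooth g -> smooth (fun x => f x + g x).
Proof. by move=> sf sg; apply: smooth_algP; apply: salg_add; exact: salg_smooth. Qed.

Lemma smoothM f g : smooth f -> smooth g -> smooth (fun x => f x * g x).
Proof. by move=> sf sg; apply: smooth_algP; apply: salg_mul; exact: salg_smooth. Qed.

Lemma smooth_cst (a : R) : smooth (cst a : R * R -> R).
Proof.
apply: (@smooth_coind (fun f => exists a, f = cst a)); last by exists a.
- by move=> f x [b ->].
- by move=> f i [b ->]; exists 0; apply/funext => x; rewrite partial_cst.
Qed.

Lemma smooth_fst : smooth (@fst R R).
Proof.
apply: (@smooth_coind (fun f => f = fst \/ smooth f)); last by left.
- by move=> f x [->|/smooth_differentiable//]; exact: differentiable_fst.
- move=> f i [->|]; last by right; exact: smooth_partial.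
  right; rewrite (_ : partial _ _ = cst (~~ i)%:R); first exact: smooth_cst.
  by apply/funext => x; rewrite partial_fst.
Qed.

Lemma smooth_snd : smooth (@snd R R).
Proof.
apply: (@smooth_coind (fun f => f = snd \/ smooth f)); last by left.
- by move=> f x [->|/smooth_differentiable//]; exact: differentiable_snd.
- move=> f i [->|]; last by right; exact: smooth_partial.
  right; rewrite (_ : partial _ _ = cst i%:R); first exact: smooth_cst.
  by apply/funext => x; rewrite partial_snd.
Qed.

Lemma smoothZ (a : R) f : smooth f -> smooth (fun x => a * f x).
Proof. by move=> sf; apply: (@smoothM (cst a)) => //; exact: smooth_cst. Qed.

Lemma affine_differentiable (a : R) (b : R * R) x :
  differentiable (fun y : R * R => a *: y + b) x.
Proof. by apply: differentiableD => //; apply: differentiableZ. Qed.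

Lemma partial_affine i f (a : R) (b x : R * R) : differentiable f (a *: x + b) ->
  partial i (fun y => f (a *: y + b)) x = a * partial i f (a *: x + b).
Proof.
move=> df; rewrite (partialE i df).
have -> : a * 'd f (a *: x + b) (Defs.basis R i) = 'd f (a *: x + b) (a *: Defs.basis R i).
  by rewrite linearZ.
rewrite -deriveE// /partial /derive; set v := Defs.basis R i.
have hE : (fun h : R => h^-1 *: (f (a *: (h *: v + x) + b) - f (a *: x + b))) =
    (fun h : R => h^-1 *: (f (h *: (a *: v) + (a *: x + b)) - f (a *: x + b))).
  apply/funext => h; congr (_ *: (f _ - _)).
  by rewrite scalerDr addrA !scalerA mulrC.
by rewrite /= hE.
Qed.

Lemma smooth_affine f (a : R) (b : R * R) : smooth f -> smooth (fun x => f (a *: x + b)).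
Proof.
move=> sf; apply: (@smooth_coind (fun h => exists c g, smooth g /\
   h = (fun x => c * g (a *: x + b)))); last by exists 1, f; split => //; apply/funext => x; rewrite mul1r.
- move=> h x [c [g [sg ->]]].
  apply: (@differentiableM _ _ (cst c) (fun x => g (a *: x + b))) => //.
  apply: (@differentiable_comp _ _ _ _ (fun y : R * R => a *: y + b) g).
    exact: affine_differentiable.
  exact: smooth_differentiable.
- move=> h i [c [g [sg ->]]]; exists (c * a), (partial i g); split.
    exact: smooth_partial.
  apply/funext => x; rewrite partialZ ?partial_affine ?mulrA//.
    exact: smooth_differentiable.
  apply: (@differentiable_comp _ _ _ _ (fun y : R * R => a *: y + b) g).
    exact: affine_differentiable.
  exact: smooth_differentiable.
Qed.

Lemma is_derive_line f x k (t : R) : differentiable f (x + t *: k) ->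
  is_derive t 1 (fun t => f (x + t *: k))
    (k.1 * partial false f (x + t *: k) + k.2 * partial true f (x + t *: k)).
Proof.
move=> df; rewrite -diffE_partial//.
have hE : (fun h : R => h^-1 *: (f (x + (h *: (1 : R) + t) *: k) - f (x + t *: k))) =
    (fun h : R => h^-1 *: (f (h *: k + (x + t *: k)) - f (x + t *: k))).
  apply/funext => h; congr (_ *: (f _ - _)).
  by rewrite scalerDl addrCA; congr (_ *: k + _); rewrite /GRing.scale/= mulr1.
have dk : derivable f (x + t *: k) k by exact: diff_derivable.
apply: DeriveDef; first by rewrite /derivable; rewrite hE.
by rewrite -deriveE// /derive; rewrite hE.
Qed.

Lemma lipschitz_partial f (M : R) x k :
  (forall y, differentiable f y) -> (forall i y, `|partial i f y| <= M) ->
  `|f (x + k) - f x| <= 2 * M * `|k|.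
Proof.
move=> df fM.
have [||c _] := @MVT_segment R (fun t => f (x + t *: k))
   (fun t => k.1 * partial false f (x + t *: k) + k.2 * partial true f (x + t *: k)) 0 1 ler01.
- by move=> t _; exact: is_derive_line.
- apply: continuous_subspaceT => t; apply: differentiable_continuous.
  by apply/derivable1_diffP; have [] := is_derive_line (df (x + t *: k)).
rewrite scale1r scale0r addr0 subr0 mulr1 => ->.
rewrite (le_trans (ler_normD _ _))// !normrM.
have k1 : `|k.1| <= `|k| by rewrite prod_normE/= le_max lexx.
have k2 : `|k.2| <= `|k| by rewrite prod_normE/= le_max lexx orbT.
have -> : 2 * M * `|k| = `|k| * M + `|k| * M by ring.
by apply: lerD; apply: ler_pM.
Qed.

(** The mean value theorem gives the increment as a derivative at an intermediate point, and the
    Lipschitz bound on each partial derivative moves this point to [x]. The constant is 4 = 2 * 2: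
    two coordinates, each with Lipschitz constant 2 M in the max norm. *)
Lemma taylor_partial f (M : R) x k : smooth f ->
  (forall i j y, `|partial i (partial j f) y| <= M) ->
  `|f (x + k) - f x - (k.1 * partial false f x + k.2 * partial true f x)| <=
    4 * M * `|k| ^+ 2.
Proof.
move=> sf fM.
have [||c] := @MVT_segment R (fun t => f (x + t *: k))
   (fun t => k.1 * partial false f (x + t *: k) + k.2 * partial true f (x + t *: k)) 0 1 ler01.
- by move=> t _; apply: is_derive_line; exact: smooth_differentiable.
- apply: continuous_subspaceT => t; apply: differentiable_continuous.
  by apply/derivable1_diffP; have [] := is_derive_line (smooth_differentiable (x + t *: k) sf).
rewrite in_itv/= => /andP[c0 c1].
rewrite scale1r scale0r addr0 subr0 mulr1 => ->.
have M0 : 0 <= M by exact: le_trans (fM true true x).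
have lip i : `|partial i f (x + c *: k) - partial i f x| <= 2 * M * `|k|.
  apply: (le_trans (@lipschitz_partial (partial i f) M x (c *: k) _ _)) => //.
    by move=> y; apply: smooth_differentiable; exact: smooth_partial.
  rewrite ler_wpM2l ?mulr_ge0//.
  by rewrite normrZ ger0_norm// ler_piMl.
rewrite (_ : _ - _ = k.1 * (partial false f (x + c *: k) - partial false f x) +
   k.2 * (partial true f (x + c *: k) - partial true f x)); last by ring.
rewrite (le_trans (ler_normD _ _))// !normrM.
have k1 : `|k.1| <= `|k| by rewrite prod_normE/= le_max lexx.
have k2 : `|k.2| <= `|k| by rewrite prod_normE/= le_max lexx orbT.
have -> : 4 * M * `|k| ^+ 2 = `|k| * (2 * M * `|k|) + `|k| * (2 * M * `|k|) by ring.
by apply: lerD; apply: ler_pM.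
Qed.

End Smooth.

(** * Smooth functions built from exp (- 1 / t) *)

Section Bump.
Variable R : realType.

(* The derivative of [p (1 / t) exp (- 1 / t)] has the same form, with [p]
   replaced by [X^2 (p - p')]. *)
Definition expinv (p : {poly R}) (t : R) : R :=
  if 0 < t then p.[t^-1] * expR (- t^-1) else 0.

Definition expinv_der (p : {poly R}) : {poly R} := 'X^2 * (p - p^`()).

Lemma poly_le_norm (p : {poly R}) (s : R) : 1 <= s ->
  `|p.[s]| <= (\sum_(i < size p) `|p`_i|) * s ^+ size p.
Proof.
move=> s1; have s0 : 0 <= s by exact: le_trans s1.
rewrite horner_coef mulr_suml (le_trans (ler_norm_sum _ _ _))//.
apply: ler_sum => i _; rewrite normrM ler_wpM2l// ger0_norm ?exprn_ge0//.
by rewrite ler_weXn2l// ltnW.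
Qed.

(** With s = 1 / t, one term of the exponential series gives exp (- s) <= (n + 1)! s^-(n + 1). The
    exponent n + 1 exceeds [size p] by two, and the two spare powers of 1 / s are the factor t^2. *)
Lemma expinv_quadratic (p : {poly R}) : exists C, forall t, `|t| <= 1 ->
  `|expinv p t| <= C * t ^+ 2.
Proof.
pose S := \sum_(i < size p) `|p`_i|; pose n := (size p).+1.
have S0 : 0 <= S by exact: sumr_ge0.
exists (S * n.+1`!%:R) => t t1; rewrite /expinv.
case: ltP => [t0|_]; last by rewrite normr0 mulr_ge0 ?sqr_ge0// mulr_ge0// ler0n.
have st : 1 <= t^-1 by rewrite invf_ge1// -(gtr0_norm t0).
have s0 : 0 < t^-1 by rewrite invr_gt0.
set s := t^-1 in st s0 *.
rewrite normrM [`|expR _|]ger0_norm ?expR_ge0//.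
have e1 : expR (- s) <= n.+1`!%:R * s ^- n.+1.
  rewrite expRN -[leRHS]invrK lef_pV2 ?posrE ?expR_gt0 ?invr_gt0 ?mulr_gt0 ?invr_gt0 ?exprn_gt0 ?ltr0n ?fact_gt0//.
  rewrite invfM invrK mulrC (le_trans _ (expR_ge1Dxn n (ltW s0)))//.
  by rewrite lerDr.
apply: (@le_trans _ _ ((S * s ^+ size p) * (n.+1`!%:R * s ^- n.+1))).
  by apply: ler_pM => //; exact: poly_le_norm.
rewrite -!mulrA ler_wpM2l// mulrCA ler_wpM2l ?ler0n//.
rewrite /n exprS exprS invfM invfM mulrCA [s ^+ _ * _]mulrCA divff ?expf_neq0 ?gt_eqF//.
by rewrite mulr1 /s invrK expr2.
Qed.

Lemma is_derive_expinv (p : {poly R}) (t : R) :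
  is_derive t 1 (expinv p) (expinv (expinv_der p) t).
Proof.
have [t0|t0|->] := ltgtP t 0.
- rewrite {2}/expinv ltNge ltW//=.
  apply: (@near_eq_is_derive _ _ _ (cst 0)).
  near=> u; rewrite /expinv ltNge ltW//=.
  by near: u; exact: lt_nbhsl.
- rewrite {2}/expinv t0.
  pose f (u : R) : R := p.[u^-1] * expR (- u^-1).
  apply: (@near_eq_is_derive _ _ _ f).
    by near=> u; rewrite /expinv ifT//; near: u; exact: lt_nbhsr.
  have tn : t != 0 by rewrite gt_eqF.
  have dv : is_derive t 1 (fun t : R => t^-1) (- t ^- 2).
    by have := @is_deriveV R id t 1 1 tn (is_derive_id _ _); rewrite /GRing.scale/= mulr1.
  have dp : is_derive t 1 (fun t => p.[t^-1]) (p^`().[t^-1] * - t ^- 2).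
    exact: is_derive1_comp.
  have de : is_derive t 1 (fun t : R => expR (- t^-1)) (expR (- t^-1) * t ^- 2).
    have dn : is_derive t 1 (fun t : R => - t^-1) (t ^- 2).
      by have := is_deriveN dv; rewrite opprK.
    exact: is_derive1_comp.
  have := is_deriveM dp de; move=> H; apply: (is_derive_eq H).
  rewrite /expinv_der !hornerE /GRing.scale/= -exprVn; ring.
rewrite {2}/expinv ltxx.
(* At the origin the difference quotient is bounded by C |h|, so the derivative is zero. *)
have [C hC] := expinv_quadratic p.
have e0 : expinv p 0 = 0 by rewrite /expinv ltxx.
have lim0 : (fun h : R => h^-1 *: (expinv p (h *: (1 : R) + 0) - expinv p 0)) @ 0^' --> (0 : R).
  apply: (@cvg_to_0_linear R _ C 1) => // h /andP[h0 h1].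
  rewrite e0 subr0 addr0 /GRing.scale/= mulr1 normrM normfV.
  rewrite ler_pdivrMl// (le_trans (hC _ (ltW h1)))//.
  by rewrite -real_normK ?num_real// expr2 mulrCA.
apply: DeriveDef; first by apply/cvg_ex; exists 0.
exact: cvg_lim.
Unshelve. all: by end_near. Qed.

Lemma expinv_differentiable p t : differentiable (expinv p) t.
Proof. by apply/derivable1_diffP; have [] := is_derive_expinv p t. Qed.

(** Coinduction on the functions [k * expinv q (l x)] with [l] affine: a partial derivative
    multiplies [k] by a coefficient of [l] and replaces [q] by [expinv_der q]. *)
Lemma smooth_expinv (p : {poly R}) (a b c : R) :
  smooth (fun x : R * R => expinv p (a * x.1 + b * x.2 + c)).
Proof.
pose l x : R := a * x.1 + b * x.2 + c.
have dl x : differentiable l x.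
  do 2 apply: differentiableD => //; apply: differentiableM => //; [exact: differentiable_fst|exact: differentiable_snd].
have pl i x : partial i l x = if i then b else a.
  rewrite /l !partialD ?partialZ ?partial_fst ?partial_snd ?(partial_cst _ c)//;
    do ?[exact: differentiable_fst|exact: differentiable_snd].
  - by case: i; rewrite ?mulr1 ?mulr0 ?addr0 ?add0r.
  - by apply: differentiableM => //; exact: differentiable_fst.
  - by apply: differentiableM => //; exact: differentiable_snd.
  - apply: differentiableD => //; apply: differentiableM => //; [exact: differentiable_fst|exact: differentiable_snd].
have pu (u : R -> R) i x (d : R) : is_derive (l x) 1 u d ->
    partial i (fun x => u (l x)) x = (if i then b else a) * d.
  move=> [du <-]; set e := (if i then b else a).
  have du' : differentiable u (l x) by exact/derivable1_diffP.
  have -> : e * 'D_1 u (l x) = 'D_e u (l x).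
    rewrite !deriveE//; have {2}-> : e = e *: (1 : R) by rewrite /GRing.scale/= mulr1.
    by rewrite linearZ.
  rewrite /partial /derive.
  have hE : (fun h : R => h^-1 *: (u (l (h *: Defs.basis R i + x)) - u (l x))) =
      (fun h : R => h^-1 *: (u (h *: e + l x) - u (l x))).
    apply/funext => h; congr (_ *: (u _ - _)).
    by rewrite /l /e /Defs.basis; case: i {e} => /=; rewrite /GRing.scale/=; ring.
  by rewrite /= hE.
apply: (@smooth_coind _ (fun f => exists k p, f = (fun x => k * expinv p (l x)))).
- move=> f x [k [q ->]].
  apply: (@differentiableM _ _ (cst k) (fun x => expinv q (l x))) => //.
  apply: (@differentiable_comp _ _ _ _ l (expinv q)) => //.
  exact: expinv_differentiable.
- move=> f i [k [q ->]]; exists (k * (if i then b else a)), (expinv_der q).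
  apply/funext => x; rewrite partialZ; last first.
    apply: (@differentiable_comp _ _ _ _ l (expinv q)) => //.
    exact: expinv_differentiable.
  by rewrite (pu _ _ _ _ (is_derive_expinv q (l x))) mulrA.
- by exists 1, p; apply/funext => x; rewrite mul1r.
Qed.

End Bump.

(** * A smooth density of mass one supported in the unit square *)

Section UnitBump.
Variable R : realType.
Notation mR := (measurableTypeR R).
Notation mR2 := (mR * mR)%type.
Notation leb2 := (@leb2 R).
Implicit Types (f g : R * R -> R) (x k : R * R).

Definition unit_square : set (R * R) := `[-1, 1]%classic `*` `[-1, 1]%classic.

Lemma unit_squareP x : unit_square x <-> `|x| <= 1.
Proof. by rewrite /unit_square/= !in_itv/= -!ler_norml prod_normE ge_max; split=> [[-> ->]|/andP[]]. Qed.

Lemma compact_unit_square : compact unit_square.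
Proof. by apply: compact_setX; exact: segment_compact. Qed.

Lemma continuous_bounded_supp f : continuous f -> (forall x, 1 < `|x| -> f x = 0) ->
  exists M, forall x, `|f x| <= M.
Proof.
move=> cf f0.
have cnf : {within unit_square, continuous (fun x => `|f x|)}.
  by apply: continuous_subspaceT => x; apply: cvg_norm; exact: cf.
have sq0 : unit_square !=set0.
  by exists 0; apply/unit_squareP; rewrite normr0.
have [c _ fc] := compact_EVT_max sq0 compact_unit_square cnf.
exists `|f c| => x; have [x1|x1] := leP `|x| 1; last by rewrite f0// normr0.
by apply: fc; rewrite inE; exact/unit_squareP.
Qed.

Lemma partial_supp i f : (forall x, 1 < `|x| -> f x = 0) ->
  forall x, 1 < `|x| -> partial i f x = 0.
Proof.
move=> f0 x x1; rewrite /partial (@near_eq_derive _ _ _ f (cst 0)) ?derive_cst//.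
near=> y; apply: f0; near: y.
exact: (cvgr_gt _ (@norm_continuous _ _ x)).
Unshelve. all: by end_near. Qed.

(** One factor for each side of the square, vanishing beyond that side. The zero coefficients are
    written out so that each factor has the shape treated by [smooth_expinv]. *)
Definition raw_bump x : R := expinv 1 (1 * x.1 + 0 * x.2 + 1) * expinv 1 (- 1 * x.1 + 0 * x.2 + 1) *
  (expinv 1 (0 * x.1 + 1 * x.2 + 1) * expinv 1 (0 * x.1 + - 1 * x.2 + 1)).

Lemma expinv1_ge0 (t : R) : 0 <= expinv 1 t.
Proof. by rewrite /expinv; case: ifP => // _; rewrite hornerC mul1r expR_ge0. Qed.

Lemma expinv1_le1 (t : R) : expinv 1 t <= 1.
Proof.
rewrite /expinv; case: ltP => // t0; rewrite hornerC mul1r.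
by rewrite -expR0 ler_expR oppr_le0 invr_ge0 ltW.
Qed.

Lemma smooth_raw_bump : smooth raw_bump.
Proof.
apply: smoothM; apply: smoothM; exact: smooth_expinv.
Qed.

Lemma raw_bump_ge0 x : 0 <= raw_bump x.
Proof. by rewrite /raw_bump !mulr_ge0 ?expinv1_ge0. Qed.

Lemma raw_bump_le1 x : raw_bump x <= 1.
Proof.
have h (a b : R) : 0 <= a -> 0 <= b -> a <= 1 -> b <= 1 -> a * b <= 1.
  by move=> *; rewrite mulr_ile1.
by rewrite /raw_bump !h ?mulr_ge0 ?expinv1_ge0 ?expinv1_le1.
Qed.

Lemma raw_bump_supp x : 1 < `|x| -> raw_bump x = 0.
Proof.
have e0 (t : R) : t <= 0 -> expinv 1 t = 0 by rewrite /expinv ltNge => ->.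
rewrite /raw_bump !mul0r !mul1r !mulN1r !addr0 !add0r.
rewrite prod_normE/= lt_max !ltr_normr => /orP[]/orP[] x1.
- by rewrite [expinv 1 (- x.1 + 1)]e0 ?mulr0 ?mul0r//; lra.
- by rewrite [expinv 1 (x.1 + 1)]e0 ?mul0r//; lra.
- by rewrite [expinv 1 (- x.2 + 1)]e0 ?mulr0//; lra.
- by rewrite [expinv 1 (x.2 + 1)]e0 ?mul0r ?mulr0//; lra.
Qed.

(** Makes the mass positive: on the square of half size, which has area one, the four arguments are
    at least 1/2, so that each factor is at least exp (- 2). *)
Lemma raw_bump_lower x : `|x| <= 1 / 2 -> expR (- 8) <= raw_bump x.
Proof.
have e2 (t : R) : 1 / 2 <= t -> expR (- 2) <= expinv 1 t.
  move=> t2; have t0 : 0 < t by rewrite (lt_le_trans _ t2)// divr_gt0.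
  rewrite /expinv t0 hornerC mul1r ler_expR lerN2.
  by rewrite invf_ple ?posrE// -(mul1r 2^-1).
rewrite prod_normE/= ge_max => /andP[]; rewrite !ler_norml => /andP[a b] /andP[c d].
have -> : expR (- 8) = expR (- 2) * expR (- 2) * (expR (- 2) * expR (- 2)) :> R.
  by rewrite -!expRD; congr expR; ring.
rewrite /raw_bump !mul0r !mul1r !mulN1r !addr0 !add0r.
have ee0 : 0 <= expR (- 2) :> R := expR_ge0 _.
apply: ler_pM; rewrite ?mulr_ge0//; apply: ler_pM => //; apply: e2; lra.
Qed.

Lemma raw_bump_integral : (0 < \int[leb2]_x (raw_bump x)%:E < +oo)%E.
Proof.
have mb : measurable_fun [set: mR2] raw_bump.
  by apply: continuous_measurable_fun2 => //; exact/smooth_continuous/smooth_raw_bump.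
apply/andP; split.
  pose S : set mR2 := `[-(1/2), 1/2]%classic `*` `[-(1/2), 1/2]%classic.
  have mS : measurable S by apply: measurableX; exact: measurable_itv.
  have S1 : leb2 S = 1%E.
    rewrite /S leb2X; try exact: measurable_itv.
    rewrite lebesgue_measure_itv/= lte_fin ifT; last by lra.
    by rewrite -EFinB -EFinM; congr EFin; field.
  apply: (@lt_le_trans _ _ (\int[leb2]_(x in S) (cst (expR (- 8))%:E x))%E).
    by rewrite integral_cst// [X in (_ < _ * X)%E]S1 mule1 lte_fin expR_gt0.
  apply: (@le_trans _ _ (\int[leb2]_(x in S) (raw_bump x)%:E)%E).
    apply: ge0_le_integral => //.
    - by move=> x _; rewrite lee_fin expR_ge0.
    - by apply/measurable_EFinP; exact: measurable_funS mb.
    - move=> x [Sx1 Sx2]; rewrite lee_fin; apply: raw_bump_lower.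
      rewrite prod_normE ge_max; move: Sx1 Sx2; rewrite /= !in_itv/=.
      by rewrite !ler_norml => -> ->.
  apply: ge0_subset_integral => //; first exact/measurable_EFinP.
  by move=> x _; rewrite lee_fin raw_bump_ge0.
have msq : measurable (unit_square : set mR2) by apply: measurableX; exact: measurable_itv.
apply: (@le_lt_trans _ _ (\int[leb2]_x (\1_unit_square x)%:E)%E).
  apply: ge0_le_integral => //.
  - by move=> x _; rewrite lee_fin raw_bump_ge0.
  - exact/measurable_EFinP.
  - exact/measurable_EFinP/measurable_indic.
  - move=> x _; rewrite lee_fin; have [x1|x1] := leP `|x| 1.
      by rewrite indicE mem_set ?raw_bump_le1//; exact/unit_squareP.
    by rewrite raw_bump_supp.
rewrite integral_indic// setIT.
have usq : (leb2 unit_square < +oo)%E.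
  rewrite /unit_square leb2X; try exact: measurable_itv.
  by rewrite lebesgue_measure_itv/= lte_fin ifT ?ltry//; lra.
exact: usq.
Qed.

Definition unit_bump x : R := (fine (\int[leb2]_x (raw_bump x)%:E)%E)^-1 * raw_bump x.

Lemma raw_bump_mass_gt0 : 0 < fine (\int[leb2]_x (raw_bump x)%:E)%E.
Proof. by apply: fine_gt0; exact: raw_bump_integral. Qed.

Lemma smooth_unit_bump : smooth unit_bump.
Proof. by apply: smoothZ; exact: smooth_raw_bump. Qed.

Lemma unit_bump_ge0 x : 0 <= unit_bump x.
Proof. by rewrite mulr_ge0 ?raw_bump_ge0// invr_ge0 ltW// raw_bump_mass_gt0. Qed.

Lemma unit_bump_supp x : 1 < `|x| -> unit_bump x = 0.
Proof. by move=> x1; rewrite /unit_bump raw_bump_supp ?mulr0. Qed.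

Lemma unit_bump_integral : (\int[leb2]_x (unit_bump x)%:E = 1)%E.
Proof.
have mb : measurable_fun [set: mR2] raw_bump.
  by apply: continuous_measurable_fun2 => //; exact/smooth_continuous/smooth_raw_bump.
under eq_integral do rewrite EFinM.
rewrite ge0_integralZl//=; last 3 first.
- exact/measurable_EFinP.
- by move=> x _; rewrite lee_fin raw_bump_ge0.
- by rewrite lee_fin invr_ge0 ltW// raw_bump_mass_gt0.
have /andP[i0 ioo] := raw_bump_integral.
rewrite -[X in (_ * X)%E]fineK; last by rewrite ge0_fin_numE// ltW.
by rewrite -EFinM mulVf// gt_eqF// raw_bump_mass_gt0.
Qed.

End UnitBump.

(** * Convolutions over a set and their derivatives *)

Section Convolution.
Variable R : realType.
Notation mR := (measurableTypeR R).
Notation mR2 := (mR * mR)%type.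
Notation leb2 := (@leb2 R).
Implicit Types (f g F : R * R -> R) (x k z : R * R).

Lemma integrable_bounded_mul (E : set mR2) (v g : mR2 -> R) (M : R) : measurable E ->
  leb2.-integrable E (EFin \o v) -> measurable_fun E g -> (forall z, `|g z| <= M) ->
  leb2.-integrable E (EFin \o (fun z => v z * g z)).
Proof.
move=> mE iv mg gM.
have mv : measurable_fun E v by case/integrableP: iv => /measurable_EFinP.
have M0 : 0 <= M by exact: le_trans (gM 0).
apply: (@le_integrable _ _ _ leb2 E mE _ (EFin \o (fun z => M * v z))).
- by apply/measurable_EFinP; exact: measurable_funM.
- move=> z _; rewrite /= lee_fin !normrM mulrC ler_wpM2r//.
  by rewrite (le_trans (gM z))// ler_norm.
- have := integrableZl mE M iv; exact: eq_integrable.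
Qed.

Variables (E : set mR2) (v : mR2 -> R) (a b : R) (e : R * R).
Hypotheses (mE : measurable E) (iv : leb2.-integrable E (EFin \o v)).

(** The argument of the kernel is affine in [x] and [z] with separate dilations [a] and [b]; the
    mollification towards an interior ball has this form, up to a factor. *)
Definition conv F x : R := int2 E (fun z => v z * F (a *: z - b *: x + e)).

Lemma measurable_conv_kernel F x : continuous F ->
  measurable_fun E (fun z : mR2 => F (a *: z - b *: x + e)).
Proof.
move=> cF; apply: continuous_measurable_fun2 => //.
move=> z; apply: (@continuous_comp _ _ _ (fun z : R * R => a *: z - b *: x + e) F); last exact: cF.
apply: differentiable_continuous.
by do 2 apply: differentiableD => //.
Qed.

Lemma conv_integrable F x : continuous F -> (forall y, 1 < `|y| -> F y = 0) ->
  leb2.-integrable E (EFin \o (fun z => v z * F (a *: z - b *: x + e))).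
Proof.
move=> cF F0; have [M FM] := continuous_bounded_supp cF F0.
apply: (@integrable_bounded_mul _ _ _ M) => //.
exact: measurable_conv_kernel.
Qed.

(** The second derivatives of [F] are bounded because they are continuous and vanish outside the
    unit square. The Taylor bound for [F] is therefore uniform, and integrating it against [v] gives
    a quadratic remainder for the convolution. *)
Lemma conv_taylor F x : smooth F -> (forall y, 1 < `|y| -> F y = 0) ->
  [/\ differentiable (conv F) x,
      partial false (conv F) x = - b * conv (partial false F) x &
      partial true (conv F) x = - b * conv (partial true F) x].
Proof.
move=> sF F0.
have supp2 i j y : 1 < `|y| -> partial i (partial j F) y = 0.
  by apply: partial_supp => ?; exact: partial_supp.
have [M FM] : exists M, forall i j y, `|partial i (partial j F) y| <= M.
  have bd i j : exists M, forall y, `|partial i (partial j F) y| <= M.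
    apply: continuous_bounded_supp (supp2 i j).
    exact/smooth_continuous/smooth_partial/smooth_partial.
  have [M1 h1] := bd false false; have [M2 h2] := bd false true.
  have [M3 h3] := bd true false; have [M4 h4] := bd true true.
  exists (Num.max (Num.max M1 M2) (Num.max M3 M4)) => i j y.
  case: i; case: j; rewrite !le_max.
  - by rewrite (h4 y) !orbT.
  - by rewrite (h3 y) !orbT.
  - by rewrite (h2 y) !orbT.
  - by rewrite (h1 y).
have iF := @conv_integrable F _ (smooth_continuous sF) F0.
have iP i := @conv_integrable (partial i F) x
   (smooth_continuous (smooth_partial i sF)) (@partial_supp _ i F F0).
have inv : leb2.-integrable E (EFin \o (fun z => `|v z|)).
  apply: (@eq_integrable _ _ _ _ _ mE (abse \o (EFin \o v))) => //.
  exact: integrable_abse.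
(* 4 M comes from the Taylor bound, b^2 from the increment [- b *: k] of the argument, and the
   integral is the L^1 norm of [v]. *)
pose C := 4 * M * b ^+ 2 * \int[leb2]_(z in E) `|v z|.
apply: (@quadratic_diff _ _ _ _ _ C) => k.
have iA i : leb2.-integrable E (EFin \o (fun z => (if i then k.2 else k.1) * - b *
    (v z * partial i F (a *: z - b *: x + e)))).
  have := integrableZl mE ((if i then k.2 else k.1) * - b) (iP i).
  exact: eq_integrable.
rewrite (_ : conv F (x + k) - conv F x - (k.1 * (- b * conv (partial false F) x) +
     k.2 * (- b * conv (partial true F) x)) =
  \int[leb2]_(z in E) (v z * (F (a *: z - b *: (x + k) + e) - F (a *: z - b *: x + e) -
   ((- b *: k).1 * partial false F (a *: z - b *: x + e) +
    (- b *: k).2 * partial true F (a *: z - b *: x + e))))); last first.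
  rewrite mulrA [in X in _ - (_ + X)]mulrA /conv /int2.
  rewrite -(RintegralZl _ mE (iP false)) -(RintegralZl _ mE (iP true)).
  rewrite -(RintegralD mE (iA false) (iA true)) -(RintegralB mE (iF _) (iF _)).
  rewrite -RintegralB//; last 2 first.
  - by have := integrableB mE (iF (x + k)) (iF x); apply: eq_integrable.
  - by have := integrableD mE (iA false) (iA true); apply: eq_integrable.
  apply: eq_Rintegral => z _; rewrite /= /GRing.scale/=; ring.
have bnd z : `|v z * (F (a *: z - b *: (x + k) + e) - F (a *: z - b *: x + e) -
   ((- b *: k).1 * partial false F (a *: z - b *: x + e) +
    (- b *: k).2 * partial true F (a *: z - b *: x + e)))| <=
   4 * M * b ^+ 2 * `|k| ^+ 2 * `|v z|.
  rewrite normrM mulrC ler_wpM2r//.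
  have -> : a *: z - b *: (x + k) + e = (a *: z - b *: x + e) + (- b *: k).
    by apply: pair_ext; rewrite /= /GRing.scale/=; ring.
  rewrite (le_trans (taylor_partial _ _ sF FM))//.
  have -> : `|- b *: k| ^+ 2 = b ^+ 2 * `|k| ^+ 2.
    by rewrite normrZ exprMn normrN real_normK ?num_real.
  by rewrite mulrA.
have iI : leb2.-integrable E (EFin \o (fun z => v z * (F (a *: z - b *: (x + k) + e) - F (a *: z - b *: x + e) -
   ((- b *: k).1 * partial false F (a *: z - b *: x + e) +
    (- b *: k).2 * partial true F (a *: z - b *: x + e))))).
  have := integrableB mE (integrableB mE (iF (x + k)) (iF x)) (integrableD mE (iA false) (iA true)).
  apply: eq_integrable => // z _; rewrite /= /GRing.scale/=; congr EFin; ring.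
rewrite (le_trans (le_normr_Rintegral mE iI))//.
rewrite /C mulrAC -RintegralZl//.
apply: le_Rintegral => //.
- move: (integrable_abse iI); exact: eq_integrable.
- by have := integrableZl mE (4 * M * b ^+ 2 * `|k| ^+ 2) inv; apply: eq_integrable.
Qed.

Lemma smooth_conv F : smooth F -> (forall y, 1 < `|y| -> F y = 0) -> smooth (conv F).
Proof.
move=> sF F0; apply: (@smooth_coind _ (fun f => exists c F, [/\ smooth F,
  (forall y, 1 < `|y| -> F y = 0) & f = (fun x => c * conv F x)])).
- move=> f x [c [G [sG G0 ->]]].
  apply: (@differentiableM _ _ (cst c) (conv G)) => //.
  by have [] := conv_taylor x sG G0.
- move=> f i [c [G [sG G0 ->]]]; exists (c * - b), (partial i G); split.
  + exact: smooth_partial.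
  + exact: partial_supp.
  + apply/funext => x; have [dG p0 p1] := conv_taylor x sG G0.
    have pi : partial i (conv G) x = - b * conv (partial i G) x.
      by case: i; [exact: p1|exact: p0].
    rewrite (partialZ _ c dG); move: (partial i (conv G) x) (conv (partial i G) x) pi => X Y ->.
    exact: mulrA.
- by exists 1, F; split => //; apply/funext => x; rewrite mul1r.
Qed.

Lemma partial_conv F i x : smooth F -> (forall y, 1 < `|y| -> F y = 0) ->
  partial i (conv F) x = - b * conv (partial i F) x.
Proof. by move=> sF F0; have [_ p0 p1] := conv_taylor x sF F0; case: i; [exact: p1|exact: p0]. Qed.

End Convolution.

(** * Density of Lipschitz functions and mollification *)

Section Density.
Variable R : realType.
Notation mR := (measurableTypeR R).
Notation mR2 := (mR * mR)%type.
Notation leb2 := (@leb2 R).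
Variable E : set mR2.
Hypotheses (mE : measurable E) (Efin : (leb2 E < +oo)%E).
Implicit Types (f g h k : mR2 -> R).

(** For Lipschitz functions the mollification error is explicit. Boundedness makes the class stable
    under products and, on a set of finite measure, a subset of L^2. *)
Definition bounded_lipschitz k : Prop := exists L B : R,
  (forall x y : R * R, `|k x - k y| <= L * `|x - y|) /\ forall x, `|k x| <= B.

Lemma bounded_lipschitz_continuous (k : R * R -> R) : bounded_lipschitz k -> continuous k.
Proof.
move=> [L [B [kL _]]] x; apply/cvgrPdist_le => e e0.
have L0 : 0 < `|L| + 1 by rewrite ltr_wpDl.
have d0 : 0 < (`|L| + 1)^-1 * e by rewrite mulr_gt0// invr_gt0.
apply: filterS (nbhsx_ballx (x : R * R) _ d0) => y.
rewrite -ball_normE /= => /ltW; rewrite ler_pdivlMl// => xy.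
rewrite (le_trans (kL x y))// (le_trans _ xy)//.
by rewrite ler_wpM2r// (le_trans (ler_norm _))// lerDl.
Qed.

Lemma bounded_lipschitz_L2 k : bounded_lipschitz k -> L2 E k.
Proof.
move=> bk; have ck := bounded_lipschitz_continuous bk.
case: bk => L [B [_ kB]]; apply: (@L2_bounded _ _ _ B) => //.
exact: continuous_measurable_fun2.
Qed.

Lemma bounded_lipschitzD k h : bounded_lipschitz k -> bounded_lipschitz h ->
  bounded_lipschitz (fun x => k x + h x).
Proof.
move=> [L [B [kL kB]]] [L' [B' [hL hB]]]; exists (L + L'), (B + B'); split=> [x y|x].
  by rewrite opprD addrACA mulrDl (le_trans (ler_normD _ _))// lerD.
by rewrite (le_trans (ler_normD _ _))// lerD.
Qed.

Lemma bounded_lipschitzM k h : bounded_lipschitz k -> bounded_lipschitz h ->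
  bounded_lipschitz (fun x => k x * h x).
Proof.
move=> [L [B [kL kB]]] [L' [B' [hL hB]]]; exists (L * B' + B * L'), (B * B'); split=> [x y|x].
  have -> : k x * h x - k y * h y = (k x - k y) * h x + k y * (h x - h y) by ring.
  rewrite (le_trans (ler_normD _ _))// !normrM mulrDl mulrAC -[B * L' * _]mulrA.
  by apply: lerD; apply: ler_pM.
by rewrite normrM ler_pM.
Qed.

Lemma bounded_lipschitz_cst (a : R) : bounded_lipschitz (cst a).
Proof.
exists 0, `|a|; split => // x y.
by rewrite subrr normr0 mul0r.
Qed.

Definition sqint f : R := int2 E (fun x => f x ^+ 2).

Lemma L2_sqr_integrable f : L2 E f -> leb2.-integrable E (EFin \o (fun x => f x ^+ 2)).
Proof. by move=> lf; have := L2_integrableM mE lf lf; apply: eq_integrable => // x _; rewrite /= expr2. Qed.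

Lemma sqint_sub_le f g h : L2 E f -> L2 E g -> L2 E h ->
  sqint (fun x => f x - h x) <=
  2 * sqint (fun x => f x - g x) + 2 * sqint (fun x => g x - h x).
Proof.
move=> lf lg lh.
have i1 := L2_sqr_integrable (L2_sub lf lg).
have i2 := L2_sqr_integrable (L2_sub lg lh).
have i3 := L2_sqr_integrable (L2_sub lf lh).
have i1' : leb2.-integrable E (EFin \o (fun x => 2 * (f x - g x) ^+ 2)).
  by have := integrableZl mE 2 i1; apply: eq_integrable.
have i2' : leb2.-integrable E (EFin \o (fun x => 2 * (g x - h x) ^+ 2)).
  by have := integrableZl mE 2 i2; apply: eq_integrable.
rewrite /sqint /int2 -(RintegralZl _ mE i1) -(RintegralZl _ mE i2) -(RintegralD mE i1' i2').
apply: le_Rintegral => //.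
  by have := integrableD mE i1' i2'; apply: eq_integrable.
move=> x _; rewrite -subr_ge0.
have -> : 2 * (f x - g x) ^+ 2 + 2 * (g x - h x) ^+ 2 - (f x - h x) ^+ 2 =
  (f x - 2 * g x + h x) ^+ 2 by ring.
exact: sqr_ge0.
Qed.

Lemma L2_le f h : measurable_fun E f -> L2 E h -> (forall x, E x -> `|f x| <= h x) -> L2 E f.
Proof.
move=> mf lh fh; apply: L2I => //; apply: le_lt_trans (L2_lty mE lh).
apply: ge0_le_integral => //.
- by move=> x _; rewrite lee_fin sqr_ge0.
- by apply/measurable_EFinP; exact: measurable_funX.
- by apply/measurable_EFinP; apply: measurable_funX; exact: L2_measurable lh.
- move=> x Ex; rewrite lee_fin -[f x ^+ 2]real_normK ?num_real// ler_sqr ?nnegrE//.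
    exact: fh.
  by rewrite (le_trans _ (fh _ Ex)).
Qed.

Lemma sqint_dominated (g_ : nat -> mR2 -> R) h :
  (forall n, measurable_fun E (g_ n)) -> L2 E h ->
  (forall n x, E x -> `|g_ n x| <= h x) ->
  (forall x, E x -> g_ n x @[n --> \oo] --> 0) ->
  sqint (g_ n) @[n --> \oo] --> 0.
Proof.
move=> mg lh gh g0.
have mg2 n : measurable_fun E (EFin \o (fun x => g_ n x ^+ 2)).
  by apply/measurable_EFinP; exact: measurable_funX.
have cg : {ae leb2, forall x, E x -> (g_ n x ^+ 2)%:E @[n --> \oo] --> cst 0%E x}.
  apply: aeW => x Ex; apply: cvg_EFin; first exact: nearW.
  have := cvgM (g0 x Ex) (g0 x Ex); rewrite mulr0 => g2.
  rewrite (_ : _ \o _ = g_^~ x \* g_^~ x)  ; first exact: g2.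
  by apply/funext => n; rewrite /= expr2.
have dg : {ae leb2, forall x n, E x -> (`|(g_ n x ^+ 2)%:E| <= (h x ^+ 2)%:E)%E}.
  apply: aeW => x n Ex; rewrite /= lee_fin ger0_norm ?sqr_ge0//.
  rewrite -[g_ n x ^+ 2]real_normK ?num_real// ler_sqr ?nnegrE//.
    exact: gh.
  by rewrite (le_trans _ (gh n _ Ex)).
have [_ _] := @dominated_convergence _ _ _ leb2 E mE (fun n x => (g_ n x ^+ 2)%:E) (cst 0%E)
  (fun x => (h x ^+ 2)%:E) mg2 (measurable_cst _) cg (L2_sqr_integrable lh) dg.
rewrite integral0 => H.
exact: fine_cvg.
Qed.

Definition lipschitz_approx f : Prop := L2 E f /\ forall e : R, 0 < e ->
  exists2 k, bounded_lipschitz k & sqint (fun x => f x - k x) <= e.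

Lemma lipschitz_approx_id k : bounded_lipschitz k -> lipschitz_approx k.
Proof.
move=> bk; split; first exact: bounded_lipschitz_L2.
move=> e e0; exists k => //; rewrite /sqint /int2.
under eq_Rintegral do rewrite subrr expr0n/=.
by rewrite Rintegral_cst// mul0r ltW.
Qed.

Lemma lipschitz_approxZ (a : R) f : lipschitz_approx f -> lipschitz_approx (fun x => a * f x).
Proof.
move=> [lf fk]; split; first exact: L2_scale.
move=> e e0; have d0 : 0 < e / (a ^+ 2 + 1) by rewrite divr_gt0// ltr_wpDl// sqr_ge0.
have [k bk ke] := fk _ d0; exists (fun x => a * k x).
  by apply: (@bounded_lipschitzM (cst a)) => //; exact: bounded_lipschitz_cst.
rewrite /sqint /int2; under eq_Rintegral do rewrite -mulrBr exprMn.
rewrite RintegralZl//; last exact: (L2_sqr_integrable (L2_sub lf (bounded_lipschitz_L2 bk))).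
apply: (@le_trans _ _ ((a ^+ 2 + 1) * (e / (a ^+ 2 + 1)))); last first.
  by rewrite mulrC divfK// gt_eqF// ltr_wpDl// sqr_ge0.
apply: ler_pM => //; rewrite ?sqr_ge0 ?lerDl//.
by apply: Rintegral_ge0 => x _; rewrite sqr_ge0.
Qed.

Lemma lipschitz_approxD f g : lipschitz_approx f -> lipschitz_approx g ->
  lipschitz_approx (fun x => f x + g x).
Proof.
move=> [lf fk] [lg gk]; split; first exact: L2_add.
move=> e e0; have e4 : 0 < e / 4 by rewrite divr_gt0.
have [k bk ke] := fk _ e4; have [h bh he] := gk _ e4.
exists (fun x => k x + h x); first exact: bounded_lipschitzD.
have lk := bounded_lipschitz_L2 bk; have lh := bounded_lipschitz_L2 bh.
apply: (le_trans (@sqint_sub_le _ (fun x => k x + g x) _ (L2_add lf lg) (L2_add lk lg) (L2_add lk lh))).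
have -> : sqint (fun x => f x + g x - (k x + g x)) = sqint (fun x => f x - k x).
  by apply: eq_Rintegral => x _; congr (_ ^+ 2); ring.
have -> : sqint (fun x => k x + g x - (k x + h x)) = sqint (fun x => g x - h x).
  by apply: eq_Rintegral => x _; congr (_ ^+ 2); ring.
by lra.
Qed.

(** Dominated convergence makes the error tend to zero in L^2. The domination is asked of the error
    [f - g_ n], and the square-integrability of [f] follows from it. *)
Lemma lipschitz_approx_lim (g_ : nat -> mR2 -> R) f h :
  (forall n, lipschitz_approx (g_ n)) -> measurable_fun E f -> L2 E h ->
  (forall n x, E x -> `|f x - g_ n x| <= h x) ->
  (forall x, E x -> g_ n x @[n --> \oo] --> f x) -> lipschitz_approx f.
Proof.
move=> ag mf lh fgh gf.
have lg n : L2 E (g_ n) by case: (ag n).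
have mg n : measurable_fun E (g_ n) by exact: L2_measurable (lg n).
have mfg n : measurable_fun E (fun x => f x - g_ n x) by exact: measurable_funB.
have lf : L2 E f.
  have := L2_add (lg 0%N) (L2_le (mfg 0%N) lh (fgh 0%N)).
  by apply: L2_ext => x _; rewrite addrC subrK.
split=> // e e0.
have : sqint (fun x => f x - g_ n x) @[n --> \oo] --> 0.
  apply: (@sqint_dominated _ h) => // x Ex.
  have := cvgB (@cvg_cst _ (f x) _ _ _) (gf x Ex); rewrite subrr; exact.
have e4 : 0 < e / 4 by rewrite divr_gt0.
move=> /cvgrPdist_le /(_ _ e4) [n _ /(_ n (leqnn n))].
rewrite /= sub0r normrN => ne.
have [k bk ke] := (ag n).2 _ e4; exists k => //.
apply: (le_trans (@sqint_sub_le _ (g_ n) _ lf (lg n) (bounded_lipschitz_L2 bk))).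
have := le_trans (ler_norm _) ne; lra.
Qed.

Lemma lipschitz_approx_sum (I : Type) (s : seq I) (F : I -> mR2 -> R) :
  (forall i, lipschitz_approx (F i)) -> lipschitz_approx (fun x => \sum_(i <- s) F i x).
Proof.
move=> aF; elim: s => [|i s ih].
  rewrite (_ : (fun x => _) = cst 0); last by apply/funext => x; rewrite big_nil.
  exact/lipschitz_approx_id/bounded_lipschitz_cst.
rewrite (_ : (fun x => _) = (fun x => F i x + \sum_(i <- s) F i x)).
  exact: lipschitz_approxD.
by apply/funext => x; rewrite big_cons.
Qed.

Lemma eq_lipschitz_approx f g : f =1 g -> lipschitz_approx f -> lipschitz_approx g.
Proof. by move=> /funext ->. Qed.

(** At a given point the partial sums jump once from 0 to 1, or stay at 0. This yields both their
    convergence to the indicator of the union and the bound by 1. *)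
Lemma trivIset_indic_sum (A : (set mR2)^nat) : trivIset setT A -> forall x,
  (exists2 i, A i x & forall n, \sum_(0 <= j < n) \1_(A j) x = (i < n)%N%:R :> R) \/
  (~ (\bigcup_i A i) x /\ forall n, \sum_(0 <= j < n) \1_(A j) x = 0 :> R).
Proof.
move=> tA x; have [[i _ Aix]|nA] := pselect ((\bigcup_i A i) x); [left|right].
  exists i => //; elim=> [|n ih]; first by rewrite big_nil.
  rewrite big_nat_recr//= ih indicE ltnS.
  have [<-|ne] := eqVneq i n; first by rewrite ltnn leqnn mem_set//= add0r.
  rewrite [(i <= n)%N]leq_eqVlt (negbTE ne)/= memNset ?addr0// => Anx; move/eqP: ne; apply.
  by apply: tA => //; exists x.
split=> // n; rewrite big1_seq// => j _; rewrite indicE memNset// => Ajx.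
by apply: nA; exists j.
Qed.

(** Monotone class argument: the sets [A] concerned are stable under complement and countable
    disjoint union. The parameters [S] and [pi] allow one coordinate to be treated while the other
    one is confined to a fixed set. *)
Lemma lipschitz_approx_dynkin d (T : measurableType d) (pi : mR2 -> T) (S : set mR2)
    (G : set (set T)) :
  measurable_fun setT pi -> measurable S -> lipschitz_approx \1_S ->
  @measurable _ T = <<s G >> -> setI_closed G ->
  (forall A, G A -> lipschitz_approx \1_(S `&` pi @^-1` A)) ->
  forall A, measurable A -> lipschitz_approx \1_(S `&` pi @^-1` A).
Proof.
move=> mpi mS aS mG GI aG A; rewrite mG.
have mpre B : measurable B -> measurable (S `&` pi @^-1` B).
  by move=> mB; apply: measurableI => //; rewrite -[X in measurable X]setTI; exact: mpi.
apply: (dynkin_induction (P := fun A => lipschitz_approx \1_(S `&` pi @^-1` A)) mG GI) => //.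
- by rewrite preimage_setT setIT.
- move=> B mB aB.
  apply: (@eq_lipschitz_approx (fun x => \1_S x + (-1) * \1_(S `&` pi @^-1` B) x)); last first.
    by apply: lipschitz_approxD => //; exact: lipschitz_approxZ.
  move=> x; rewrite !indicE.
  have [Sx|Sx] := pselect (S x); last first.
    by rewrite !memNset//= ?mulr0 ?addr0// => -[].
  have [Bx|Bx] := pselect (B (pi x)).
    by rewrite [x \in S]mem_set// mem_set// memNset ?mulr1 ?subrr// => -[].
  by rewrite [x \in S]mem_set// memNset ?mem_set ?mulr0 ?addr0// => -[].
- move=> F mF tF aF.
  have tSF : trivIset setT (fun i => S `&` pi @^-1` F i).
    by move=> i j _ _ [x [[_ Fi] [_ Fj]]]; apply: tF => //; exists (pi x).
  have bigU : \bigcup_i (S `&` pi @^-1` F i) = S `&` pi @^-1` (\bigcup_k F k).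
    by rewrite preimage_bigcup setI_bigcupr.
  apply: (@lipschitz_approx_lim (fun n x => \sum_(0 <= i < n) \1_(S `&` pi @^-1` F i) x) _ (cst 1)).
  + by move=> n; exact: lipschitz_approx_sum.
  + apply: measurable_funTS; apply: measurable_indic.
    by apply: mpre; exact: bigcup_measurable.
  + exact: L2_cst.
  + move=> n x _; rewrite /cst/=.
    have [[i Ai ->]|[nA ->]] := trivIset_indic_sum tSF x.
      rewrite -bigU indicE mem_set; last by exists i.
      by case: (i < n)%N; rewrite ?subrr ?normr0// subr0 normr1.
    by rewrite -bigU indicE memNset// subrr normr0.
  + move=> x _; have [[i Ai sE]|[nA sE]] := trivIset_indic_sum tSF x.
      rewrite -bigU indicE mem_set; last by exists i.
      apply: cvg_near_cst; exists i.+1 => // n /= ni.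
      by rewrite sE ni.
    rewrite -bigU indicE memNset//; apply: cvg_near_cst; apply: nearW => n.
    by rewrite sE.
Qed.

Lemma lipschitz_approx_setT : lipschitz_approx \1_[set: mR2].
Proof.
apply: (@eq_lipschitz_approx (cst 1)); first by move=> x; rewrite indicE mem_set.
exact/lipschitz_approx_id/bounded_lipschitz_cst.
Qed.

(** Clamped affine function of slope [n]: Lipschitz, with the indicator of the open ray from [a] as
    pointwise limit. *)
Definition ramp (a : R) (n : nat) (t : R) : R := Num.min (Num.max (n%:R * (t - a)) 0) 1.

Lemma ramp_ge0 a n t : 0 <= ramp a n t.
Proof. by rewrite /ramp le_min ler01 le_max lexx orbT. Qed.

Lemma ramp_le1 a n t : ramp a n t <= 1.
Proof. by rewrite /ramp ge_min lexx orbT. Qed.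

Lemma ramp_lipschitz a n t u : `|ramp a n t - ramp a n u| <= n%:R * `|t - u|.
Proof.
have c (x y : R) : `|Num.min (Num.max x 0) 1 - Num.min (Num.max y 0) 1| <= `|x - y|.
  have n1 := ler_norm (x - y); have n2 := ler_norm (y - x); rewrite distrC in n2.
  have n0 := normr_ge0 (x - y); rewrite /Num.min /Num.max.
  case: (ltP x 0) => hx; case: (ltP y 0) => hy; rewrite ?ltr01;
    [|case: (ltP y 1) => h1|case: (ltP x 1) => h1|case: (ltP x 1) => h1; case: (ltP y 1) => h2];
    rewrite ler_norml; apply/andP; split; lra.
by rewrite (le_trans (c _ _))// -mulrBr normrM ger0_norm ?ler0n// opprB addrA subrK.
Qed.

Lemma ramp_cvg a t : ramp a n t @[n --> \oo] --> (\1_(`]a, +oo[%classic : set R) t : R).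
Proof.
rewrite indicE mem_setE in_itv/= andbT; have [ta|ta] := ltP a t; last first.
  apply: cvg_near_cst; apply: nearW => n.
  by rewrite /ramp max_r ?min_l// mulr_ge0_le0// subr_le0.
have ta0 : 0 < t - a by rewrite subr_gt0.
apply: cvg_near_cst; exists (Num.truncn (t - a)^-1).+1 => // n /= nt.
rewrite /ramp min_r// le_max -ler_pdivrMr// div1r.
by rewrite (le_trans (ltW (truncnS_gt _)))// ler_nat.
Qed.

Lemma ramp_bounded_lipschitz1 a n : bounded_lipschitz (fun x => ramp a n x.1).
Proof.
exists n%:R, 1; split=> [x y|x]; last by rewrite ger0_norm ?ramp_ge0// ramp_le1.
rewrite (le_trans (ramp_lipschitz _ _ _ _))// ler_wpM2l ?ler0n//.
by rewrite prod_normE/= le_max lexx.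
Qed.

Lemma ramp_bounded_lipschitz2 a n : bounded_lipschitz (fun x => ramp a n x.2).
Proof.
exists n%:R, 1; split=> [x y|x]; last by rewrite ger0_norm ?ramp_ge0// ramp_le1.
rewrite (le_trans (ramp_lipschitz _ _ _ _))// ler_wpM2l ?ler0n//.
by rewrite prod_normE/= le_max lexx orbT.
Qed.

Definition ray : set (set mR) := [set `]a, +oo[%classic | a in [set: R]].

Lemma rayI : setI_closed ray.
Proof.
move=> _ _ [a _ <-] [b _ <-]; exists (Num.max a b) => //.
by apply/seteqP; split=> x /=; rewrite !in_itv/= !andbT gt_max => /andP.
Qed.

Lemma measurable_rayE : @measurable _ mR = <<s ray >>.
Proof.
have := RGenOInfty.measurableE R; rewrite /measurable/= => ->.
congr (<<s _ >>); apply/seteqP; split=> [A [x ->]|A [x _ <-]]; last by exists x.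
by exists x.
Qed.

Lemma lipschitz_approx_ramp_lim (S : set mR2) (g_ : nat -> mR2 -> R) :
  measurable S -> (forall n, bounded_lipschitz (g_ n)) ->
  (forall n x, 0 <= g_ n x <= 1) ->
  (forall x, g_ n x @[n --> \oo] --> (\1_S x : R)) -> lipschitz_approx \1_S.
Proof.
move=> mS bg g01 gS; apply: (@lipschitz_approx_lim g_ _ (cst 1)) => //.
- by move=> n; exact: lipschitz_approx_id.
- exact: L2_cst.
- move=> n x _ /=; have /andP[a b] := g01 n x.
  by rewrite indicE; case: (_ \in _); rewrite ler_norml; apply/andP; split; rewrite /=; lra.
Qed.

Lemma lipschitz_approx_strip (A : set mR) : measurable A ->
  lipschitz_approx \1_(fst @^-1` A : set mR2).
Proof.
have mray a : measurable (`]a, +oo[%classic : set mR) by exact: measurable_itv.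
move=> mA; rewrite -[X in \1_X]setTI.
apply: (lipschitz_approx_dynkin measurable_fst measurableT lipschitz_approx_setT measurable_rayE rayI) => //.
move=> _ [a _ <-]; rewrite setTI.
apply: (@lipschitz_approx_ramp_lim _ (fun n x => ramp a n x.1)).
- by rewrite -[X in measurable X]setTI; exact: measurable_fst.
- by move=> n; exact: ramp_bounded_lipschitz1.
- by move=> n x; rewrite ramp_ge0 ramp_le1.
- by move=> x; exact: ramp_cvg.
Qed.

(** Provides the generators for the induction on the second coordinate: rays in that coordinate,
    intersected with an arbitrary strip in the first one. *)
Lemma lipschitz_approx_strip_ray (A : set mR) (b : R) : measurable A ->
  lipschitz_approx \1_((snd @^-1` `]b, +oo[ : set mR2) `&` fst @^-1` A).
Proof.
have mray a : measurable (`]a, +oo[%classic : set mR) by exact: measurable_itv.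
have mS : measurable (snd @^-1` `]b, +oo[ : set mR2).
  by rewrite -[X in measurable X]setTI; exact: measurable_snd.
have aS : lipschitz_approx \1_(snd @^-1` `]b, +oo[ : set mR2).
  apply: (@lipschitz_approx_ramp_lim _ (fun n x => ramp b n x.2)) => //.
  - by move=> n; exact: ramp_bounded_lipschitz2.
  - by move=> n x; rewrite ramp_ge0 ramp_le1.
  - by move=> x; exact: ramp_cvg.
apply: (lipschitz_approx_dynkin measurable_fst mS aS measurable_rayE rayI) => //.
move=> _ [a _ <-].
apply: (@lipschitz_approx_ramp_lim _ (fun n x => ramp b n x.2 * ramp a n x.1)).
- apply: measurableI => //; rewrite -[X in measurable X]setTI; exact: measurable_fst.
- move=> n; apply: bounded_lipschitzM.
    exact: ramp_bounded_lipschitz2.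
  exact: ramp_bounded_lipschitz1.
- by move=> n x; rewrite mulr_ge0 ?ramp_ge0// mulr_ile1 ?ramp_ge0 ?ramp_le1.
- move=> x; rewrite indicI/=; apply: cvgM; exact: ramp_cvg.
Qed.

Lemma lipschitz_approx_rect (A B : set mR) : measurable A -> measurable B ->
  lipschitz_approx \1_(A `*` B).
Proof.
move=> mA mB; have -> : A `*` B = (fst @^-1` A) `&` (snd @^-1` B) by [].
have mS : measurable (fst @^-1` A : set mR2).
  by rewrite -[X in measurable X]setTI; exact: measurable_fst.
apply: (lipschitz_approx_dynkin measurable_snd mS (lipschitz_approx_strip mA) measurable_rayE rayI) => //.
by move=> _ [b _ <-]; rewrite setIC; exact: lipschitz_approx_strip_ray.
Qed.

Lemma lipschitz_approx_indic (A : set mR2) : measurable A -> lipschitz_approx \1_A.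
Proof.
move=> mA; rewrite -[A]setTI.
apply: (@lipschitz_approx_dynkin _ mR2 id setT [set A `*` B | A in @measurable _ mR & B in @measurable _ mR]) => //.
- exact: lipschitz_approx_setT.
- exact: measurable_prod_measurableType.
- move=> _ _ [A1 mA1 [A2 mA2 <-]] [B1 mB1 [B2 mB2 <-]].
  exists (A1 `&` B1); first exact: measurableI.
  exists (A2 `&` B2); first exact: measurableI.
  by rewrite setXI.
- by move=> _ [A1 mA1 [A2 mA2 <-]]; rewrite setTI; exact: lipschitz_approx_rect.
Qed.

Import HBNNSimple HBSimple.

(** Increasing approximation by simple functions [g n], with the error dominated by [f] itself. *)
Lemma lipschitz_approx_ge0 f : L2 E f -> (forall x, E x -> 0 <= f x) -> lipschitz_approx f.
Proof.
move=> lf f0; have mf := L2_measurable mE lf.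
have mf' : measurable_fun E (EFin \o f) by exact/measurable_EFinP.
have f0' x : E x -> (0 <= (EFin \o f) x)%E by move=> Ex; rewrite lee_fin f0.
pose g := nnsfun_approx mE mf'.
have gf n x : E x -> g n x <= f x.
  by move=> Ex; have := le_approx n f0' Ex; rewrite lee_fin /g nnsfun_approxE.
apply: (@lipschitz_approx_lim (fun n => g n) _ f) => //.
- move=> n; pose s : seq R := finmap.enum_fset (fset_set (range (g n))).
  have gE : (g n : mR2 -> R) = (fun x : mR2 => \sum_(y <- s) y * \1_(g n @^-1` [set y]) x).
    by apply/funext => x; rewrite [LHS]fimfunE fsbig_finite.
  rewrite gE.
  apply: lipschitz_approx_sum => y; apply: lipschitz_approxZ.
  by apply: lipschitz_approx_indic.
- move=> n x Ex; rewrite ger0_norm ?subr_ge0 ?gf//.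
  by rewrite gerBl.
- move=> x Ex; have gx : (EFin \o (fun n => g n x)) n @[n --> \oo] --> (f x)%:E.
    exact: cvg_nnsfun_approx.
  by move/fine_cvgP : gx => [].
Qed.

Lemma L2_lipschitz_dense f : L2 E f -> lipschitz_approx f.
Proof.
move=> lf; have mf := L2_measurable mE lf.
have lp : L2 E (fun x => `|f x|).
  apply: (@L2_le _ (fun x => `|f x|)); first exact: measurableT_comp.
    apply: L2I => //; first exact: measurableT_comp.
    apply: le_lt_trans (L2_lty mE lf).
    by under eq_integral do rewrite real_normK ?num_real//.
  by move=> x _; rewrite normr_id.
apply: (@eq_lipschitz_approx (fun x => (2^-1 * (`|f x| + f x)) + (-1) * (2^-1 * (`|f x| - f x)))).
  by move=> x; field.
apply: lipschitz_approxD; last apply: lipschitz_approxZ; apply: lipschitz_approx_ge0.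
- by apply: L2_scale; exact: L2_add.
- by move=> x _; rewrite mulr_ge0//; have := ler_norm (- f x); rewrite normrN; lra.
- by apply: L2_scale; exact: L2_sub.
- by move=> x _; rewrite mulr_ge0// subr_ge0 ler_norm.
Qed.

End Density.

(** * Mollification towards an interior ball *)

Section BumpScale.
Variable R : realType.
Notation mR := (measurableTypeR R).
Notation mR2 := (mR * mR)%type.

Lemma continuous_bump_affine (a : R) (e : R * R) :
  continuous (fun z : R * R => unit_bump (a *: z + e)).
Proof. by apply: smooth_continuous; apply: smooth_affine; exact: smooth_unit_bump. Qed.

Lemma bump_affine_integral (a : R) (e : R * R) : a != 0 ->
  (\int[@leb2 R]_z (unit_bump (a *: z + e))%:E = (a ^- 2)%:E)%E.
Proof.
move=> a0; have mb : measurable_fun [set: mR2] (EFin \o @unit_bump R).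
  apply/measurable_EFinP; apply: continuous_measurable_fun2 => //.
  by apply: smooth_continuous; exact: smooth_unit_bump.
have := leb2_scale e a0 mb (fun z => unit_bump_ge0 z).
rewrite unit_bump_integral.
set I := (X in (_ * X)%E); set J := (\int[_]_z _)%E.
have -> : I = J.
  by apply: eq_integral => z _; congr (unit_bump _)%:E; apply: pair_ext.
(* Finiteness of the integral is not known beforehand; infinite values contradict a^2 J = 1. *)
case: J => [r| |].
- rewrite -EFinM => -[r1]; congr EFin.
  have a2 : a ^+ 2 != 0 by rewrite expf_neq0.
  by apply: (mulfI a2); rewrite -r1 mulfV.
- by rewrite gt0_muley// lte_fin exprn_even_gt0.
- by rewrite gt0_muleNy// lte_fin exprn_even_gt0.
Qed.

End BumpScale.

Section Mollifier.
Variable R : realType.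
Notation mR := (measurableTypeR R).
Notation mR2 := (mR * mR)%type.
Notation leb2 := (@leb2 R).
Notation bump := (@unit_bump R).
Variable E : set mR2.
Variables (c : R * R) (s B : R).
Hypotheses (oE : open (E : set (R * R))) (Efin : (leb2 E < +oo)%E).
Hypotheses (EB : forall x, E x -> `|x : R * R| <= B) (s_gt0 : 0 < s).
Hypothesis Estar : forall (x y : R * R) (l : R), E x -> `|y - c| <= s -> 0 <= l <= 1 ->
  E (l *: x + (1 - l) *: y).
Implicit Types (f g v : mR2 -> R) (x y z : R * R).

Let mE : measurable E. Proof. exact: open_measurable2. Qed.

(* [mollify l g x] averages [g] over the points [l x + (1 - l) y] with [|y - c| <= s],
   which belong to E when x does: the mollified function is defined on the whole
   of E without extending [g]. *)
Definition mscale_ (l : R) : R := ((1 - l) * s)^-1.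

(** The bump rescaled to the max-norm ball of centre l x + (1 - l) c and radius (1 - l) s, the
    inverse of [mscale_ l]. The factor [mscale_ l ^+ 2] restores mass one in [z]. *)
Definition mkernel (l : R) x z : R :=
  mscale_ l ^+ 2 * bump (mscale_ l *: z - (mscale_ l * l) *: x + - (s^-1 *: c)).

Definition mollify (l : R) g x : R := int2 E (fun z => mkernel l x z * g z).

Section FixedScale.
Variable l : R.
Hypotheses (l_gt0 : 0 < l) (l_lt1 : l < 1).

Lemma mscale_gt0 : 0 < mscale_ l.
Proof. by rewrite invr_gt0 mulr_gt0// subr_gt0. Qed.

Lemma mkernel_ge0 x z : 0 <= mkernel l x z.
Proof. by rewrite mulr_ge0 ?sqr_ge0 ?unit_bump_ge0. Qed.

Lemma mkernel_supp_pt x z : `|mscale_ l *: z - (mscale_ l * l) *: x + - (s^-1 *: c)| <= 1 ->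
  exists2 y, `|y - c| <= s & z = l *: x + (1 - l) *: y.
Proof.
move=> h; have l1 : 1 - l != 0 by rewrite gt_eqF// subr_gt0.
have s0 : s != 0 by rewrite gt_eqF.
exists ((1 - l)^-1 *: (z - l *: x)); last first.
  by apply: pair_ext; rewrite /= /GRing.scale/=; field.
rewrite (_ : _ - c = s *: (mscale_ l *: z - (mscale_ l * l) *: x + - (s^-1 *: c))).
  by rewrite normrZ gtr0_norm// ler_piMr// ltW.
apply: pair_ext; rewrite /= /GRing.scale/= /mscale_; field; by rewrite l1 s0.
Qed.

Lemma mkernel_neq0 x z : mkernel l x z != 0 ->
  exists2 y, `|y - c| <= s & z = l *: x + (1 - l) *: y.
Proof.
move=> K0; apply: mkernel_supp_pt; rewrite leNgt; apply: contra_neqN K0 => h.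
by rewrite /mkernel unit_bump_supp// mulr0.
Qed.

(** Star-shapedness enters here: for [x] in E the kernel lives on E, so it keeps mass one when the
    integral is restricted to E. *)
Lemma mkernel_out x z : E x -> ~ E z -> mkernel l x z = 0.
Proof.
move=> Ex nEz; apply/eqP; apply: contra_notT nEz => /mkernel_neq0[y yc ->].
by apply: Estar => //; rewrite !ltW.
Qed.

Lemma continuous_mkernel x : continuous (mkernel l x).
Proof.
move=> z; apply: cvgM; first exact: cvg_cst.
apply: (@continuous_comp _ _ _ (fun z : R * R => mscale_ l *: z - (mscale_ l * l) *: x + - (s^-1 *: c)) bump).
  by apply: differentiable_continuous; do 2 apply: differentiableD => //.
exact: (smooth_continuous (@smooth_unit_bump R)).
Qed.

Lemma continuous_mkernel_x z : continuous (fun x : R * R => mkernel l x z).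
Proof.
move=> x; apply: cvgM; first exact: cvg_cst.
apply: (@continuous_comp _ _ _ (fun x : R * R => mscale_ l *: z - (mscale_ l * l) *: x + - (s^-1 *: c)) bump).
  by apply: differentiable_continuous; do 2 apply: differentiableD => //.
exact: (smooth_continuous (@smooth_unit_bump R)).
Qed.

Lemma mkernel_integral_z x : (\int[leb2]_z (mkernel l x z)%:E = 1)%E.
Proof.
have a0 : mscale_ l != 0 by rewrite gt_eqF// mscale_gt0.
under eq_integral => z _ do rewrite /mkernel EFinM -addrA.
rewrite ge0_integralZl//=; last 3 first.
- apply/measurable_EFinP; apply: continuous_measurable_fun2 => //.
  exact: continuous_bump_affine.
- by move=> z _; rewrite lee_fin unit_bump_ge0.
- by rewrite lee_fin sqr_ge0.
by rewrite bump_affine_integral// -EFinM mulfV// expf_neq0.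
Qed.

(** As a function of [x] the kernel is further dilated by [l], hence the mass l^-2. The factor [l]
    in [partial_mollify] will compensate for it. *)
Lemma mkernel_integral_x z : (\int[leb2]_x (mkernel l x z)%:E = (l ^- 2)%:E)%E.
Proof.
have a0 : mscale_ l != 0 by rewrite gt_eqF// mscale_gt0.
have l0 : l != 0 by rewrite gt_eqF.
under eq_integral => x _.
  rewrite /mkernel EFinM (_ : _ + _ = - (mscale_ l * l) *: x + (mscale_ l *: z - s^-1 *: c)).
    over.
  by apply: pair_ext; rewrite /= /GRing.scale/=; ring.
rewrite ge0_integralZl//=; last 3 first.
- apply/measurable_EFinP; apply: continuous_measurable_fun2 => //.
  exact: continuous_bump_affine.
- by move=> x _; rewrite lee_fin unit_bump_ge0.
- by rewrite lee_fin sqr_ge0.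
rewrite bump_affine_integral ?oppr_eq0 ?mulf_neq0// -EFinM sqrrN exprMn.
by congr EFin; field; rewrite l0 a0.
Qed.

Lemma mkernel_integral_E x : E x -> (\int[leb2]_(z in E) (mkernel l x z)%:E = 1)%E.
Proof.
move=> Ex; rewrite -(mkernel_integral_z x) integral_mkcond; apply: eq_integral => z _.
rewrite patchE; case: ifPn => // /negP zE.
by rewrite mkernel_out// => Ez; apply: zE; rewrite inE.
Qed.

Lemma measurable_mkernel_prod :
  measurable_fun [set: mR2 * mR2] (fun p : mR2 * mR2 => mkernel l p.1 p.2).
Proof.
apply: measurable_funM => //.
have mb : measurable_fun [set: mR2] (@unit_bump R).
  apply: continuous_measurable_fun2 => //.
  by apply: smooth_continuous; exact: smooth_unit_bump.
apply: (measurableT_comp mb).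
have m1 : measurable_fun [set: mR2 * mR2] (fun p : mR2 * mR2 => p.1.1 : mR).
  by apply: (measurableT_comp measurable_fst).
have m2 : measurable_fun [set: mR2 * mR2] (fun p : mR2 * mR2 => p.1.2 : mR).
  by apply: (measurableT_comp measurable_snd).
have m3 : measurable_fun [set: mR2 * mR2] (fun p : mR2 * mR2 => p.2.1 : mR).
  by apply: (measurableT_comp measurable_fst).
have m4 : measurable_fun [set: mR2 * mR2] (fun p : mR2 * mR2 => p.2.2 : mR).
  by apply: (measurableT_comp measurable_snd).
apply: (@measurable_fun_pair _ _ _ _ mR mR
  (fun p : mR2 * mR2 => (mscale_ l * p.2.1 - (mscale_ l * l) * p.1.1 - s^-1 * c.1 : mR))
  (fun p : mR2 * mR2 => (mscale_ l * p.2.2 - (mscale_ l * l) * p.1.2 - s^-1 * c.2 : mR))).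
- by apply: measurable_funB => //; apply: measurable_funB; exact: measurable_funM.
- by apply: measurable_funB => //; apply: measurable_funB; exact: measurable_funM.
Qed.

Lemma mollify_conv g x : L2 E g -> mollify l g x =
  mscale_ l ^+ 2 * conv E g (mscale_ l) (mscale_ l * l) (- (s^-1 *: c)) bump x.
Proof.
move=> lg; rewrite /mollify /conv /int2 -RintegralZl//; last first.
  apply: conv_integrable => //; first exact: L2_integrable.
    by apply: smooth_continuous; exact: smooth_unit_bump.
  exact: unit_bump_supp.
by apply: eq_Rintegral => z _; rewrite /mkernel mulrA [LHS]mulrAC mulrA.
Qed.

Lemma mollify_convE g : L2 E g -> mollify l g = (fun x =>
  mscale_ l ^+ 2 * conv E g (mscale_ l) (mscale_ l * l) (- (s^-1 *: c)) bump x).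
Proof. by move=> lg; apply/funext => x; exact: mollify_conv. Qed.

Lemma smooth_mollify g : L2 E g -> smooth (mollify l g).
Proof.
move=> lg; rewrite mollify_convE//; apply: smoothZ; apply: smooth_conv => //.
- exact: L2_integrable.
- exact: smooth_unit_bump.
- exact: unit_bump_supp.
Qed.

Lemma mkernel_mul_integrable g x : L2 E g ->
  leb2.-integrable E (EFin \o (fun z => mkernel l x z * g z)).
Proof.
move=> lg; have := @conv_integrable _ E g (mscale_ l) (mscale_ l * l) (- (s^-1 *: c)) mE
  (L2_integrable mE Efin lg) bump x (smooth_continuous (@smooth_unit_bump R)) (@unit_bump_supp R).
move=> /(integrableZl mE (mscale_ l ^+ 2)); apply: eq_integrable => // z _.
rewrite /= /mkernel; congr EFin; ring.
Qed.

Lemma mollify_sqr_le g x : L2 E g -> E x ->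
  ((mollify l g x ^+ 2)%:E <= \int[leb2]_z (mkernel l x z * (g \_ E) z ^+ 2)%:E)%E.
Proof.
move=> lg Ex.
have mk : measurable_fun E (mkernel l x) by apply: continuous_measurable_fun2 => //; exact: continuous_mkernel.
have := @weighted_jensen _ _ _ leb2 E (mkernel l x) g mE mk (L2_measurable mE lg)
  (fun z _ => mkernel_ge0 x z) (mkernel_integral_E Ex).
move/le_trans; apply; rewrite integral_mkcond.
rewrite le_eqVlt; apply/orP; left; apply/eqP; apply: eq_integral => z _.
by rewrite !patchE; case: ifPn => // _; rewrite expr0n/= mulr0.
Qed.

(** Jensen's inequality for the density [mkernel l x], then Tonelli and the mass of the kernel in
    [x]. Extending [g] by zero places both integrals on the whole plane. *)
Lemma mollify_L2_bound g : L2 E g ->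
  (\int[leb2]_(x in E) (mollify l g x ^+ 2)%:E <=
   (l ^- 2)%:E * \int[leb2]_(z in E) (g z ^+ 2)%:E)%E.
Proof.
move=> lg; have mg : measurable_fun [set: mR2] (g \_ E).
  by apply/(measurable_restrictT _ mE); exact: L2_measurable lg.
have mG : measurable_fun [set: mR2 * mR2]
    (fun p : mR2 * mR2 => (mkernel l p.1 p.2 * (g \_ E) p.2 ^+ 2)%:E).
  apply/measurable_EFinP; apply: measurable_funM; first exact: measurable_mkernel_prod.
  by apply: measurable_funX; exact: (measurableT_comp mg).
have G0 (p : mR2 * mR2) : (0 <= (mkernel l p.1 p.2 * (g \_ E) p.2 ^+ 2)%:E)%E.
  by rewrite lee_fin mulr_ge0 ?mkernel_ge0 ?sqr_ge0.
have mF : measurable_fun [set: mR2]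
    (fun x : mR2 => \int[leb2]_z (mkernel l x z * (g \_ E) z ^+ 2)%:E)%E.
  exact: (@measurable_fun_fubini_tonelli_F _ _ mR2 mR2 R leb2 _ mG G0).
apply: (@le_trans _ _ (\int[leb2]_(x in E) \int[leb2]_z (mkernel l x z * (g \_ E) z ^+ 2)%:E)%E).
  apply: ge0_le_integral => //.
  - by move=> x _; rewrite lee_fin sqr_ge0.
  - apply/measurable_EFinP; apply: measurable_funX; apply: continuous_measurable_fun2 => //.
    by apply: smooth_continuous; exact: smooth_mollify.
  - exact: measurable_funS mF.
  - by move=> x Ex; exact: mollify_sqr_le.
apply: (@le_trans _ _ (\int[leb2]_x \int[leb2]_z (mkernel l x z * (g \_ E) z ^+ 2)%:E)%E).
  apply: ge0_subset_integral => // x _.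
  by apply: integral_ge0 => z _; rewrite (G0 (x, z)).
rewrite (leb2_tonelli4 mG G0)/=.
under eq_integral => z _.
  under eq_integral => x _ do rewrite mulrC EFinM.
  rewrite ge0_integralZl//=; last 3 first.
  - apply/measurable_EFinP; apply: continuous_measurable_fun2 => //; exact: continuous_mkernel_x.
  - by move=> x _; rewrite lee_fin mkernel_ge0.
  - by rewrite lee_fin sqr_ge0.
  rewrite mkernel_integral_x muleC.
  over.
rewrite ge0_integralZl//=; last 3 first.
- by apply/measurable_EFinP; exact: measurable_funX.
- by move=> z _; rewrite lee_fin sqr_ge0.
- by rewrite lee_fin invr_ge0 sqr_ge0.
rewrite le_eqVlt; apply/orP; left; apply/eqP; congr (_ * _)%E.
rewrite [RHS]integral_mkcond; apply: eq_integral => z _.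
by rewrite !patchE; case: ifPn => // _; rewrite expr0n.
Qed.

Lemma mollify_L2 g : L2 E g -> L2 E (mollify l g).
Proof.
move=> lg; apply: L2I => //.
  by apply: continuous_measurable_fun2 => //; apply: smooth_continuous; exact: smooth_mollify.
apply: le_lt_trans (mollify_L2_bound lg) _.
rewrite lte_mul_pinfty ?lee_fin ?invr_ge0 ?sqr_ge0//; exact: L2_lty.
Qed.

Lemma sqintE g : L2 E g -> (\int[leb2]_(x in E) (g x ^+ 2)%:E = (sqint E g)%:E)%E.
Proof.
move=> lg; rewrite /sqint /int2 fineK//.
by apply: integrable_fin_num => //; exact: L2_sqr_integrable.
Qed.

Lemma mollify_sqint g : L2 E g -> sqint E (mollify l g) <= l ^- 2 * sqint E g.
Proof.
move=> lg; have := mollify_L2_bound lg.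
by rewrite (sqintE lg) (sqintE (mollify_L2 lg)) -EFinM lee_fin.
Qed.

Lemma mollifyB f g x : L2 E f -> L2 E g ->
  mollify l (fun z => f z - g z) x = mollify l f x - mollify l g x.
Proof.
move=> lf lg; rewrite /mollify /int2 -RintegralB//; try exact: mkernel_mul_integrable.
by apply: eq_Rintegral => z _; rewrite mulrBr.
Qed.

(** The kernel at [x] only sees points z = l x + (1 - l) y with y in the ball, so z - x = (1 - l) (y
    - x), where x and y both lie in E and have norm at most [B]. *)
Lemma mollify_lipschitz (k : mR2 -> R) (L : R) x :
  (forall x y : R * R, `|k x - k y| <= L * `|x - y|) -> 0 <= L -> L2 E k -> E x ->
  `|mollify l k x - k x| <= L * ((1 - l) * (2 * B)).
Proof.
move=> kL L0 lk Ex.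
have l1 : 0 <= 1 - l by rewrite subr_ge0 ltW.
have iK : leb2.-integrable E (EFin \o (fun z => mkernel l x z * cst 1 z)).
  by apply: mkernel_mul_integrable; exact: L2_cst.
have iK1 : leb2.-integrable E (EFin \o (mkernel l x)).
  by move: iK; apply: eq_integrable => // z _; rewrite /= mulr1.
have K1 : \int[leb2]_(z in E) mkernel l x z = 1.
  by rewrite /Rintegral mkernel_integral_E.
have -> : k x = \int[leb2]_(z in E) (k x * mkernel l x z).
  by rewrite RintegralZl// K1 mulr1.
have ikx : leb2.-integrable E (EFin \o (fun z => k x * mkernel l x z)).
  by have := integrableZl mE (k x) iK1; apply: eq_integrable.
have ik := mkernel_mul_integrable x lk.
rewrite /mollify /int2 -RintegralB//.
have iD : leb2.-integrable E (EFin \o (fun z => mkernel l x z * k z - k x * mkernel l x z)).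
  by have := integrableB mE ik ikx; apply: eq_integrable.
rewrite (le_trans (le_normr_Rintegral mE iD))//.
have -> : L * ((1 - l) * (2 * B)) =
    \int[leb2]_(z in E) (L * ((1 - l) * (2 * B)) * mkernel l x z).
  by rewrite RintegralZl// K1 mulr1.
apply: le_Rintegral => //.
- by move: (integrable_abse iD); exact: eq_integrable.
- by have := integrableZl mE (L * ((1 - l) * (2 * B))) iK1; apply: eq_integrable.
move=> z Ez; have -> : mkernel l x z * k z - k x * mkernel l x z = mkernel l x z * (k z - k x) by ring.
rewrite normrM ger0_norm ?mkernel_ge0// mulrC.
have [->|K0] := eqVneq (mkernel l x z) 0; first by rewrite !mulr0.
rewrite ler_wpM2r ?mkernel_ge0// (le_trans (kL _ _))// ler_wpM2l//.
have [y yc zE] := mkernel_neq0 K0.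
(* The case l = 0 of [Estar]: the ball itself lies in E. *)
have Ey : E y.
  have := Estar Ex yc (l := 0); rewrite lexx ler01 scale0r add0r subr0 scale1r; exact.
have -> : z - x = (1 - l) *: (y - x).
  by rewrite zE; apply: pair_ext; rewrite /= /GRing.scale/=; ring.
rewrite normrZ ger0_norm// ler_wpM2l//.
by rewrite (le_trans (ler_normB _ _))// mulr2n mulrDl mul1r lerD// EB.
Qed.

(** [A] inverts the affine argument of the bump, so the support lies in the image of the unit
    square. This image is compact and consists of points l x + (1 - l) y', hence lies in E. *)
Lemma mollifier_test_function x : E x -> test_function E
  (fun z => bump (mscale_ l *: z - (mscale_ l * l) *: x + - (s^-1 *: c))).
Proof.
move=> Ex; pose A (y : R * R) := (mscale_ l)^-1 *: y + (l *: x + (mscale_ l)^-1 *: (s^-1 *: c)).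
have a0 : mscale_ l != 0 by rewrite gt_eqF// mscale_gt0.
have cA : continuous A by move=> y; apply: differentiable_continuous; exact: affine_differentiable.
have sq : compact (A @` @unit_square R).
  by apply: continuous_compact; [exact: continuous_subspaceT|exact: compact_unit_square].
have hs : hausdorff_space (R * R)%type by exact: norm_hausdorff.
have sub : [set z | bump (mscale_ l *: z - (mscale_ l * l) *: x + - (s^-1 *: c)) != 0] `<=`
    A @` @unit_square R.
  move=> z /= K0; exists (mscale_ l *: z - (mscale_ l * l) *: x + - (s^-1 *: c)).
    apply/unit_squareP; rewrite leNgt; apply: contra_neqN K0 => h.
    by rewrite unit_bump_supp.
  by apply: pair_ext; rewrite /A /= /GRing.scale/=; field; rewrite a0 gt_eqF.
have csq := compact_closed hs sq.
have clsub := closure_subset sub; rewrite -((closure_id _).1 csq) in clsub.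
split.
- rewrite (_ : (fun z => _) = (fun z => bump (mscale_ l *: z + (- ((mscale_ l * l) *: x) - s^-1 *: c)))).
    by apply: smooth_affine; exact: smooth_unit_bump.
  by apply/funext => z; rewrite addrA.
- by apply: (subclosed_compact _ sq) => //; exact: closed_closure.
- apply: (subset_trans clsub) => _ [y /unit_squareP y1 <-].
  have [|y' y'c ->] := @mkernel_supp_pt x (A y).
    rewrite (_ : _ + _ = y)//; apply: pair_ext; rewrite /A /= /GRing.scale/=; field; rewrite a0 gt_eqF//.
  by apply: Estar => //; rewrite !ltW.
Qed.

(** Differentiating the kernel in [x] amounts to multiplying its derivative in [z] by - l, and the
    weak derivative of [v] absorbs the latter. The kernel is an admissible test function only for
    [x] in E. *)
Lemma partial_mollify i v t x : L2 E v -> L2 E t ->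
  (forall f : R * R -> R, test_function E f -> int2 E (fun z => v z * partial i f z) =
    - int2 E (fun z => t z * f z)) ->
  E x -> partial i (mollify l v) x = l * mollify l t x.
Proof.
move=> lv lt wv Ex; have a0 : mscale_ l != 0 by rewrite gt_eqF// mscale_gt0.
have sb := @smooth_unit_bump R; have b0 := @unit_bump_supp R.
have iv := L2_integrable mE Efin lv.
have dc : differentiable (conv E v (mscale_ l) (mscale_ l * l) (- (s^-1 *: c)) bump) x.
  by apply: smooth_differentiable; apply: smooth_conv.
rewrite (mollify_convE lv) (partialZ _ _ dc) (partial_conv _ _ _ mE iv)// (mollify_conv _ lt).
have := wv _ (mollifier_test_function Ex).
have pE z : partial i (fun z => bump (mscale_ l *: z - (mscale_ l * l) *: x + - (s^-1 *: c))) z =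
   mscale_ l * partial i bump (mscale_ l *: z - (mscale_ l * l) *: x + - (s^-1 *: c)).
  rewrite (_ : (fun z => _) = (fun z => bump (mscale_ l *: z + (- ((mscale_ l * l) *: x) - s^-1 *: c)))).
    rewrite partial_affine; last exact: smooth_differentiable.
    by rewrite addrA.
  by apply/funext => y; rewrite addrA.
rewrite /int2; under eq_Rintegral do rewrite pE mulrCA.
rewrite RintegralZl//; last first.
  apply: conv_integrable => //; first exact/smooth_continuous/smooth_partial.
  exact: partial_supp.
rewrite -[X in _ * X = _]/(conv E v (mscale_ l) (mscale_ l * l) (- (s^-1 *: c)) (partial i bump) x).
rewrite -[X in _ = - X]/(conv E t (mscale_ l) (mscale_ l * l) (- (s^-1 *: c)) bump x).
move: (conv E v _ _ _ _ _) (conv E t _ _ _ _ _) => V T VT.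
have -> : T = - (mscale_ l * V) by rewrite VT opprK.
ring.
Qed.

End FixedScale.

Lemma int2_cauchy_schwarz f g (N M : R) : L2 E f -> L2 E g -> 0 <= N -> 0 <= M ->
  sqint E f <= N ^+ 2 -> sqint E g <= M ^+ 2 -> `|int2 E (fun x => f x * g x)| <= N * M.
Proof.
move=> lf lg N0 M0 fN gM; rewrite -ler_sqr ?nnegrE ?mulr_ge0// real_normK ?num_real// exprMn.
have l0 : L2 E (fun=> 0) by exact: L2_cst.
have := @ip_cauchy_schwarz _ E (fun x => (f x, 0)) (fun x => (g x, 0)) mE (conj lf l0) (conj lg l0).
have iE h k : ip E (fun x => (h x, 0)) (fun x => (k x, 0)) = int2 E (fun x => h x * k x).
  by apply: eq_Rintegral => x _; rewrite /dot/= mulr0 addr0.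
have sE h : int2 E (fun x => h x * h x) = sqint E h.
  by apply: eq_Rintegral => x _; rewrite expr2.
rewrite !iE !sE => /le_trans; apply; apply: ler_pM => //;
  by apply: Rintegral_ge0 => x _; exact: sqr_ge0.
Qed.

(** Writing T for the mollification and k for a Lipschitz function close to f in L^2, f (T f - f) =
    f T (f - k) + f (T k - k) + f (k - f). The outer terms are small uniformly for l >= 1/2, where T
    has norm at most 2; the middle one is of order 1 - l. *)
Lemma mollify_weak_cvg f (e : R) : L2 E f -> 0 < e -> exists2 l0 : R, l0 < 1 &
  forall l, 1 / 2 <= l -> l0 <= l -> l < 1 ->
    `|int2 E (fun x => f x * mollify l f x) - sqint E f| <= e.
Proof.
move=> lf e0; pose N := Num.sqrt (sqint E f).
have N0 : 0 <= N := sqrtr_ge0 _.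
have sf0 : 0 <= sqint E f by apply: Rintegral_ge0 => x _; exact: sqr_ge0.
have fN : sqint E f <= N ^+ 2 by rewrite sqr_sqrtr.
(* The outer terms are at most 2 N d and N d, together 3 e / 4; the remaining e / 4 is for the
   Lipschitz term. *)
pose d := e / (4 * (N + 1)).
have N1 : 0 < N + 1 by rewrite ltr_wpDl.
have d0 : 0 < d by rewrite divr_gt0// mulr_gt0.
have [_ /(_ (d ^+ 2) (exprn_gt0 _ d0)) [k bk fk]] := L2_lipschitz_dense mE Efin lf.
have lk := bounded_lipschitz_L2 mE Efin bk.
have [L [Bk [kL _]]] := bk.
have kL' (x y : R * R) : `|k x - k y| <= `|L| * `|x - y|.
  by rewrite (le_trans (kL x y))// ler_wpM2r// ler_norm.
pose m := Num.sqrt (fine (leb2 E)); pose P := N * (`|L| * (2 * `|B|) * m).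
have m0 : 0 <= m := sqrtr_ge0 _.
have P0 : 0 <= P by rewrite !mulr_ge0.
have P1 : 0 < P + 1 by rewrite ltr_wpDl.
exists (1 - e / (4 * (P + 1))); first by rewrite gtrBl divr_gt0// mulr_gt0.
move=> l l2 ll0 l1; have l0 : 0 < l by rewrite (lt_le_trans _ l2)// divr_gt0.
have lfk := L2_sub lf lk.
have lTf := mollify_L2 l0 l1 lf; have lTk := mollify_L2 l0 l1 lk.
have lTfk := mollify_L2 l0 l1 lfk.
have lTkk := L2_sub lTk lk; have lkf := L2_sub lk lf.
have i1 := L2_integrableM mE lf lTfk.
have i2 := L2_integrableM mE lf lTkk.
have i3 := L2_integrableM mE lf lkf.
have -> : int2 E (fun x => f x * mollify l f x) - sqint E f =
   int2 E (fun x => f x * mollify l (fun z => f z - k z) x) +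
   int2 E (fun x => f x * (mollify l k x - k x)) + int2 E (fun x => f x * (k x - f x)).
  rewrite /int2 -RintegralD// -RintegralD//; last first.
    by have := integrableD mE i1 i2; apply: eq_integrable.
  rewrite /sqint /int2 -RintegralB//; last 2 first.
  - exact: L2_integrableM.
  - exact: L2_sqr_integrable.
  apply: eq_Rintegral => x _; rewrite mollifyB//; ring.
have b1 : `|int2 E (fun x => f x * mollify l (fun z => f z - k z) x)| <= N * (2 * d).
  apply: int2_cauchy_schwarz => //; first by rewrite mulr_ge0// ltW.
  rewrite (le_trans (mollify_sqint l0 l1 lfk))// exprMn.
  apply: ler_pM => //; first by rewrite invr_ge0 sqr_ge0.
    by apply: Rintegral_ge0 => x _; exact: sqr_ge0.
  have lV : l^-1 <= 2 by rewrite invf_ple ?posrE//; move: l2; rewrite mul1r.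
  by rewrite -exprVn ler_sqr ?nnegrE// invr_ge0 ltW.
have b3 : `|int2 E (fun x => f x * (k x - f x))| <= N * d.
  apply: int2_cauchy_schwarz => //; first exact: ltW.
  by apply: le_trans fk; rewrite le_eqVlt; apply/orP; left; apply/eqP;
    apply: eq_Rintegral => x _; ring.
have b2 : `|int2 E (fun x => f x * (mollify l k x - k x))| <=
    N * (`|L| * ((1 - l) * (2 * `|B|)) * m).
  have l1' : 0 <= 1 - l by rewrite subr_ge0 ltW.
  apply: int2_cauchy_schwarz => //; first by rewrite !mulr_ge0.
  rewrite exprMn sqr_sqrtr ?fine_ge0//.
  have <- := @Rintegral_cst _ _ _ leb2 E mE ((`|L| * ((1 - l) * (2 * `|B|))) ^+ 2).
  apply: le_Rintegral => //.
  - exact: L2_sqr_integrable.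
  - by have := L2_sqr_integrable mE (L2_cst (`|L| * ((1 - l) * (2 * `|B|))) mE Efin); apply: eq_integrable.
  - move=> x Ex; rewrite -[(_ - _) ^+ 2]real_normK ?num_real// ler_sqr ?nnegrE// ?mulr_ge0//.
    have B0 : 0 <= B by exact: le_trans (EB Ex).
    by rewrite (ger0_norm B0); apply: mollify_lipschitz.
rewrite (le_trans (ler_normD _ _))//.
apply: (@le_trans _ _ (N * (2 * d) + N * (`|L| * ((1 - l) * (2 * `|B|)) * m) + N * d)).
  by rewrite lerD// (le_trans (ler_normD _ _))// lerD.
have h1 : N * d <= e / 4.
  have -> : e / 4 = (N + 1) * d by rewrite /d; field; rewrite gt_eqF.
  by rewrite ler_wpM2r ?ltW// ltrDl.
have h2 : P * (1 - l) <= e / 4.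
  apply: (@le_trans _ _ ((P + 1) * (e / (4 * (P + 1))))).
    by apply: ler_pM => //; rewrite ?subr_ge0 ?(ltW l1) ?lerDl//; lra.
  by rewrite le_eqVlt; apply/orP; left; apply/eqP; field; rewrite gt_eqF.
have -> : N * (`|L| * ((1 - l) * (2 * `|B|)) * m) = P * (1 - l) by rewrite /P; ring.
have -> : N * (2 * d) = 2 * (N * d) by ring.
by lra.
Qed.

End Mollifier.

(** * Geometry of star-shaped quadrilaterals *)

Section Euclid.
Variable R : realType.
Implicit Types (x y z u v w a b c : R * R) (A : set (R * R)).

Definition cross u v : R := u.1 * v.2 - u.2 * v.1.

Lemma enorm_ge0 x : 0 <= enorm x.
Proof. exact: sqrtr_ge0. Qed.

Lemma sqr_enorm x : enorm x ^+ 2 = dot x x.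
Proof. by rewrite sqr_sqrtr// dot_ge0. Qed.

Lemma enormZ (t : R) x : enorm (t *: x) = `|t| * enorm x.
Proof.
rewrite /enorm (_ : dot _ _ = t ^+ 2 * dot x x); last by rewrite /dot/= /GRing.scale/=; ring.
by rewrite sqrtrM ?sqr_ge0// sqrtr_sqr.
Qed.

Lemma enormN x : enorm (- x) = enorm x.
Proof. by rewrite -scaleN1r enormZ normrN normr1 mul1r. Qed.

Lemma enorm_eq0 x : (enorm x == 0) = (x == 0).
Proof.
rewrite sqrtr_eq0 /dot; apply/idP/eqP => [|->]; last by rewrite /= mul0r addr0.
rewrite -!expr2 => h.
have : x.1 ^+ 2 + x.2 ^+ 2 == 0 by rewrite eq_le h addr_ge0 ?sqr_ge0.
rewrite paddr_eq0 ?sqr_ge0// !sqrf_eq0 => /andP[/eqP x1 /eqP x2].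
exact: pair_ext.
Qed.

Lemma fst_le_enorm x : `|x.1| <= enorm x.
Proof.
rewrite -ler_sqr ?nnegrE ?enorm_ge0// sqr_enorm real_normK ?num_real// /dot -!expr2.
by rewrite lerDl sqr_ge0.
Qed.

Lemma snd_le_enorm x : `|x.2| <= enorm x.
Proof.
rewrite -ler_sqr ?nnegrE ?enorm_ge0// sqr_enorm real_normK ?num_real// /dot -!expr2.
by rewrite lerDr sqr_ge0.
Qed.

Lemma norm_le_enorm x : `|x| <= enorm x.
Proof. by rewrite prod_normE/= ge_max fst_le_enorm snd_le_enorm. Qed.

Lemma enorm_le_norm x : enorm x <= 2 * `|x|.
Proof.
have x1 : `|x.1| <= `|x| by rewrite prod_normE/= le_max lexx.
have x2 : `|x.2| <= `|x| by rewrite prod_normE/= le_max lexx orbT.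
rewrite -ler_sqr ?nnegrE ?enorm_ge0 ?mulr_ge0// sqr_enorm /dot -!expr2.
rewrite -[x.1 ^+ 2]real_normK ?num_real// -[x.2 ^+ 2]real_normK ?num_real//.
have := ler_pM (normr_ge0 _) (normr_ge0 _) x1 x1; have := ler_pM (normr_ge0 _) (normr_ge0 _) x2 x2.
by rewrite exprMn -!expr2; have := sqr_ge0 `|x|; lra.
Qed.

Lemma continuous_enorm : continuous (@enorm R).
Proof.
move=> x; rewrite /enorm; apply: (@continuous_comp _ _ _ (fun x : R * R => dot x x) Num.sqrt).
  rewrite /dot; apply: differentiable_continuous.
  by apply: differentiableD; apply: differentiableM; (exact: differentiable_fst || exact: differentiable_snd).
exact: sqrt_continuous.
Qed.

Lemma open_eball c (r : R) : open (eball c r).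
Proof.
rewrite (_ : eball c r = (fun x => enorm (x - c)) @^-1` `]-oo, r[); last first.
  by apply/seteqP; split=> x /=; rewrite in_itv.
apply: open_comp; last exact: interval_open.
move=> x _; apply: (@continuous_comp _ _ _ (fun x : R * R => x - c) (@enorm R)).
  by apply: differentiable_continuous; exact: differentiableB.
exact: continuous_enorm.
Qed.

Lemma dot_le_enorm u v : `|dot u v| <= enorm u * enorm v.
Proof.
rewrite -ler_sqr ?nnegrE ?mulr_ge0 ?enorm_ge0// exprMn !sqr_enorm real_normK ?num_real//.
rewrite -subr_ge0 (_ : _ - _ = cross u v ^+ 2) ?sqr_ge0// /dot /cross; ring.
Qed.

Lemma parallel_proj (p q w1 w2 : R) : w1 * w1 + w2 * w2 != 0 -> p * w2 = q * w1 ->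
  p = (p * w1 + q * w2) / (w1 * w1 + w2 * w2) * w1.
Proof.
move=> w0 pq; apply: (mulIf w0); rewrite [RHS]mulrAC divfK//.
have -> : (p * w1 + q * w2) * w1 = p * (w1 * w1 + w2 * w2) - w2 * (p * w2 - q * w1) by ring.
by rewrite pq subrr mulr0 subr0.
Qed.

Section Star.
Variables (E : set (R * R)) (c : R * R) (r : R).
Hypotheses (star : star_shaped_ball E c r) (r_gt0 : 0 < r).

Lemma eball_center : eball c r c.
Proof. by rewrite /eball/= subrr (_ : enorm 0 = 0)//; apply/eqP; rewrite enorm_eq0. Qed.

(** The ball leaves room to pass to the closure: when [x] is replaced by a nearby point [x'] of E,
    [y] moves to [m x'], still in the ball, and the segment between them contains the same target
    point. The slope t / (1 - t) of [m] is why t < 1. *)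
Lemma star_closure y x (t : R) : eball c r y -> closure E x -> 0 <= t < 1 ->
  E (y + t *: (x - y)).
Proof.
move=> By clx /andP[t0 t1].
have t1' : 1 - t != 0 by rewrite gt_eqF// subr_gt0.
pose k := t / (1 - t); pose m (x' : R * R) := y + k *: (x - x').
have cm : {for x, continuous m}.
  by apply: differentiable_continuous; apply: differentiableD.
have mx : m x = y by rewrite /m subrr scaler0 addr0.
have nb : nbhs x (m @^-1` eball c r).
  by apply: cm; rewrite mx; apply: open_nbhs_nbhs; split=> //; exact: open_eball.
have [x' [Ex' Bm]] := clx _ nb.
have := star Bm Ex'; apply; exists t; first by rewrite /= in_itv/= t0 ltW.
by apply: pair_ext; rewrite /m /k/= /GRing.scale/=; field.
Qed.

Variables (a b : R * R).
Hypotheses (ab : a != b).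
Hypothesis edge_cl : forall x, segment a b x -> closure E x.
Hypothesis edge_out : forall x, segment a b x -> ~ E x.

Lemma segment_l : segment a b a.
Proof. by exists 0; rewrite ?scale0r ?addr0//= in_itv/= lexx ler01. Qed.

Lemma segment_r : segment a b b.
Proof. by exists 1; rewrite ?scale1r ?subrKC//= in_itv/= lexx ler01. Qed.

(** If [y] were on the line of the edge, then according to its position [a] would lie strictly
    between [y] and [b], or [y] on the edge, or [b] strictly between [y] and [a]. Each case puts a
    point of the edge in E. *)
Lemma star_line_ball y : eball c r y -> cross (a - y) (b - a) != 0.
Proof.
move=> By; apply/eqP => ab0.
pose w := b - a; have w0 : dot w w != 0.
  rewrite -sqr_enorm expf_neq0// enorm_eq0 subr_eq0; by rewrite eq_sym.
pose t := dot (y - a) w / dot w w.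
have yE : y = a + t *: w.
  have c0 : (y - a).1 * w.2 = (y - a).2 * w.1.
    by apply/eqP; rewrite -subr_eq0; apply/eqP; move: ab0; rewrite /cross /w/=; lra.
  have e1 : (y - a).1 = t * w.1 by rewrite /t /dot; apply: parallel_proj.
  have e2 : (y - a).2 = t * w.2.
    have -> : t = ((y - a).2 * w.2 + (y - a).1 * w.1) / (w.2 * w.2 + w.1 * w.1).
      by rewrite /t /dot; congr (_ / _); rewrite addrC.
    by apply: parallel_proj => //; rewrite addrC.
  by apply: pair_ext; rewrite /= /GRing.scale/= -?e1 -?e2 /=; ring.
have Ey : E y.
  by have := star_closure By (edge_cl segment_l) (t := 0); rewrite scale0r addr0 lexx ltr01; exact.
have [t0|t0] := ltP t 0.
  apply: (edge_out segment_l).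
  have t1 : 1 - t != 0 by rewrite gt_eqF// subr_gt0 (lt_trans t0).
  have -> : a = y + (- t / (1 - t)) *: (b - y).
    by rewrite yE; apply: pair_ext; rewrite /= /GRing.scale/= /w/=; field.
  apply: star_closure => //; first exact: (edge_cl segment_r).
  have t1' : 0 < 1 - t by rewrite subr_gt0 (lt_trans t0).
  by rewrite divr_ge0 ?oppr_ge0 ?ltW//= ltr_pdivrMr// mul1r; lra.
have [t1|t1] := leP t 1.
  by apply: (edge_out _ Ey); exists t; rewrite ?yE//= in_itv/= t0.
apply: (edge_out segment_r).
have t0' : t != 0 by rewrite gt_eqF// (lt_trans ltr01).
have -> : b = y + ((t - 1) / t) *: (a - y).
  by rewrite yE; apply: pair_ext; rewrite /= /GRing.scale/= /w/=; field.
apply: star_closure => //; first exact: (edge_cl segment_l).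
have tp : 0 < t by rewrite (lt_trans ltr01).
by rewrite divr_ge0 ?ltW ?subr_gt0//= ltr_pdivrMr// mul1r; lra.
Qed.

(** The cross product is the length of the edge times the distance from [c] to its line. Were that
    distance less than [r], the foot [y] of the perpendicular would be a point of the ball on the
    line. *)
Lemma star_cross_ge : r * enorm (b - a) <= `|cross (a - c) (b - c)|.
Proof.
rewrite leNgt; apply/negP => lt_r.
pose w := b - a; have w0 : 0 < enorm w.
  by rewrite lt_neqAle enorm_ge0 eq_sym enorm_eq0 subr_eq0 eq_sym ab.
have ww : dot w w != 0 by rewrite -sqr_enorm expf_neq0// gt_eqF.
pose D := cross (a - c) (b - c); pose n : R * R := (w.2, - w.1).
pose y := c + (D / dot w w) *: n.
have By : eball c r y.
  rewrite /eball/= /y addrAC subrr add0r enormZ.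
  have -> : enorm n = enorm w by rewrite /enorm /n /dot/=; congr Num.sqrt; ring.
  rewrite -sqr_enorm normrM normfV [`|_ ^+ 2|]ger0_norm ?sqr_ge0// expr2 invfM.
  rewrite -mulrA -mulrA mulVf ?gt_eqF// mulr1 ltr_pdivrMr//.
have := star_line_ball By; rewrite (_ : cross _ _ = 0) ?eqxx//.
have -> : cross (a - y) (b - a) = D - D / dot w w * dot w w.
  by rewrite /y /D /cross /n /dot /w/= /GRing.scale/=; ring.
by rewrite divfK// subrr.
Qed.

End Star.

(* If the triangles c p q and c q s were oppositely oriented, a ray from c close to
   cq would meet both edges, at points that cannot both lie outside E. *)
Lemma star_adjacent_cross (E : set (R * R)) (c : R * R) (r : R) (p q s : R * R) :
  star_shaped_ball E c r -> 0 < r ->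
  (forall x, segment p q x -> closure E x /\ ~ E x) ->
  (forall x, segment q s x -> closure E x /\ ~ E x) ->
  segment p q `&` segment q s = [set q] -> p != q ->
  cross (p - c) (q - c) != 0 -> cross (q - c) (s - c) != 0 ->
  0 < cross (p - c) (q - c) * cross (q - c) (s - c).
Proof.
move=> star r0 e1 e2 pqs pq; set P := cross _ (q - c); set Q := cross (q - c) _ => P0 Q0.
rewrite ltNge; apply/negP => PQ.
pose b := q - c; pose K := cross (p - q) (s - q).
pose u := dot (p - q) b; pose v := dot (s - q) b; pose n := dot b b.
have n0 : 0 < n.
  rewrite /n lt_neqAle dot_ge0 andbT eq_sym -sqr_enorm expf_neq0// enorm_eq0.
  by apply: contraNneq P0 => b0; rewrite /P -/b b0 /cross/= !mulr0 subrr.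
have aQ : 0 < `|Q| by rewrite normr_gt0.
have aP : 0 < `|P| by rewrite normr_gt0.
have PQE : P * `|Q| = - (Q * `|P|).
  have [P1|P1] := ltP 0 P.
    by rewrite ler0_norm ?gtr0_norm//; [ring|rewrite -(pmulr_rle0 _ P1)].
  have {}P1 : P < 0 by rewrite lt_neqAle P0.
  by rewrite ger0_norm ?ltr0_norm//; [ring|rewrite -(nmulr_rle0 _ P1)].
pose g := Num.sg P.
have gP : P = g * `|P| by rewrite /g mulr_sg_norm.
have gQ : Q = - (g * `|Q|).
  by apply: (mulIf (lt0r_neq0 aP)); rewrite mulNr mulrAC -gP PQE opprK.
have gK : `|g * K| <= `|K| by rewrite /g normrM normr_sg P0 mul1r.
have gg : g * g = 1 by rewrite /g -expr2 sqr_sg P0.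
(* [M] adds up the ratios required by [c1] to [c4], so that the single small parameter e = 1 / M
   meets these four conditions, and e <= 1. *)
pose M := 1 + 2 * `|K| / `|Q| + 2 * `|P| / `|Q| + 2 * `|u| / n + 4 * `|P| * `|v| / (`|Q| * n).
have m1 : 0 <= 2 * `|K| / `|Q| by rewrite divr_ge0// mulr_ge0.
have m2 : 0 <= 2 * `|P| / `|Q| by rewrite divr_ge0// mulr_ge0.
have m3 : 0 <= 2 * `|u| / n by rewrite divr_ge0 ?mulr_ge0// ltW.
have m4 : 0 <= 4 * `|P| * `|v| / (`|Q| * n) by rewrite divr_ge0 ?mulr_ge0// ltW.
have M0 : 0 < M by rewrite /M; lra.
pose e := M^-1; have e0 : 0 < e by rewrite invr_gt0.
have eM (X Y : R) : 0 < Y -> X / Y <= M -> e * X <= Y.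
  by move=> Y0; rewrite ler_pdivrMr// /e ler_pdivrMl.
have e_le1 : e <= 1 by rewrite /e invf_le1// /M; lra.
have c1 : e * (2 * `|K|) <= `|Q| by apply: eM => //; rewrite /M; lra.
have c2 : e * (2 * `|P|) <= `|Q| by apply: eM => //; rewrite /M; lra.
have c3 : e * (2 * `|u|) <= n by apply: eM => //; rewrite /M; lra.
have c4 : e * (4 * `|P| * `|v|) <= `|Q| * n.
  by apply: eM; [rewrite mulr_gt0|rewrite /M; lra].
clear m1 m2 m3 m4 M0 eM; clearbody e; clear M.
have egK : `|e * (g * K)| <= `|Q| / 2.
  rewrite normrM gtr0_norm// ler_pdivlMr//.
  by rewrite -mulrA (le_trans _ c1)// ler_wpM2l ?(ltW e0)// mulrC ler_wpM2l.
pose D := `|Q| - e * (g * K).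
have DQ : `|Q| / 2 <= D by rewrite /D; have := ler_norm (e * (g * K)); lra.
have D0 : 0 < D by rewrite (lt_le_trans _ DQ)// divr_gt0.
(* Solves [cross P1 P2 = 0]: the point of [segment q s] with parameter [t] is then aligned with [c]
   and the point of [segment p q] at parameter [e] from [q]. *)
pose t := e * `|P| / D.
have t0 : 0 < t by rewrite divr_gt0// mulr_gt0.
have tD : t * D = e * `|P| by rewrite /t divfK// gt_eqF.
have tQ : t * `|Q| <= 2 * (e * `|P|).
  by rewrite -tD mulrCA ler_wpM2l ?(ltW t0)//; lra.
have t1 : t <= 1.
  rewrite -(ler_pM2r aQ) mul1r (le_trans tQ)//; lra.
pose P1 := b + e *: (p - q); pose P2 := b + t *: (s - q).
have PP : cross P1 P2 = 0.
  have -> : cross P1 P2 = t * Q + e * P + e * t * K.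
    by rewrite /cross /P1 /P2 /Q /P /K /b /cross/= /GRing.scale/=; ring.
  have -> : t * Q + e * P + e * t * K = g * (e * `|P| - t * D).
    have alg (g' P' Q' K' aP' aQ' : R) : P' = g' * aP' -> Q' = - (g' * aQ') -> g' * g' = 1 ->
        t * Q' + e * P' + e * t * K' = g' * (e * aP' - t * (aQ' - e * (g' * K'))).
      move=> -> -> gg'.
      transitivity (g' * (e * aP') - g' * (t * aQ') + (g' * g') * (e * t * K')); last by ring.
      by rewrite gg'; ring.
    exact: alg gP gQ gg.
  by rewrite tD subrr mulr0.
have d1 : 0 < dot P1 b.
  have -> : dot P1 b = n + e * u by rewrite /P1 /n /u /dot/= /GRing.scale/=; ring.
  have : `|e * u| <= n / 2 by rewrite normrM (gtr0_norm e0); lra.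
  by rewrite ler_norml; lra.
have d2 : 0 < dot P2 b.
  have -> : dot P2 b = n + t * v by rewrite /P2 /n /v /dot/= /GRing.scale/=; ring.
  have : `|t * v| <= n / 2.
    rewrite normrM (gtr0_norm t0) -(ler_pM2r aQ) mulrAC.
    apply: (@le_trans _ _ (2 * (e * `|P|) * `|v|)); first by rewrite ler_wpM2r.
    lra.
  by rewrite ler_norml; lra.
have par : dot P2 b *: P1 = dot P1 b *: P2.
  have idn : dot P2 b *: P1 = dot P1 b *: P2 + cross P1 P2 *: (b.2, - b.1).
    by apply: pair_ext; rewrite /dot /cross/= /GRing.scale/=; ring.
  by rewrite idn PP scale0r addr0.
have x1 : segment p q (c + P1).
  exists (1 - e); first by rewrite /= in_itv/= subr_ge0 e_le1 gerBl ltW.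
  by apply: pair_ext; rewrite /P1 /b /= /GRing.scale/=; ring.
have x2 : segment q s (c + P2).
  exists t; first by rewrite /= in_itv/= t1 ltW.
  by apply: pair_ext; rewrite /P2 /b /= /GRing.scale/=; ring.
have Bc := eball_center c r0.
have sub x y (k : R) : closure E y -> ~ E x -> 0 <= k < 1 -> x - c = k *: (y - c) -> False.
  move=> cly nEx k01 xy; apply: nEx.
  have -> : x = c + k *: (y - c) by rewrite -xy addrC subrK.
  exact: (star_closure star Bc cly k01).
have cP x : c + x - c = x by rewrite addrAC subrr add0r.
(* On a common ray the point nearer to [c] lies in E, because the farther one is in the closure; but
   the edges avoid E. If the two points coincide, the common point must be [q], which [e > 0] and
   [p != q] exclude. *)
have [lt12|lt21|eq12] := ltgtP (dot P1 b) (dot P2 b).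
- apply: (sub (c + P1) (c + P2) (dot P1 b / dot P2 b)).
  + by case: (e2 _ x2).
  + by case: (e1 _ x1).
  + by rewrite divr_ge0 ?ltW//= ltr_pdivrMr// mul1r.
  + by rewrite !cP mulrC -scalerA -par scalerA mulVf ?scale1r// gt_eqF.
- apply: (sub (c + P2) (c + P1) (dot P2 b / dot P1 b)).
  + by case: (e1 _ x1).
  + by case: (e2 _ x2).
  + by rewrite divr_ge0 ?ltW//= ltr_pdivrMr// mul1r.
  + by rewrite !cP mulrC -scalerA par scalerA mulVf ?scale1r// gt_eqF.
have P12 : P1 = P2.
  have d0 : dot P2 b != 0 by rewrite gt_eqF.
  by apply: (scalerI d0); rewrite par eq12.
have : (segment p q `&` segment q s) (c + P1) by split=> //; rewrite P12.
rewrite pqs /= => /eqP; rewrite -subr_eq0 (_ : _ - _ = e *: (p - q)).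
  by rewrite scaler_eq0 gt_eqF//= subr_eq0 (negbTE pq).
by apply: pair_ext; rewrite /P1 /b/= /GRing.scale/=; ring.
Qed.

End Euclid.

(** * Shape regularity of one element *)

Section QuadGeometry.
Variable R : realType.

Lemma diam_ub (A : set (R * R)) (x y : R * R) : bounded_set A -> A x -> A y ->
  enorm (x - y) <= diam A.
Proof.
move=> [M [_ AM]] Ax Ay; apply: sup_ubound; last by exists (x, y).
have M1 : M < M + 1 by rewrite ltrDl.
exists (2 * (M + 1 + (M + 1))) => _ [[u v] /= [Au Av] <-].
rewrite (le_trans (enorm_le_norm _))// ler_wpM2l//.
by rewrite (le_trans (ler_normB _ _))// lerD//; exact: (AM _ M1).
Qed.

Lemma closed_enorm_le (c : R * R) (h : R) : closed [set x | enorm (x - c) <= h].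
Proof.
rewrite (_ : [set x | _] = (fun x => enorm (x - c)) @^-1` `]-oo, h]); last first.
  by apply/seteqP; split=> x /=; rewrite in_itv.
apply: closed_comp; last exact: closed_le.
move=> x _; apply: (@continuous_comp _ _ _ (fun x : R * R => x - c) (@enorm R)).
  by apply: differentiable_continuous; exact: differentiableB.
exact: continuous_enorm.
Qed.

Lemma open_diam_gt0 (A : set (R * R)) : open A -> bounded_set A -> A !=set0 -> 0 < diam A.
Proof.
move=> oA bA [x Ax].
have /nbhs_ballP[e /= e0 xe] := open_nbhs_nbhs (conj oA Ax).
pose y := (x.1 + e / 2, x.2).
have e2 : 0 < e / 2 by rewrite divr_gt0.
have Ay : A y.
  apply: xe; split; rewrite -ball_normE /y/=; last by rewrite subrr normr0.
  by rewrite opprD addrA subrr sub0r normrN gtr0_norm// ltr_pdivrMr// ltr_pMr// ltr1n.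
apply: lt_le_trans (diam_ub bA Ay Ax).
rewrite lt_neqAle enorm_ge0 eq_sym enorm_eq0 subr_eq0 andbT.
by apply/eqP => yx; have := congr1 fst yx; rewrite /y/=; lra.
Qed.

(** Twice the signed area of the quadrilateral. *)
Definition cross_diag (z : 'I_4 -> R * R) : R :=
  cross (z (inord 2) - z (inord 0)) (z (inord 3) - z (inord 1)).

Lemma ordS_inord (k : nat) : (k < 3)%N -> ordS (inord k : 'I_4) = inord k.+1.
Proof.
move=> k3; apply/val_inj; rewrite /= !inordK ?modn_small//; exact: ltn_trans k3 _.
Qed.

Lemma ordS_inord3 : ordS (inord 3 : 'I_4) = inord 0.
Proof. by apply/val_inj; rewrite /= !inordK. Qed.

Lemma ord4P (P : 'I_4 -> Prop) : P (inord 0) -> P (inord 1) -> P (inord 2) -> P (inord 3) ->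
  forall i, P i.
Proof.
move=> P0 P1 P2 P3 i; rewrite -(inord_val i).
by case: i => [[|[|[|[|//]]]] ?] /=.
Qed.

Lemma sum_ord4 (V : nmodType) (F : 'I_4 -> V) : \sum_(i < 4) F i =
  F (inord 0) + F (inord 1) + F (inord 2) + F (inord 3).
Proof.
rewrite !big_ord_recr big_ord0/= add0r.
by congr (F _ + F _ + F _ + F _); apply/val_inj; rewrite /= inordK.
Qed.

(** The mesh assumptions read at the scale [h] of one element: distances to [c] are at most [h], and
    the triangles on [c] and an edge, like the pair of diagonals, are non-degenerate up to powers of
    gamma. *)
Record good_quad (gamma : R) (Q : quad R) (c : R * R) (r h : R) : Prop := GoodQuad {
  gq_open : open (region Q);
  gq_h : 0 < h;
  gq_r : gamma * h <= r;
  gq_r0 : 0 < r;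
  gq_star : star_shaped_ball (region Q) c r;
  gq_bound : forall x, region Q x -> enorm (x - c) <= h;
  gq_edge : forall i x, edge Q i x -> closure (region Q) x;
  gq_vertex : forall i, enorm (vertex Q i - c) <= h;
  gq_cross : forall i, gamma ^+ 2 * h ^+ 2 <= `|cross (vertex Q i - c) (vertex Q (ordS i) - c)|;
  gq_diag : 4 * gamma ^+ 2 * h ^+ 2 <= `|cross_diag (vertex Q)| }.

(** [h] is the diameter. Each triangle bound multiplies the radius from (A.1) by the edge length
    from (A.2), and the diagonal bound adds the four triangles, which all have the same
    orientation. *)
Lemma quad_geometry (gamma : R) (Q : quad R) : 0 < gamma -> is_quadrilateral Q ->
  mesh_star gamma Q -> mesh_edge gamma Q -> exists c r h, good_quad gamma Q c r h.
Proof.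
move=> g0 [[inj adj opp] oE bE bdE] [c [r [gr star]]] medge.
set E := region Q in oE bE bdE gr star; pose h := diam E.
have edgeE i x : edge Q i x -> closure E x /\ ~ E x.
  move=> ix; have : (closure E `\` E) x by rewrite bdE; exists i.
  by case.
have E0 : E !=set0.
  have [clv _] : closure E (vertex Q (inord 0)) /\ ~ E (vertex Q (inord 0)).
    by apply: (edgeE (inord 0)); exact: segment_l.
  by have [x [Ex _]] := clv setT filterT; exists x.
have h0 : 0 < h by exact: open_diam_gt0.
have r0 : 0 < r by rewrite (lt_le_trans _ gr)// mulr_gt0.
have Bc := eball_center c r0.
have Ec : E c.
  have [x Ex] := E0; apply: (star _ _ Bc Ex).
  by exists 0; rewrite ?scale0r ?addr0//= in_itv/= lexx ler01.
have Eh x : E x -> enorm (x - c) <= h by move=> Ex; exact: diam_ub.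
have clh x : closure E x -> enorm (x - c) <= h.
  have := closure_subset Eh; rewrite -((closure_id _).1 (@closed_enorm_le c h)); exact.
have vh i : enorm (vertex Q i - c) <= h.
  by apply: clh; case: (edgeE i (vertex Q i)) => //; exact: segment_l.
have vne i : vertex Q i != vertex Q (ordS i).
  by apply/eqP => /inj /(congr1 val); case: i => [[|[|[|[|//]]]] ?].
have crossr i : r * enorm (vertex Q (ordS i) - vertex Q i) <=
    `|cross (vertex Q i - c) (vertex Q (ordS i) - c)|.
  apply: (star_cross_ge star (vne i)).
  - by move=> x ix; case: (edgeE i x ix).
  - by move=> x ix; case: (edgeE i x ix).
have crossg i : gamma ^+ 2 * h ^+ 2 <= `|cross (vertex Q i - c) (vertex Q (ordS i) - c)|.
  apply: le_trans (crossr i); rewrite -exprMn expr2; apply: ler_pM => //.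
  - by rewrite mulr_ge0// ltW.
  - by rewrite mulr_ge0// ltW.
  - exact: medge.
have gh0 : 0 < gamma ^+ 2 * h ^+ 2 by rewrite mulr_gt0// exprn_gt0.
have cne i : cross (vertex Q i - c) (vertex Q (ordS i) - c) != 0.
  by rewrite -normr_gt0 (lt_le_trans gh0).
have same i : 0 < cross (vertex Q i - c) (vertex Q (ordS i) - c) *
    cross (vertex Q (ordS i) - c) (vertex Q (ordS (ordS i)) - c).
  apply: (star_adjacent_cross star r0 (edgeE i) (edgeE (ordS i)) (adj i)) => //.
exists c, r, h; split=> //.
- by move=> i x /edgeE[].
- have S0 : ordS (inord 0 : 'I_4) = inord 1 by rewrite ordS_inord.
  have S1 : ordS (inord 1 : 'I_4) = inord 2 by rewrite ordS_inord.
  have S2 : ordS (inord 2 : 'I_4) = inord 3 by rewrite ordS_inord.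
  pose X i := cross (vertex Q i - c) (vertex Q (ordS i) - c).
  (* Shoelace formula, in which [c] cancels. *)
  have sumX : cross_diag (vertex Q) = X (inord 0) + X (inord 1) + X (inord 2) + X (inord 3).
    by rewrite /X ordS_inord3 !S0 !S1 !S2 /cross_diag /cross/=; ring.
  rewrite sumX; have := crossg (inord 0); have := crossg (inord 1); have := crossg (inord 2).
  have := crossg (inord 3); rewrite -!/(X _).
  have := same (inord 0); have := same (inord 1); have := same (inord 2).
  rewrite -!/(X _) !S0 !S1 !S2.
  move: (X (inord 0)) (X (inord 1)) (X (inord 2)) (X (inord 3)) (gamma ^+ 2) (h ^+ 2) => a b d e k l.
  have sgn (u v : R) : 0 < u * v -> (0 < u /\ 0 < v) \/ (u < 0 /\ v < 0).
    have [u0|u0|->] := ltgtP u 0.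
    - by rewrite nmulr_rgt0//; right.
    - by rewrite pmulr_rgt0//; left.
    - by rewrite mul0r ltxx.
  move=> /sgn s3 /sgn s2 /sgn s1.
  have [|] := ltP 0 a => a0.
    have b0 : 0 < b by case: s1 => -[]; lra.
    have d0 : 0 < d by case: s2 => -[]; lra.
    have e0 : 0 < e by case: s3 => -[]; lra.
    rewrite !gtr0_norm ?addr_gt0//; lra.
  have {}a0 : a < 0 by case: s1 => -[]; lra.
  have b0 : b < 0 by case: s1 => -[]; lra.
  have d0 : d < 0 by case: s2 => -[]; lra.
  have e0 : e < 0 by case: s3 => -[]; lra.
  have abde : a + b + d + e < 0 by lra.
  rewrite !ltr0_norm//; lra.
Qed.

End QuadGeometry.

(** * Trace inequality on triangles *)

Section Trace.
Variable R : realType.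
Notation mR := (measurableTypeR R).
Notation mR2 := (mR * mR)%type.
Notation mu := (@lebesgue_measure R).
Notation leb2 := (@leb2 R).

Lemma measurable_oo01 : measurable (`]0%R, 1%R[%classic : set mR).
Proof. exact: measurable_itv. Qed.

Lemma integral_oo_cc01 (f : R -> \bar R) : measurable_fun [set: mR] f ->
  (\int[mu]_(x in `]0%R, 1%R[) f x = \int[mu]_(x in `[0%R, 1%R]) f x)%E.
Proof.
move=> mf; rewrite integral_itv_bndo_bndc; last exact: measurable_funTS.
by rewrite integral_itv_obnd_cbnd//; exact: measurable_funTS.
Qed.

Lemma lebesgue_oo01 : (\int[mu]_(x in `]0%R, 1%R[) (1%R)%:E = 1)%E.
Proof.
by rewrite integral_cst//= lebesgue_measure_itv/= lte_fin ltr01 oppr0 adde0 mul1e.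
Qed.

Lemma jensen01 (f : R -> R) : measurable_fun [set: mR] f ->
  (((\int[mu]_(x in `]0%R, 1%R[) f x) ^+ 2)%:E <=
   \int[mu]_(x in `]0%R, 1%R[) (f x ^+ 2)%:E)%E.
Proof.
move=> mf.
have := @weighted_jensen _ mR R mu `]0%R, 1%R[%classic (cst 1) f measurable_oo01 (measurable_cst _)
  (measurable_funTS mf) (fun _ _ => ler01) lebesgue_oo01.
rewrite /cst/=.
under eq_Rintegral do rewrite mul1r.
by under eq_integral do rewrite mul1r.
Qed.

Lemma continuous_integrable01 (f : R -> R) : continuous f ->
  mu.-integrable `[0%R, 1%R]%classic (EFin \o f).
Proof.
by move=> cf; apply: continuous_compact_integrable; [exact: segment_compact|exact: continuous_subspaceT].
Qed.

Lemma continuous_line (phi : R * R -> R) (x k : R * R) : continuous phi ->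
  continuous (fun t : R => phi (x + t *: k)).
Proof.
move=> cphi t; apply: (@continuous_comp _ _ _ (fun t : R => x + t *: k) phi); last exact: cphi.
apply: (@continuousD R _ _ (cst x) (fun t : R => t *: k)); first exact: cst_continuous.
exact: scalel_continuous.
Qed.

Lemma continuous_dot (T : topologicalType) (u w : T -> R * R) :
  continuous (fst \o u) -> continuous (snd \o u) ->
  continuous (fst \o w) -> continuous (snd \o w) ->
  continuous (fun t => dot (u t) (w t)).
Proof.
move=> u1 u2 w1 w2 t; apply: cvgD; apply: cvgM;
  [exact: u1|exact: w1|exact: u2|exact: w2].
Qed.

Lemma FTC_line (phi : R * R -> R) (x k : R * R) : smooth phi ->
  \int[mu]_(t in `]0%R, 1%R[) dot (grad phi (x + t *: k)) k = phi (x + k) - phi x.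
Proof.
move=> sphi.
have cg : continuous (fun t : R => dot (grad phi (x + t *: k)) k).
  by apply: continuous_dot; try exact: cst_continuous;
    exact: (continuous_line (smooth_continuous (smooth_partial _ sphi))).
have dl t : is_derive (t : R^o) (1 : R^o) (fun t : R^o => phi (x + t *: k) : R^o) (dot (grad phi (x + t *: k)) k).
  have := @is_derive_line R phi x k t (sphi [::] _).
  by rewrite /dot/= [_ * k.1]mulrC [_ * k.2]mulrC.
have mg : measurable_fun [set: mR] (fun t : R => dot (grad phi (x + t *: k)) k).
  exact: continuous_measurable_fun.
rewrite /Rintegral integral_oo_cc01; last exact/measurable_EFinP.
rewrite (@continuous_FTC2 _ _ (fun t : R => phi (x + t *: k))) ?ltr01//.
- by rewrite /= scale1r scale0r addr0.
- exact: continuous_subspaceT.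
- split=> [t _| |].
  + by have [] := dl t.
  + by apply: cvg_at_right_filter; exact: (continuous_line (smooth_continuous sphi)).
  + by apply: cvg_at_left_filter; exact: (continuous_line (smooth_continuous sphi)).
- by move=> t _; rewrite derive1E; have [_ ->] := dl t.
Qed.

Lemma sqr_line_le (phi : R * R -> R) (x k : R * R) : smooth phi ->
  (((phi (x + k) - phi x) ^+ 2)%:E <= (enorm k ^+ 2)%:E *
    \int[mu]_(t in `]0%R, 1%R[) (dot (grad phi (x + t *: k)) (grad phi (x + t *: k)))%:E)%E.
Proof.
move=> sphi; rewrite -FTC_line//.
have cg i : continuous (fun t : R => partial i phi (x + t *: k)).
  exact: (continuous_line (smooth_continuous (smooth_partial _ sphi))).
have md (v : R -> R * R) : continuous (fst \o v) -> continuous (snd \o v) ->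
    measurable_fun [set: mR] (fun t : R => dot (grad phi (x + t *: k)) (v t)).
  by move=> c1 c2; apply: continuous_measurable_fun; apply: continuous_dot => //; exact: cg.
have mk : measurable_fun [set: mR] (fun t : R => dot (grad phi (x + t *: k)) k).
  by apply: (md (fun=> k)); exact: cst_continuous.
have mgg : measurable_fun [set: mR] (fun t : R => dot (grad phi (x + t *: k)) (grad phi (x + t *: k))).
  by apply: (md (fun t => grad phi (x + t *: k))); exact: cg.
apply: le_trans (jensen01 mk) _.
rewrite -ge0_integralZl//; last first.
- by rewrite lee_fin sqr_ge0.
- by move=> t _; rewrite lee_fin dot_ge0.
- by apply/measurable_EFinP; exact: measurable_funTS.
apply: ge0_le_integral => //=.
- by move=> t _; rewrite lee_fin sqr_ge0.
- by apply/measurable_EFinP; apply: measurable_funTS; exact: measurable_funX.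
- by apply: measurable_funeM; apply/measurable_EFinP; exact: measurable_funTS.
- move=> t _; rewrite -EFinM lee_fin -real_normK ?num_real// mulrC -(sqr_enorm (grad _ _)) -exprMn.
  by rewrite lerXn2r// ?nnegrE ?mulr_ge0 ?enorm_ge0//; exact: dot_le_enorm.
Qed.

(** At parameter r, the values on the two sides issuing from [v] differ by the integral of a
    derivative along the parallel r (b - a) to the third side. Jensen's inequality in r and along
    the parallel leads to an area integral over the triangle. The parameters stay in open intervals,
    so only the open triangle has to lie in E. *)
Lemma triangle_trace (E : set (R * R)) (v a b : R * R) (phi : R * R -> R) :
  open E -> smooth phi -> cross (a - v) (b - v) != 0 ->
  (forall r u : R, 0 < r < 1 -> 0 < u < 1 -> E (v + r *: ((a - v) + u *: (b - a)))) ->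
  ((`|cross (a - v) (b - v)| *
     (\int[mu]_(t in `[0%R, 1%R]) phi (v + t *: (b - v)) -
      \int[mu]_(t in `[0%R, 1%R]) phi (v + t *: (a - v))) ^+ 2)%:E <=
   (enorm (b - a) ^+ 2)%:E * \int[leb2]_(x in E) (dot (grad phi x) (grad phi x))%:E)%E.
Proof.
move=> oE sphi; set p := a - v; set q := b - a => D0 TE.
pose F x := dot (grad phi x) (grad phi x).
have cphi := smooth_continuous sphi.
have cF : continuous F.
  by apply: continuous_dot; exact: (smooth_continuous (smooth_partial _ sphi)).
have mE : measurable (E : set mR2) by exact: open_measurable2.
pose f (x : mR2) : \bar R := ((fun x => (F x)%:E) \_ E) x.
have mf : measurable_fun [set: mR2] f.
  apply/(measurable_restrictT _ _).1 => //; apply/measurable_EFinP.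
  exact: continuous_measurable_fun2.
have f0 x : (0 <= f x)%E by rewrite /f patchE; case: ifP => // _; rewrite lee_fin dot_ge0.
have Dpq : p.1 * q.2 - p.2 * q.1 = cross (a - v) (b - v).
  by rewrite /p /q /cross/=; ring.
rewrite integral_mkcond -/f (leb2_linear v (p := p) (q := q))// ?Dpq//.
rewrite EFinM muleCA lee_pmul2l ?fin_numE// ?lte_fin ?normr_gt0//.
set g := fun x : mR2 => f _.
have mg : measurable_fun [set: mR2] g.
  apply: (measurableT_comp mf).
  have := measurable_affine_map p.1 q.1 v.1 p.2 q.2 v.2.
  by apply: eq_measurable_fun => x _ /=; congr pair; ring.
rewrite leb2_tonelli1//.
pose d r := phi (v + r *: (b - v)) - phi (v + r *: (a - v)).
have cd : continuous d.
  by move=> r; apply: continuousB; exact: continuous_line.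
have md : measurable_fun [set: mR] d by exact: continuous_measurable_fun.
have -> : \int[mu]_(t in `[0%R, 1%R]) phi (v + t *: (b - v)) -
    \int[mu]_(t in `[0%R, 1%R]) phi (v + t *: p) = \int[mu]_(t in `]0%R, 1%R[) d t.
  rewrite /Rintegral integral_oo_cc01; last exact/measurable_EFinP.
  rewrite -!/(Rintegral _ _ _) RintegralB//; apply: continuous_integrable01; exact: continuous_line.
apply: le_trans (jensen01 md) _.
have G0 r : (0 <= \int[mu]_y g (r, y))%E by apply: integral_ge0 => y _; exact: f0.
have mG := measurable_integral1 mg (fun x => f0 _).
apply: (@le_trans _ _ (\int[mu]_(r in `]0%R, 1%R[) ((enorm q ^+ 2)%:E * \int[mu]_y g (r, y)))%E); last first.
  rewrite ge0_integralZl//; last 2 first.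
  - exact: measurable_funTS.
  - by rewrite lee_fin sqr_ge0.
  apply: lee_wpmul2l; first by rewrite lee_fin sqr_ge0.
  by apply: ge0_subset_integral => // r _; exact: G0.
apply: ge0_le_integral => //=.
- by move=> t _; rewrite lee_fin sqr_ge0.
- by apply/measurable_EFinP; apply: measurable_funTS; exact: measurable_funX.
- by apply: measurable_funTS; apply: measurable_funeM.
move=> r; rewrite in_itv/= => r01; have /andP[r0 r1] := r01.
have -> : d r = phi ((v + r *: p) + r *: q) - phi (v + r *: p).
  by rewrite /d; congr (phi _ - _); apply: pair_ext; rewrite /= /GRing.scale/= /p /q/=; ring.
apply: le_trans (sqr_line_le _ _ sphi) _.
rewrite enormZ exprMn mulrC EFinM -muleA; apply: lee_pmul => //.
- by rewrite lee_fin sqr_ge0.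
- apply: mule_ge0; first by rewrite lee_fin sqr_ge0.
  by apply: integral_ge0 => t _; rewrite lee_fin dot_ge0.
(* The squared length of r (b - a) brings r^2. The substitution y = r t uses one factor r, and the
   other one is bounded by 1. *)
rewrite (ge0_integral_affine 0 (a := r)) ?gt_eqF//; last 2 first.
- exact: measurable_slice1.
- by move=> t; exact: f0.
have I0 : (0 <= \int[mu]_(t in `]0%R, 1%R[) (F (v + r *: p + t *: (r *: q)))%:E)%E.
  by apply: integral_ge0 => t _; rewrite lee_fin dot_ge0.
apply: (@le_trans _ _ (`|r|%:E * \int[mu]_(t in `]0%R, 1%R[) (F (v + r *: p + t *: (r *: q)))%:E)%E).
  apply: lee_pmul => //; rewrite lee_fin// gtr0_norm// expr2 ler_piMr//; exact: ltW.
rewrite lee_pmul2l ?fin_numE//; last by rewrite lte_fin normr_gt0 gt_eqF.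
rewrite [X in (X <= _)%E]integral_mkcond.
have cl : continuous (fun t : R => F (v + r *: p + t *: (r *: q))) by exact: continuous_line.
apply: ge0_le_integral => //=.
- by move=> t _; rewrite patchE; case: ifP => // _; rewrite lee_fin dot_ge0.
- apply/(measurable_restrictT _ _).1 => //; apply/measurable_EFinP.
  by apply: measurable_funTS; exact: continuous_measurable_fun.
- apply: (measurable_comp _ _ (measurable_slice1 r mg)) => //; exact: measurable_affine.
move=> t _; rewrite patchE; case: ifPn => [|_]; last exact: f0.
rewrite inE /= in_itv/= => t01.
rewrite /g /f patchE/=.
have e : (v.1 + r * p.1 + (r * t + 0) * q.1, v.2 + r * p.2 + (r * t + 0) * q.2) =
    v + r *: (p + t *: q).
  by apply: pair_ext; rewrite /= /GRing.scale/=; ring.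
rewrite e mem_set; last exact: TE.
by rewrite lee_fin le_eqVlt; apply/orP; left; apply/eqP; congr F; apply: pair_ext; rewrite /= /GRing.scale/=; ring.
Qed.

End Trace.

(** * Harmonic quadratic polynomials and the projection *)

Section HarmonicP2.
Variable R : realType.
Implicit Types (x c : R * R) (k : R).

Definition quadratic k0 k1 k2 k3 k4 k5 x : R :=
  k0 + k1 * x.1 + k2 * x.2 + k3 * x.1 ^+ 2 + k4 * (x.1 * x.2) + k5 * x.2 ^+ 2.

Lemma quadratic_partial k0 k1 k2 k3 k4 k5 :
  partial false (quadratic k0 k1 k2 k3 k4 k5) = quadratic k1 (2 * k3) k4 0 0 0 /\
  partial true (quadratic k0 k1 k2 k3 k4 k5) = quadratic k2 k4 (2 * k5) 0 0 0.
Proof.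
suff H x : partial false (quadratic k0 k1 k2 k3 k4 k5) x = quadratic k1 (2 * k3) k4 0 0 0 x /\
    partial true (quadratic k0 k1 k2 k3 k4 k5) x = quadratic k2 k4 (2 * k5) 0 0 0 x.
  by split; apply/funext => x; case: (H x).
have [k|_ -> ->//] := @quadratic_diff R (quadratic k0 k1 k2 k3 k4 k5) x
  (quadratic k1 (2 * k3) k4 0 0 0 x) (quadratic k2 k4 (2 * k5) 0 0 0 x) (`|k3| + `|k4| + `|k5|).
have -> : quadratic k0 k1 k2 k3 k4 k5 (x + k) - quadratic k0 k1 k2 k3 k4 k5 x -
  (k.1 * quadratic k1 (2 * k3) k4 0 0 0 x + k.2 * quadratic k2 k4 (2 * k5) 0 0 0 x) =
  k3 * k.1 ^+ 2 + k4 * (k.1 * k.2) + k5 * k.2 ^+ 2 by rewrite /quadratic/=; ring.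
have n1 : `|k.1| <= `|k| by rewrite /Num.norm/= le_max lexx.
have n2 : `|k.2| <= `|k| by rewrite /Num.norm/= le_max lexx orbT.
rewrite (le_trans (ler_normD _ _))// mulrDl lerD//; last first.
  by rewrite normrM normrX ler_wpM2l// lerXn2r ?nnegrE.
rewrite (le_trans (ler_normD _ _))// mulrDl lerD//.
  by rewrite normrM normrX ler_wpM2l// lerXn2r ?nnegrE.
by rewrite !normrM ler_wpM2l// expr2 ler_pM.
Qed.

Lemma smooth_quadratic k0 k1 k2 k3 k4 k5 : smooth (quadratic k0 k1 k2 k3 k4 k5).
Proof.
have s1 := @smooth_fst R; have s2 := @smooth_snd R.
by rewrite /quadratic; do !(apply: smoothD || apply: smoothM || exact: smooth_cst || exact: s1
  || exact: s2).
Qed.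

Lemma laplacian_quadratic k0 k1 k2 k3 k4 k5 x :
  laplacian (quadratic k0 k1 k2 k3 k4 k5) x = 2 * (k3 + k5).
Proof.
rewrite /laplacian; have [-> ->] := quadratic_partial k0 k1 k2 k3 k4 k5.
have [-> _] := quadratic_partial k1 (2 * k3) k4 0 0 0.
have [_ ->] := quadratic_partial k2 k4 (2 * k5) 0 0 0.
by rewrite /quadratic; ring.
Qed.

Lemma P2_quadratic k0 k1 k2 k3 k4 k5 : P2 (quadratic k0 k1 k2 k3 k4 k5).
Proof.
exists (fun i j => nth 0 (nth [::] [:: [:: k0; k2; k5]; [:: k1; k4]; [:: k3]] i) j) => x.
under eq_bigr do rewrite big_mkcond.
by rewrite /quadratic !big_ord_recr !big_ord0/=; ring.
Qed.

Lemma P2_is_quadratic (p : R * R -> R) : P2 p ->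
  exists k0 k1 k2 k3 k4 k5, p = quadratic k0 k1 k2 k3 k4 k5.
Proof.
move=> [a pa]; pose A i j := a (inord i) (inord j).
exists (A 0 0)%N, (A 1 0)%N, (A 0 1)%N, (A 2 0)%N, (A 1 1)%N, (A 0 2)%N; apply/funext => x.
rewrite pa (_ : \sum_(i < 3) _ = \sum_(i < 3) \sum_(j < 3 | (i + j <= 2)%N)
    A i j * x.1 ^+ i * x.2 ^+ j); last first.
  by apply: eq_bigr => i _; apply: eq_bigr => j _; rewrite /A !inord_val.
under eq_bigr do rewrite big_mkcond.
by rewrite /quadratic !big_ord_recr !big_ord0/=; ring.
Qed.

(** Harmonic quadratics up to constants, centred at [c]: [d] and [e] are the coefficients of the
    real and imaginary parts of the complex square of x - c. *)
Definition hpoly c (a b d e : R) x : R :=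
  a * (x.1 - c.1) + b * (x.2 - c.2) + d * ((x.1 - c.1) ^+ 2 - (x.2 - c.2) ^+ 2) +
  2 * e * ((x.1 - c.1) * (x.2 - c.2)).

Definition hfield c (a b d e : R) x : R * R :=
  (a + 2 * d * (x.1 - c.1) + 2 * e * (x.2 - c.2),
   b + 2 * e * (x.1 - c.1) - 2 * d * (x.2 - c.2)).

Lemma hpolyE c a b d e : exists k0, hpoly c a b d e =
  quadratic k0 (a - 2 * d * c.1 - 2 * e * c.2) (b + 2 * d * c.2 - 2 * e * c.1) d (2 * e) (- d).
Proof.
exists (- a * c.1 - b * c.2 + d * (c.1 ^+ 2 - c.2 ^+ 2) + 2 * e * c.1 * c.2).
by apply/funext => x; rewrite /hpoly /quadratic; ring.
Qed.

Lemma smooth_hpoly c a b d e : smooth (hpoly c a b d e).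
Proof. by have [k0 ->] := hpolyE c a b d e; exact: smooth_quadratic. Qed.

Lemma grad_hpoly c a b d e : grad (hpoly c a b d e) = hfield c a b d e.
Proof.
have [k0 ->] := hpolyE c a b d e; apply/funext => x; rewrite /grad.
have [-> ->] := quadratic_partial k0 (a - 2 * d * c.1 - 2 * e * c.2)
  (b + 2 * d * c.2 - 2 * e * c.1) d (2 * e) (- d).
by apply: pair_ext; rewrite /quadratic /hfield/=; ring.
Qed.

Lemma harmonic_hpoly c a b d e : harmonic_P2 (hpoly c a b d e).
Proof.
have [k0 ->] := hpolyE c a b d e; split; first exact: P2_quadratic.
by move=> x; rewrite laplacian_quadratic subrr mulr0.
Qed.

Lemma harmonic_P2_grad c (p : R * R -> R) : harmonic_P2 p ->
  exists a b d e, grad p = hfield c a b d e.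
Proof.
move=> [/P2_is_quadratic[k0 [k1 [k2 [k3 [k4 [k5 ->]]]]]] lap].
have k5E : k5 = - k3.
  by have /eqP := lap 0; rewrite laplacian_quadratic mulf_eq0 pnatr_eq0/= addrC addr_eq0 => /eqP.
exists (k1 + 2 * k3 * c.1 + k4 * c.2), (k2 + k4 * c.1 - 2 * k3 * c.2), k3, (k4 / 2).
apply/funext => x; rewrite /grad; have [-> ->] := quadratic_partial k0 k1 k2 k3 k4 k5.
by rewrite k5E; apply: pair_ext; rewrite /quadratic /hfield/=; field.
Qed.

End HarmonicP2.

(** * Existence and contraction property of the projection *)

Section Gram.
Variables (R : realType) (E : set (R * R)).
Hypothesis mE : measurable (E : set (measurableTypeR R * measurableTypeR R)).

Lemma ip_sum (I : Type) (r : seq I) (x : I -> R) (G : I -> R * R -> R * R) t :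
  (forall i, L2vec E (G i)) -> L2vec E t ->
  L2vec E (fun y => \sum_(i <- r) x i *: G i y) /\
  ip E (fun y => \sum_(i <- r) x i *: G i y) t = \sum_(i <- r) x i * ip E (G i) t.
Proof.
move=> lG lt; elim: r => [|i r [lr ipr]].
  have z : (fun y : R * R => \sum_(i <- [::]) x i *: G i y) = 0 \*: t.
    by apply/funext => y; rewrite big_nil/= scale0r.
  by rewrite z; split; [exact: L2vecZ|rewrite ipZl// mul0r big_nil].
have z : (fun y => \sum_(j <- i :: r) x j *: G j y) =
    (x i \*: G i) \+ (fun y => \sum_(j <- r) x j *: G j y).
  by apply/funext => y; rewrite big_cons.
by rewrite z; split; [apply: L2vecD => //; exact: L2vecZ|
  rewrite ipDl//; [rewrite ipZl// ipr big_cons|exact: L2vecZ]].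
Qed.

Lemma ip_null s t : L2vec E s -> L2vec E t -> ip E s s = 0 -> ip E s t = 0.
Proof.
move=> ls lt s0; have := ip_cauchy_schwarz mE ls lt.
by rewrite s0 mul0r => st; apply/eqP; rewrite -sqrf_eq0 eq_le st sqr_ge0.
Qed.

Lemma gram_projection n (G : 'I_n -> R * R -> R * R) tau :
  (forall i, L2vec E (G i)) -> L2vec E tau ->
  exists x : 'I_n -> R, forall j,
    ip E (fun y => \sum_i x i *: G i y) (G j) = ip E tau (G j).
Proof.
move=> lG ltau.
pose A : 'M[R]_n := \matrix_(i, j) ip E (G i) (G j).
pose b : 'rV[R]_n := \row_j ip E tau (G j).
(* The Gram system is solvable: by Cauchy-Schwarz, a combination of the [G i] of
   norm zero is orthogonal to [tau]. *)
have /submxP[x xA] : (b <= A)%MS.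
  (* The Gram matrix may be singular. Column [k] of its cokernel gives the coefficients [v] of a
     combination [s] orthogonal to every [G j], hence to itself. *)
  rewrite submxE; apply/eqP/rowP => k; rewrite !mxE.
  pose v i := cokermx A i k; pose s y := \sum_i v i *: G i y.
  have [ls _] := ip_sum (index_enum 'I_n) v lG ltau.
  have sG j : ip E s (G j) = 0.
    rewrite (ip_sum (index_enum 'I_n) v lG (lG j)).2.
    have := congr1 (fun X : 'M[R]_n => X j k) (mulmx_coker A); rewrite mxE [RHS]mxE => Aj.
    by rewrite -[RHS]Aj; apply: eq_bigr => i _; rewrite mxE ipC mulrC.
  have ss : ip E s s = 0.
    rewrite (ip_sum (index_enum 'I_n) v lG ls).2 big1// => i _.
    by rewrite ipC sG mulr0.
  have := ip_null ls ltau ss; rewrite (ip_sum (index_enum 'I_n) v lG ltau).2 => tau0.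
  by rewrite -[RHS]tau0; apply: eq_bigr => i _; rewrite [b _ _]mxE ipC mulrC.
exists (x 0) => j.
rewrite (ip_sum (index_enum 'I_n) (x 0) lG (lG j)).2.
have := congr1 (fun X : 'rV[R]_n => X 0 j) xA; rewrite !mxE => ->.
by apply: eq_bigr => i _; rewrite mxE.
Qed.

End Gram.

Section Projection.
Variables (R : realType) (Q : quad R) (M : R).
Notation E := (region Q).
Hypotheses (oE : open E) (Efin : (leb2 E < +oo)%E) (EM : forall x, E x -> `|x| <= M).
Let mE := open_measurable2 oE.

Lemma L2_continuous_bounded (f : R * R -> R) (C : R) : continuous f ->
  (forall x, E x -> `|f x| <= C) -> L2 E f.
Proof.
move=> cf fC; apply: (L2_bounded mE Efin _ fC); exact: continuous_measurable_fun2.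
Qed.

Lemma L2vec_hfield c a b d e : L2vec E (hfield c a b d e).
Proof.
have bnd (u v w : R) : L2 E (fun x => u + v * (x.1 - c.1) + w * (x.2 - c.2)).
  have sm : smooth (fun x : R * R => u + v * (x.1 - c.1) + w * (x.2 - c.2)).
    have s1 := @smooth_fst R; have s2 := @smooth_snd R.
    by do !(apply: smoothD || apply: smoothM || exact: smooth_cst || exact: s1 || exact: s2).
  apply: (@L2_continuous_bounded _ (`|u| + `|v| * (M + `|c.1|) + `|w| * (M + `|c.2|))).
    exact: smooth_continuous.
  move=> x /EM xM.
  have n1 : `|x.1| <= M by apply: le_trans xM; rewrite /Num.norm/= le_max lexx.
  have n2 : `|x.2| <= M by apply: le_trans xM; rewrite /Num.norm/= le_max lexx orbT.
  rewrite (le_trans (ler_normD _ _))// lerD//; last first.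
    by rewrite normrM ler_wpM2l// (le_trans (ler_normB _ _))// lerD2r.
  rewrite (le_trans (ler_normD _ _))// lerD//.
  by rewrite normrM ler_wpM2l// (le_trans (ler_normB _ _))// lerD2r.
split; first exact: bnd.
by have := bnd b (2 * e) (- (2 * d)); congr (L2 _ _); apply/funext => x/=; rewrite mulNr.
Qed.

Lemma exists_projection (c : R * R) tau : L2vec E tau -> exists rho, is_projection Q tau rho.
Proof.
move=> ltau.
pose G (i : 'I_4) := hfield c (i == inord 0)%:R (i == inord 1)%:R (i == inord 2)%:R
  (i == inord 3)%:R.
have lG i : L2vec E (G i) by exact: L2vec_hfield.
have [x xG] := gram_projection mE lG ltau.
have combE (y : 'I_4 -> R) : (fun z => \sum_i y i *: G i z) =
    hfield c (y (inord 0)) (y (inord 1)) (y (inord 2)) (y (inord 3)).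
  apply/funext => z; rewrite sum_ord4 /G.
  rewrite !eqxx -!(inj_eq val_inj)/= !inordK//=.
  by apply: pair_ext; rewrite /hfield/= /GRing.scale/=; ring.
exists (fun z => \sum_i x i *: G i z); split.
  exists (hpoly c (x (inord 0)) (x (inord 1)) (x (inord 2)) (x (inord 3))).
  by split; [exact: harmonic_hpoly|rewrite grad_hpoly combE].
move=> p /(harmonic_P2_grad c)[a [b [d [e ->]]]].
pose y (i : 'I_4) := nth 0 [:: a; b; d; e] i.
have -> : hfield c a b d e = (fun z => \sum_i y i *: G i z).
  by rewrite combE /y !inordK.
rewrite -/(ip E _ _) -/(ip E _ _) ipC [RHS]ipC.
have lx := (ip_sum mE (index_enum 'I_4) x lG ltau).1.
rewrite (ip_sum mE (index_enum 'I_4) y lG lx).2 (ip_sum mE (index_enum 'I_4) y lG ltau).2.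
by apply: eq_bigr => i _; rewrite ipC xG ipC.
Qed.

Lemma Pi_hatP tau : L2vec E tau -> is_projection Q tau (Pi_hat Q tau).
Proof. by move=> /(exists_projection 0)[rho ?]; rewrite /Pi_hat; apply: xgetPex; exists rho. Qed.

Lemma Pi_hat_L2 tau : L2vec E tau -> L2vec E (Pi_hat Q tau).
Proof.
by move=> /Pi_hatP[[p [/(harmonic_P2_grad 0)[a [b [d [e gE]]]] ->]] _]; rewrite gE; exact: L2vec_hfield.
Qed.

(** Testing the projection with itself gives |Pi tau|^2 = (tau, Pi tau); Cauchy-Schwarz and a
    division conclude when |Pi tau| is positive. *)
Lemma Pi_hat_le tau : L2vec E tau -> L2norm E (Pi_hat Q tau) <= L2norm E tau.
Proof.
move=> lt; have [[p [hp pE]] pr] := Pi_hatP lt.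
have := pr p hp; rewrite -pE -!/(ip E _ _) => ppE.
have := ip_le_norm mE lt (Pi_hat_L2 lt); rewrite -ppE -sqr_L2norm.
have := sqrtr_ge0 (ip E (Pi_hat Q tau) (Pi_hat Q tau)); rewrite -L2normE.
rewrite le_eqVlt => /predU1P[<- _|P0]; first exact: sqrtr_ge0.
by rewrite ger0_norm ?sqr_ge0// expr2 ler_pM2r.
Qed.

Lemma a_h_continuous sigma tau : L2vec E sigma -> L2vec E tau ->
  a_h Q sigma tau <= L2norm E sigma * L2norm E tau.
Proof.
move=> ls lt; apply: le_trans (ler_norm _) _.
apply: le_trans (ip_le_norm mE (Pi_hat_L2 ls) (Pi_hat_L2 lt)) _.
by apply: ler_pM; rewrite ?sqrtr_ge0//; exact: Pi_hat_le.
Qed.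

Lemma a_h_diag tau : a_h Q tau tau = L2norm E (Pi_hat Q tau) ^+ 2.
Proof. by rewrite sqr_L2norm. Qed.

Lemma Pi_hat_hfield c a b d e tau : L2vec E tau ->
  ip E tau (hfield c a b d e) = ip E (Pi_hat Q tau) (hfield c a b d e).
Proof.
move=> lt; have [_ pr] := Pi_hatP lt.
by have := pr _ (harmonic_hpoly c a b d e); rewrite grad_hpoly.
Qed.

End Projection.

(** * Edge means and fluxes *)

Section EdgeMeans.
Variable R : realType.
Notation mu := (@lebesgue_measure R).
Implicit Types (phi : R * R -> R) (a b c : R * R).

Definition seg_mean a b phi : R := \int[mu]_(t in `[0%R, 1%R]) phi (a + t *: (b - a)).

Lemma seg_mean_rev a b phi : continuous phi -> seg_mean a b phi = seg_mean b a phi.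
Proof.
move=> cphi; rewrite /seg_mean.
have := @Rintegration_by_substitution_onem R (fun t => phi (b + t *: (a - b))) 1.
rewrite ler01 lexx => /(_ isT) ->; last exact/continuous_subspaceT/continuous_line.
rewrite /unstable.onem subrr; apply: eq_Rintegral => t _; congr phi.
by apply: pair_ext; rewrite /= /GRing.scale/=; ring.
Qed.

Lemma integral01_quadratic (A B C : R) :
  \int[mu]_(t in `[0%R, 1%R]) (A + B * t + C * t ^+ 2) = A + B / 2 + C / 3.
Proof.
have dF (t : R^o) : is_derive t (1 : R^o) (fun t : R^o => A * t + B / 2 * t ^+ 2 + C / 3 * t ^+ 3 : R^o)
    (A + B * t + C * t ^+ 2).
  by apply: is_derive_eq; rewrite /GRing.scale/=; field.
have cF : continuous (fun t : R^o => A * t + B / 2 * t ^+ 2 + C / 3 * t ^+ 3 : R^o).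
  move=> t; have [df _] := dF t; apply: differentiable_continuous; exact/derivable1_diffP.
have cf : continuous (fun t : R^o => A + B * t + C * t ^+ 2 : R^o).
  have df (t : R^o) : is_derive t (1 : R^o) (fun t : R^o => A + B * t + C * t ^+ 2 : R^o) (B + 2 * C * t).
    by apply: is_derive_eq; rewrite /GRing.scale/=; field.
  move=> t; have [dt _] := df t; apply: differentiable_continuous; exact/derivable1_diffP.
rewrite /Rintegral (@continuous_FTC2 _ _ (fun t : R^o => A * t + B / 2 * t ^+ 2 + C / 3 * t ^+ 3))
  ?ltr01//=; first by field.
- exact: continuous_subspaceT.
- split=> [t _| |].
  + by have [] := dF t.
  + by apply: cvg_at_right_filter; exact: cF.
  + by apply: cvg_at_left_filter; exact: cF.
- by move=> t _; rewrite derive1E; have [_ ->] := dF t.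
Qed.

(** In complex notation the mean of z^2 on the segment from x to y is (x^2 + x y + y^2) / 3; [d] and
    [e] multiply its real and imaginary parts. *)
Lemma seg_mean_hpoly c u v (a b d e : R) : let x := u - c in let y := v - c in
  seg_mean u v (hpoly c a b d e) = a * ((x.1 + y.1) / 2) + b * ((x.2 + y.2) / 2) +
    d * ((x.1 ^+ 2 + x.1 * y.1 + y.1 ^+ 2 - (x.2 ^+ 2 + x.2 * y.2 + y.2 ^+ 2)) / 3) +
    e * ((2 * x.1 * x.2 + x.1 * y.2 + x.2 * y.1 + 2 * y.1 * y.2) / 3).
Proof.
move=> x y.
transitivity (\int[mu]_(t in `[0%R, 1%R]) (hpoly c a b d e u +
  (a * (y.1 - x.1) + b * (y.2 - x.2) + 2 * d * (x.1 * (y.1 - x.1) - x.2 * (y.2 - x.2)) +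
   2 * e * (x.1 * (y.2 - x.2) + x.2 * (y.1 - x.1))) * t +
  (d * ((y.1 - x.1) ^+ 2 - (y.2 - x.2) ^+ 2) + 2 * e * ((y.1 - x.1) * (y.2 - x.2))) * t ^+ 2)).
  by apply: eq_Rintegral => t _; rewrite /hpoly /x /y/= /GRing.scale/=; ring.
by rewrite integral01_quadratic /hpoly /x /y/=; field.
Qed.

Lemma seg_mean_cst u v (a : R) : seg_mean u v (cst a) = a.
Proof.
transitivity (\int[mu]_(t in `[0%R, 1%R]) (a + 0 * t + 0 * t ^+ 2)).
  by apply: eq_Rintegral => t _; rewrite /=; ring.
by rewrite integral01_quadratic; ring.
Qed.

Lemma edge_integral_cst (Q : quad R) i (k : R) phi : continuous phi ->
  edge_integral Q i (fun x => cst k x * phi x) =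
  k * edge_length Q i * seg_mean (vertex Q i) (vertex Q (ordS i)) phi.
Proof.
move=> cphi; rewrite /edge_integral /seg_mean /= RintegralZl//; first by ring.
exact/continuous_integrable01/continuous_line.
Qed.

End EdgeMeans.

(** * Recovering four fluxes from four moments *)

Section DiscreteAlgebra.
Variable R : realType.

(** Cramer's rule with determinant [D] gives al - be and al + be from the linear moments, hence
    |al|, |be| <= K = 4 N / g^2. Three times the quadratic moments is t (Pr + i Pi) plus terms in al
    and be, hence |t| <= L / (2 g^2). The four weights are bounded by 4 |t| + 2 |al| + 2 |be|; the
    final constant is 4 (L / (2 g^2)) + 4 K with L = 12 N + 24 K. *)
Lemma quad_weights_bound (g h N : R) (x0 y0 x1 y1 x2 y2 x3 y3 w0 w1 w2 w3 : R) :
  0 < g -> 0 < h -> 0 <= N ->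
  `|x0| <= h -> `|y0| <= h -> `|x1| <= h -> `|y1| <= h ->
  `|x2| <= h -> `|y2| <= h -> `|x3| <= h -> `|y3| <= h ->
  4 * g ^+ 2 * h ^+ 2 <= `|(x2 - x0) * (y3 - y1) - (y2 - y0) * (x3 - x1)| ->
  w0 + w1 + w2 + w3 = 0 ->
  `|w0 * ((x0 + x1) / 2) + w1 * ((x1 + x2) / 2) + w2 * ((x2 + x3) / 2) + w3 * ((x3 + x0) / 2)|
    <= 2 * h * N ->
  `|w0 * ((y0 + y1) / 2) + w1 * ((y1 + y2) / 2) + w2 * ((y2 + y3) / 2) + w3 * ((y3 + y0) / 2)|
    <= 2 * h * N ->
  `|w0 * ((x0 ^+ 2 + x0 * x1 + x1 ^+ 2 - (y0 ^+ 2 + y0 * y1 + y1 ^+ 2)) / 3) +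
    w1 * ((x1 ^+ 2 + x1 * x2 + x2 ^+ 2 - (y1 ^+ 2 + y1 * y2 + y2 ^+ 2)) / 3) +
    w2 * ((x2 ^+ 2 + x2 * x3 + x3 ^+ 2 - (y2 ^+ 2 + y2 * y3 + y3 ^+ 2)) / 3) +
    w3 * ((x3 ^+ 2 + x3 * x0 + x0 ^+ 2 - (y3 ^+ 2 + y3 * y0 + y0 ^+ 2)) / 3)| <= 4 * h ^+ 2 * N ->
  `|w0 * ((2 * x0 * y0 + x0 * y1 + y0 * x1 + 2 * x1 * y1) / 3) +
    w1 * ((2 * x1 * y1 + x1 * y2 + y1 * x2 + 2 * x2 * y2) / 3) +
    w2 * ((2 * x2 * y2 + x2 * y3 + y2 * x3 + 2 * x3 * y3) / 3) +
    w3 * ((2 * x3 * y3 + x3 * y0 + y3 * x0 + 2 * x0 * y0) / 3)| <= 4 * h ^+ 2 * N ->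
  `|w0| + `|w1| + `|w2| + `|w3| <= (40 / g ^+ 2 + 192 / g ^+ 4) * N.
Proof.
move=> g0 h0 N0 bx0 by0 bx1 by1 bx2 by2 bx3 by3.
pose t := (w0 + w2) / 2; pose al := (w0 - w2) / 2; pose be := (w1 - w3) / 2.
set D := (x2 - x0) * _ - _ => hD W hx hy hr hi.
have h2 : 0 < h ^+ 2 by rewrite exprn_gt0.
have g2 : 0 < g ^+ 2 by rewrite exprn_gt0.
have gh : 0 < 4 * g ^+ 2 * h ^+ 2 by rewrite !mulr_gt0.
have D0 : 0 < `|D| by exact: lt_le_trans hD.
have prod (a b A B : R) : `|a| <= A -> `|b| <= B -> `|a * b| <= A * B.
  by move=> aA bB; rewrite normrM ler_pM.
have add (a b A B : R) : `|a| <= A -> `|b| <= B -> `|a + b| <= A + B.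
  by move=> aA bB; rewrite (le_trans (ler_normD _ _))// lerD.
have sub (a b A B : R) : `|a| <= A -> `|b| <= B -> `|a - b| <= A + B.
  by move=> aA bB; rewrite (le_trans (ler_normB _ _))// lerD.
have w0E : w0 = t + al by rewrite /t /al; field.
have w2E : w2 = t - al by rewrite /t /al; field.
have w1E : w1 = - t + be by rewrite /t /be (_ : w3 = - (w0 + w1 + w2)); [field|lra].
have w3E : w3 = - t - be by rewrite /t /be (_ : w3 = - (w0 + w1 + w2)); [field|lra].
move: t al be w0E w1E w2E w3E => t al be w0E w1E w2E w3E; subst w0 w1 w2 w3.
set Sx := (X in `|X| <= _) in hx; set Sy := (X in `|X| <= _) in hy.
pose K := 4 * N / g ^+ 2.
have divD (q : R) : `|q| * `|D| <= 8 * h ^+ 2 * N * 2 -> `|q| <= K.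
  move=> qD; rewrite /K ler_pdivlMr//.
  have : `|q| * (4 * g ^+ 2 * h ^+ 2) <= 8 * h ^+ 2 * N * 2.
    by apply: le_trans qD; rewrite ler_wpM2l.
  have -> : `|q| * (4 * g ^+ 2 * h ^+ 2) = (`|q| * g ^+ 2) * (4 * h ^+ 2) by ring.
  have -> : 8 * h ^+ 2 * N * 2 = (4 * N) * (4 * h ^+ 2) by ring.
  by rewrite ler_pM2r// mulr_gt0.
have ab1 : `|al - be| <= K.
  apply: divD; rewrite -normrM.
  have -> : (al - be) * D = (Sx * (y1 - y3) - Sy * (x1 - x3)) * 2.
    by rewrite /D /Sx /Sy; field.
  rewrite normrM [`|2|]ger0_norm// ler_wpM2r//.
  have -> : 8 * h ^+ 2 * N = (2 * h * N) * (h + h) + (2 * h * N) * (h + h) by ring.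
  by apply: (sub); apply: (prod) => //; exact: (sub).
have ab2 : `|al + be| <= K.
  apply: divD; rewrite -normrM.
  have -> : (al + be) * D = (Sy * (x0 - x2) - Sx * (y0 - y2)) * 2.
    by rewrite /D /Sx /Sy; field.
  rewrite normrM [`|2|]ger0_norm// ler_wpM2r//.
  have -> : 8 * h ^+ 2 * N = (2 * h * N) * (h + h) + (2 * h * N) * (h + h) by ring.
  by apply: (sub); apply: (prod) => //; exact: (sub).
have hal : `|al| <= K.
  have -> : al = ((al - be) + (al + be)) / 2 by field.
  rewrite normrM [`|2^-1|]ger0_norm ?invr_ge0// ler_pdivrMr//.
  by have := add _ _ _ _ ab1 ab2; lra.
have hbe : `|be| <= K.
  have -> : be = ((al + be) - (al - be)) / 2 by field.
  rewrite normrM [`|2^-1|]ger0_norm ?invr_ge0// ler_pdivrMr//.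
  by have := sub _ _ _ _ ab2 ab1; lra.
set Sr := (X in `|X| <= _) in hr; set Si := (X in `|X| <= _) in hi.
pose Pr := (x0 - x2) * (x1 - x3) - (y0 - y2) * (y1 - y3).
pose Pi := (x0 - x2) * (y1 - y3) + (y0 - y2) * (x1 - x3).
(* 12 = 3 * 4 comes from the moments; 24 = 2 * (6 + 6) from the terms in al and be, differences of
   two quantities of size 6 h^2. *)
pose L := 12 * N + 24 * K.
have qr (a b a' b' : R) : `|a| <= h -> `|b| <= h -> `|a'| <= h -> `|b'| <= h ->
    `|a ^+ 2 + a * b + b ^+ 2 - (a' ^+ 2 + a' * b' + b' ^+ 2)| <= 6 * h ^+ 2.
  move=> ha hb ha' hb'.
  have -> : 6 * h ^+ 2 = (h * h + h * h + h * h) + (h * h + h * h + h * h) by ring.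
  by apply: (sub); rewrite !expr2; (apply: (add); first apply: (add)); exact: (prod).
have qi (a b a' b' : R) : `|a| <= h -> `|b| <= h -> `|a'| <= h -> `|b'| <= h ->
    `|2 * a * a' + a * b' + a' * b + 2 * b * b'| <= 6 * h ^+ 2.
  move=> ha hb ha' hb'.
  have -> : 6 * h ^+ 2 = 2 * h * h + h * h + h * h + 2 * h * h by ring.
  have two (u : R) : `|u| <= h -> `|2 * u| <= 2 * h by move=> uh; apply: (prod); rewrite // ger0_norm.
  by do ?[apply: (add)]; apply: (prod) => //; exact: (two).
have tr : `|t * Pr| <= L * h ^+ 2.
  have -> : t * Pr = 3 * Sr -
     (al * ((x0 ^+ 2 + x0 * x1 + x1 ^+ 2 - (y0 ^+ 2 + y0 * y1 + y1 ^+ 2)) -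
            (x2 ^+ 2 + x2 * x3 + x3 ^+ 2 - (y2 ^+ 2 + y2 * y3 + y3 ^+ 2))) +
      be * ((x1 ^+ 2 + x1 * x2 + x2 ^+ 2 - (y1 ^+ 2 + y1 * y2 + y2 ^+ 2)) -
            (x3 ^+ 2 + x3 * x0 + x0 ^+ 2 - (y3 ^+ 2 + y3 * y0 + y0 ^+ 2)))).
    by rewrite /Pr /Sr; field.
  have -> : L * h ^+ 2 = 3 * (4 * h ^+ 2 * N) +
      (K * (6 * h ^+ 2 + 6 * h ^+ 2) + K * (6 * h ^+ 2 + 6 * h ^+ 2)) by rewrite /L; ring.
  apply: (sub); first by apply: (prod); rewrite // ger0_norm.
  by apply: (add); apply: (prod) => //; apply: (sub); exact: qr.
have ti : `|t * Pi| <= L * h ^+ 2.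
  have -> : t * Pi = 3 * Si -
     (al * ((2 * x0 * y0 + x0 * y1 + y0 * x1 + 2 * x1 * y1) -
            (2 * x2 * y2 + x2 * y3 + y2 * x3 + 2 * x3 * y3)) +
      be * ((2 * x1 * y1 + x1 * y2 + y1 * x2 + 2 * x2 * y2) -
            (2 * x3 * y3 + x3 * y0 + y3 * x0 + 2 * x0 * y0))).
    by rewrite /Pi /Si; field.
  have -> : L * h ^+ 2 = 3 * (4 * h ^+ 2 * N) +
      (K * (6 * h ^+ 2 + 6 * h ^+ 2) + K * (6 * h ^+ 2 + 6 * h ^+ 2)) by rewrite /L; ring.
  apply: (sub); first by apply: (prod); rewrite // ger0_norm.
  by apply: (add); apply: (prod) => //; apply: (sub); exact: qi.
have K0 : 0 <= K by exact: le_trans (normr_ge0 _) hal.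
have L0 : 0 <= L by rewrite /L addr_ge0// mulr_ge0.
have LH : 0 <= L * h ^+ 2 by rewrite mulr_ge0// ltW.
(* [Pr + i Pi] is the complex product of the two diagonals. *)
have PD : D ^+ 2 <= Pr ^+ 2 + Pi ^+ 2.
  rewrite -subr_ge0.
  have -> : Pr ^+ 2 + Pi ^+ 2 - D ^+ 2 = ((x0 - x2) * (x1 - x3) + (y0 - y2) * (y1 - y3)) ^+ 2.
    by rewrite /Pr /Pi /D; ring.
  exact: sqr_ge0.
have tD : `|t| * `|D| <= 2 * L * h ^+ 2.
  have LH2 : 0 <= 2 * L * h ^+ 2 by rewrite -mulrA mulr_ge0.
  rewrite -ler_sqr ?nnegrE ?LH2 ?mulr_ge0//.
  rewrite -normrM real_normK ?num_real// exprMn.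
  apply: (@le_trans _ _ ((t * Pr) ^+ 2 + (t * Pi) ^+ 2)).
    by rewrite !exprMn -mulrDr ler_wpM2l ?sqr_ge0.
  apply: (@le_trans _ _ ((L * h ^+ 2) ^+ 2 + (L * h ^+ 2) ^+ 2)).
    by rewrite -(real_normK (num_real (t * Pr))) -(real_normK (num_real (t * Pi))) lerD// lerXn2r ?nnegrE.
  rewrite -subr_ge0; have -> : (2 * L * h ^+ 2) ^+ 2 - ((L * h ^+ 2) ^+ 2 + (L * h ^+ 2) ^+ 2) =
    2 * (L * h ^+ 2) ^+ 2 by ring.
  by rewrite mulr_ge0// sqr_ge0.
have ht : `|t| <= L / (2 * g ^+ 2).
  rewrite ler_pdivlMr ?mulr_gt0//.
  have : `|t| * (4 * g ^+ 2 * h ^+ 2) <= 2 * L * h ^+ 2.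
    by apply: le_trans tD; rewrite ler_wpM2l.
  have -> : `|t| * (4 * g ^+ 2 * h ^+ 2) = (`|t| * (2 * g ^+ 2)) * (2 * h ^+ 2) by ring.
  have -> : 2 * L * h ^+ 2 = L * (2 * h ^+ 2) by ring.
  by rewrite ler_pM2r// mulr_gt0.
have -> : (40 / g ^+ 2 + 192 / g ^+ 4) * N = 4 * (L / (2 * g ^+ 2)) + 4 * K.
  by rewrite /L /K; field; rewrite gt_eqF.
have := ler_normD t al; have := ler_normD (- t) be; have := ler_normB t al; have := ler_normB (- t) be.
rewrite normrN; lra.
Qed.

End DiscreteAlgebra.

(** * Edge means compared through the centre of the ball *)

Section Spokes.
Variables (R : realType) (gamma : R) (Q : quad R) (c : R * R) (r h : R).
Hypotheses (gamma_gt0 : 0 < gamma) (gQ : good_quad gamma Q c r h).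
Notation E := (region Q).
Variables (phi : R * R -> R) (G : R).
Hypotheses (sphi : smooth phi) (G_ge0 : 0 <= G).
Hypothesis phiG : (\int[@leb2 R]_(x in E) (dot (grad phi x) (grad phi x))%:E <= (G ^+ 2)%:E)%E.

(** Trace inequality on the triangle [v], [a], [c]. Its side from [a] to [c] has length at most h
    and its cross product is at least gamma^2 h^2, so the powers of h cancel. *)
Lemma spoke_mean v a : gamma ^+ 2 * h ^+ 2 <= `|cross (a - v) (c - v)| ->
  enorm (a - c) <= h -> (forall s : R, 0 <= s <= 1 -> closure E (v + s *: (a - v))) ->
  gamma * `|seg_mean v c phi - seg_mean v a phi| <= G.
Proof.
move=> hD ah cl; set X := seg_mean v c phi - _.
have h0 := gq_h gQ.
have gh : 0 < gamma ^+ 2 * h ^+ 2 by rewrite mulr_gt0// exprn_gt0.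
have D0 : 0 < `|cross (a - v) (c - v)| by exact: lt_le_trans hD.
have TE u w : 0 < u < 1 -> 0 < w < 1 -> E (v + u *: ((a - v) + w *: (c - a))).
  move=> /andP[u0 u1] /andP[w0 w1].
  have uw1 : u * w < 1.
    by rewrite (lt_trans _ u1)// -[ltRHS]mulr1 ltr_pM2l.
  have uw0 : 0 < 1 - u * w by rewrite subr_gt0.
  have uwn : 1 - u * w != 0 by rewrite gt_eqF.
  (* Parameter of the point where the ray from [c] through the given point meets the side from [v]
     to [a]; the given point is strictly closer to [c]. *)
  pose s := u * (1 - w) / (1 - u * w).
  have s01 : 0 <= s <= 1.
    rewrite /s divr_ge0 ?mulr_ge0 ?ltW ?subr_gt0//= ltr_pdivrMr// mul1r.
    by rewrite mulrBr mulr1 ltrD2r.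
  have -> : v + u *: ((a - v) + w *: (c - a)) =
      c + (1 - u * w) *: ((v + s *: (a - v)) - c).
    by apply: pair_ext; rewrite /= /GRing.scale/= /s; field.
  apply: (star_closure (gq_star gQ) (eball_center c (gq_r0 gQ)) (cl _ s01)).
  by rewrite ltW//= gtrBl mulr_gt0.
have := @triangle_trace R E v a c phi (gq_open gQ) sphi.
rewrite -normr_gt0 => /(_ D0 TE); rewrite -!/(seg_mean _ _ _) -/X => XG.
have XhG : `|cross (a - v) (c - v)| * X ^+ 2 <= h ^+ 2 * G ^+ 2.
  rewrite -lee_fin; apply: (le_trans XG); rewrite (EFinM (h ^+ 2)); apply: lee_pmul => //.
  - by rewrite lee_fin sqr_ge0.
  - by apply: integral_ge0 => x _; rewrite lee_fin dot_ge0.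
  - by rewrite lee_fin lerXn2r ?nnegrE ?enorm_ge0 ?(ltW h0)// -enormN opprB.
rewrite -ler_sqr ?nnegrE ?mulr_ge0 ?(ltW gamma_gt0)//.
rewrite exprMn real_normK ?num_real// -(ler_pM2l (x := h ^+ 2)) ?exprn_gt0//.
apply: le_trans XhG; rewrite mulrA ler_wpM2r ?sqr_ge0// mulrC; exact: hD.
Qed.

Let A i := seg_mean (vertex Q i) (vertex Q (ordS i)) phi.

Lemma edge_mean_adjacent i : gamma * `|A i - A (ordS i)| <= 2 * G.
Proof.
have cphi := smooth_continuous sphi.
set v := vertex Q (ordS i).
have crossN (x y z : R * R) : `|cross (x - y) (z - y)| = `|cross (x - z) (y - z)|.
  by rewrite -normrN; congr `|_|; rewrite /cross/=; ring.
have h1 : gamma * `|seg_mean v c phi - seg_mean v (vertex Q i) phi| <= G.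
  apply: spoke_mean; [|exact: (gq_vertex gQ)|].
    by rewrite crossN; exact: (gq_cross gQ).
  move=> s /andP[s0 s1]; apply: (gq_edge gQ (i := i)); exists (1 - s).
    by rewrite /= in_itv/= subr_ge0 s1 gerBl.
  by apply: pair_ext; rewrite /= /GRing.scale/= /v; ring.
have h2 : gamma * `|seg_mean v c phi - A (ordS i)| <= G.
  apply: spoke_mean; [|exact: (gq_vertex gQ)|].
    rewrite crossN (_ : cross _ _ = - cross (vertex Q (ordS i) - c) (vertex Q (ordS (ordS i)) - c)).
      by rewrite normrN; exact: (gq_cross gQ).
    by rewrite /cross/= /v; ring.
  move=> s s01; apply: (gq_edge gQ (i := ordS i)); exists s => //.
have -> : A i - A (ordS i) = (seg_mean v c phi - A (ordS i)) -
    (seg_mean v c phi - seg_mean v (vertex Q i) phi).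
  by rewrite {1}/A seg_mean_rev//; ring.
have := ler_normB (seg_mean v c phi - A (ordS i))
    (seg_mean v c phi - seg_mean v (vertex Q i) phi).
rewrite -(ler_pM2l gamma_gt0) mulrDr => /le_trans; apply.
by rewrite mulrDl mul1r lerD.
Qed.

(** In a cycle of four edges every edge is at most two steps away from edge 0, and each step costs 2
    G. *)
Lemma edge_mean_diff i : gamma * `|A i - A (inord 0)| <= 4 * G.
Proof.
have tri (x y z u w : R) : gamma * `|x - y| <= u -> gamma * `|y - z| <= w ->
    gamma * `|x - z| <= u + w.
  move=> xy yz; rewrite (le_trans _ (lerD xy yz))// -mulrDr ler_pM2l//.
  exact: ler_distD.
have h0 : gamma * `|A (inord 1) - A (inord 0)| <= 2 * G.
  by have := edge_mean_adjacent (inord 0); rewrite distrC ordS_inord.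
have h1 : gamma * `|A (inord 2) - A (inord 1)| <= 2 * G.
  by have := edge_mean_adjacent (inord 1); rewrite distrC ordS_inord.
have h3 : gamma * `|A (inord 3) - A (inord 0)| <= 2 * G.
  by have := edge_mean_adjacent (inord 3); rewrite ordS_inord3.
have G24 : 2 * G <= 4 * G by rewrite ler_wpM2r// ler_nat.
move: i; apply: ord4P.
- by rewrite subrr normr0 mulr0 mulr_ge0.
- exact: le_trans h0 G24.
- have -> : 4 * G = 2 * G + 2 * G by ring.
  exact: tri h1 h0.
- exact: le_trans h3 G24.
Qed.

End Spokes.

(** * Coercivity *)

Section Coercivity.
Variables (R : realType) (gamma : R) (Q : quad R) (c : R * R) (r h : R).
Hypotheses (gamma_gt0 : 0 < gamma) (gQ : good_quad gamma Q c r h).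
Notation E := (region Q).
Notation leb2 := (@leb2 R).
Let oE := gq_open gQ.
Let mE := open_measurable2 oE.

Lemma region_center : E !=set0 -> E c.
Proof.
move=> [x Ex]; apply: (gq_star gQ (eball_center c (gq_r0 gQ)) Ex); exact: segment_l.
Qed.

Lemma leb2_region : (leb2 E <= (4 * h ^+ 2)%:E)%E.
Proof.
have h0 := gq_h gQ.
have sub : E `<=` `[c.1 - h, c.1 + h]%classic `*` `[c.2 - h, c.2 + h]%classic.
  move=> x /(gq_bound gQ) xh; split; rewrite /= in_itv/= -ler_distl.
    exact: le_trans (fst_le_enorm (x - c)) xh.
  exact: le_trans (snd_le_enorm (x - c)) xh.
apply: (@le_trans _ _ (leb2 (`[c.1 - h, c.1 + h]%classic `*` `[c.2 - h, c.2 + h]%classic))).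
  by apply: le_measure; rewrite ?inE//; apply: measurableX; exact: measurable_itv.
rewrite leb2X; [|exact: measurable_itv|exact: measurable_itv].
rewrite !lebesgue_measure_itv/= !lte_fin !ltrD2l !gtrN//.
by rewrite -!EFinD -EFinM lee_fin le_eqVlt; apply/orP; left; apply/eqP; ring.
Qed.

Lemma leb2_region_lty : (leb2 E < +oo)%E.
Proof. exact: le_lt_trans leb2_region (ltry _). Qed.

(** The mollifier works with max-norm balls. The Euclidean norm is at most twice the max norm, so
    the max-norm ball of radius r / 3 lies in the Euclidean ball of radius r. *)
Let s := r / 3.

Lemma region_star_max_ball (x y : R * R) (l : R) : E x -> `|y - c| <= s -> 0 <= l <= 1 ->
  E (l *: x + (1 - l) *: y).
Proof.
move=> Ex ys l01; have r0 := gq_r0 gQ.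
have By : eball c r y.
  rewrite /eball/= (le_lt_trans (enorm_le_norm _))//.
  by rewrite (@le_lt_trans _ _ (2 * s))// ?ler_wpM2l// /s; lra.
apply: (gq_star gQ By Ex); exists l; first by rewrite /= in_itv.
by apply: pair_ext; rewrite /= /GRing.scale/=; ring.
Qed.

Let s_gt0 : 0 < s. Proof. by rewrite divr_gt0// (gq_r0 gQ). Qed.

Let B := h + enorm c.
Let EB x : E x -> `|x| <= B.
Proof.
move=> Ex; have -> : x = (x - c) + c by rewrite subrK.
rewrite (le_trans (ler_normD _ _))// lerD// ?norm_le_enorm//.
exact: le_trans (norm_le_enorm _) (gq_bound gQ Ex).
Qed.

(** [Sigma_h] comes with its own constant divergence [d], tied to the fluxes, and [Sigma0_h] adds
    divergence zero separately. The kernel centred at [c] with l = 1/2 is a test function of nonzero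
    integral, which identifies the two. *)
Lemma weak_div_cst_unique tau (d : R) : E c -> weak_div E tau (cst d) -> weak_div E tau (cst 0) -> d = 0.
Proof.
move=> Ec wd w0; have l0 : 0 < (1 / 2 : R) by rewrite divr_gt0.
have l1 : 1 / 2 < (1 : R) by lra.
have tf := mollifier_test_function s_gt0 region_star_max_ball l0 l1 Ec.
have K1 := mkernel_integral_E s_gt0 region_star_max_ball l0 l1 Ec.
set f := fun z : R * R => _ in tf.
set m := mscale_ s (1 / 2) in f tf.
have kE z : mkernel c s (1 / 2) c z = m ^+ 2 * f z by [].
have m0 : m != 0.
  by rewrite /m /mscale_ invr_eq0 mulf_neq0// ?gt_eqF// subr_gt0.
have ik : leb2.-integrable E (EFin \o mkernel c s (1 / 2) c).
  apply/integrableP; split.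
    apply/measurable_EFinP; apply: continuous_measurable_fun2 => //.
    by have [sf _ _] := tf; exact/smooth_continuous/(smoothZ (m ^+ 2) sf).
  have := ltry (1 : R); rewrite -[1%:E]K1; congr (_ < _)%E.
  by apply: eq_integral => z _; rewrite /= ger0_norm// mkernel_ge0.
have int0 : int2 E (fun x => cst 0 x * f x) = 0.
  rewrite /int2; under eq_Rintegral do rewrite mul0r.
  by rewrite Rintegral_cst// mul0r.
have : int2 E (fun x => cst d x * f x) = 0.
  by apply: oppr_inj; rewrite -(wd f tf) (w0 f tf) int0.
have -> : int2 E (fun x => cst d x * f x) = d * m ^- 2.
  transitivity (int2 E (fun x => (d * m ^- 2) * mkernel c s (1 / 2) c x)).
    by apply: eq_Rintegral => z _; rewrite kE mulrA -(mulrA d) mulVf ?mulr1// expf_neq0.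
  by rewrite /int2 RintegralZl// /Rintegral K1/= mulr1.
by move/eqP; rewrite mulf_eq0 invr_eq0 expf_eq0 (negPf m0) andbF orbF => /eqP.
Qed.

Lemma Sigma0_weights tau : E c -> Sigma0_h Q tau ->
  exists2 w : 'I_4 -> R, forall phi, smooth phi ->
    ip E tau (grad phi) = \sum_i w i * seg_mean (vertex Q i) (vertex Q (ordS i)) phi
  & exists2 v, L2 E v & weak_grad E v tau.
Proof.
move=> Ec [[_ [v [[lv _] vtau]] [d [wd [k nt]]]] w0].
have d0 := weak_div_cst_unique Ec wd w0.
exists (fun i => k i * edge_length Q i); last by exists v.
move=> phi sphi; have := nt phi sphi; rewrite d0.
have -> : int2 E (fun x => cst 0 x * phi x) = 0.
  rewrite /int2; under eq_Rintegral do rewrite mul0r.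
  by rewrite Rintegral_cst// mul0r.
rewrite addr0 /ip => ->; apply: eq_bigr => i _.
by rewrite edge_integral_cst//; exact: smooth_continuous.
Qed.

Lemma ip_sqint (t : R * R -> R * R) : L2vec E t ->
  ip E t t = sqint E (fst \o t) + sqint E (snd \o t).
Proof.
move=> [t1 t2]; rewrite /ip /sqint /int2 -RintegralD//; last 2 first.
- exact: L2_sqr_integrable.
- exact: L2_sqr_integrable.
Qed.

Lemma sum_centered (w A : 'I_4 -> R) (k : R) : \sum_i w i = 0 ->
  \sum_i w i * A i = \sum_i w i * (A i - k).
Proof.
move=> w0; under [RHS]eq_bigr do rewrite mulrBr.
by rewrite sumrB -mulr_suml w0 mul0r subr0.
Qed.

(** The function phi = 1 has zero gradient and all its edge means equal 1. *)
Lemma weights_sum tau (w : 'I_4 -> R) :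
  (forall phi, smooth phi ->
    ip E tau (grad phi) = \sum_i w i * seg_mean (vertex Q i) (vertex Q (ordS i)) phi) ->
  \sum_i w i = 0.
Proof.
move=> wE; have := wE _ (smooth_cst 1); rewrite [LHS](_ : _ = 0); last first.
  rewrite /ip /int2; under eq_Rintegral do rewrite /dot /grad/= !partial_cst !mulr0 addr0.
  by rewrite Rintegral_cst// mul0r.
by move=> w0; rewrite [RHS]w0; apply: eq_bigr => i _; rewrite seg_mean_cst mulr1.
Qed.

Section Mollified.
Variables (v : R * R -> R) (tau : R * R -> R * R) (l : R).
Hypotheses (lv : L2 E v) (ltau : L2vec E tau) (vtau : weak_grad E v tau).
Hypotheses (l_gt0 : 0 < l) (l_lt1 : l < 1).
Let phi := mollify E c s l v.
Let T g := mollify E c s l g.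

Lemma grad_mollify x : E x -> grad phi x = (l * T (fst \o tau) x, l * T (snd \o tau) x).
Proof.
move=> Ex; have [l1 l2] := ltau.
rewrite /grad; congr pair.
- apply: (partial_mollify oE leb2_region_lty s_gt0 region_star_max_ball) => //.
  by move=> f /vtau[].
- apply: (partial_mollify oE leb2_region_lty s_gt0 region_star_max_ball) => //.
  by move=> f /vtau[].
Qed.

Lemma L2vec_grad_mollify : L2vec E (grad phi).
Proof.
have [l1 l2] := ltau; split.
- apply: (@L2_ext _ _ (fun x => l * T (fst \o tau) x)).
    by move=> x /set_mem Ex; rewrite /comp grad_mollify.
  by apply: L2_scale; exact: (mollify_L2 oE leb2_region_lty s_gt0 region_star_max_ball).
- apply: (@L2_ext _ _ (fun x => l * T (snd \o tau) x)).
    by move=> x /set_mem Ex; rewrite /comp grad_mollify.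
  by apply: L2_scale; exact: (mollify_L2 oE leb2_region_lty s_gt0 region_star_max_ball).
Qed.

(** The l^2 of the squared gradient cancels the l^-2 of [mollify_sqint] exactly, so the bound has no
    constant depending on [l]. *)
Lemma ip_grad_mollify_le : ip E (grad phi) (grad phi) <= L2norm E tau ^+ 2.
Proof.
have [l1 l2] := ltau; rewrite sqr_L2norm !ip_sqint//; last exact: L2vec_grad_mollify.
have ln : l != 0 by rewrite gt_eqF.
have H g : L2 E g -> int2 E (fun x => (l * T g x) ^+ 2) <= sqint E g.
  move=> lg; have := mollify_sqint oE leb2_region_lty s_gt0 region_star_max_ball l_gt0 l_lt1 lg.
  rewrite -(ler_pM2l (x := l ^+ 2)) ?exprn_gt0// mulrA divff ?expf_neq0// mul1r.
  apply: le_trans; rewrite /sqint /int2 -RintegralZl//; last first.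
    by apply: L2_sqr_integrable => //; exact: (mollify_L2 oE leb2_region_lty s_gt0 region_star_max_ball).
  by rewrite le_eqVlt; apply/orP; left; apply/eqP/eq_Rintegral => x _; rewrite exprMn.
apply: lerD.
- have := H _ l1; apply: le_trans; rewrite le_eqVlt; apply/orP; left; apply/eqP.
  by apply: eq_Rintegral => x /set_mem Ex; rewrite /comp grad_mollify.
- have := H _ l2; apply: le_trans; rewrite le_eqVlt; apply/orP; left; apply/eqP.
  by apply: eq_Rintegral => x /set_mem Ex; rewrite /comp grad_mollify.
Qed.

Lemma integral_grad_mollify_le :
  (\int[leb2]_(x in E) (dot (grad phi x) (grad phi x))%:E <= (L2norm E tau ^+ 2)%:E)%E.
Proof.
have ig := dot_integrable mE L2vec_grad_mollify L2vec_grad_mollify.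
rewrite -[leLHS]fineK; last exact: (integrable_fin_num mE ig).
by rewrite lee_fin; exact: ip_grad_mollify_le.
Qed.

Lemma ip_tau_grad_mollify : ip E tau (grad phi) =
  l * (int2 E (fun x => (tau x).1 * T (fst \o tau) x) + int2 E (fun x => (tau x).2 * T (snd \o tau) x)).
Proof.
have [l1 l2] := ltau.
have m1 := mollify_L2 oE leb2_region_lty s_gt0 region_star_max_ball l_gt0 l_lt1 l1.
have m2 := mollify_L2 oE leb2_region_lty s_gt0 region_star_max_ball l_gt0 l_lt1 l2.
have i1 := L2_integrableM mE l1 m1; have i2 := L2_integrableM mE l2 m2.
rewrite /int2 -(RintegralD mE i1 i2).
rewrite -RintegralZl//; last exact: (integrableD mE i1 i2).
by apply: eq_Rintegral => x /set_mem Ex; rewrite (grad_mollify Ex) /dot /T /=; ring.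
Qed.

(** The weights have zero sum, so the mean on edge 0 can be subtracted from every edge mean; the
    differences are at most 4 / gamma times the norm of tau. *)
Lemma ip_tau_weights_le (w : 'I_4 -> R) :
  (forall phi, smooth phi ->
    ip E tau (grad phi) = \sum_i w i * seg_mean (vertex Q i) (vertex Q (ordS i)) phi) ->
  ip E tau (grad phi) <= 4 / gamma * L2norm E tau * \sum_i `|w i|.
Proof.
move=> wE; have sphi : smooth phi by exact: (smooth_mollify c s oE leb2_region_lty l lv).
have w0 := weights_sum wE.
pose A i := seg_mean (vertex Q i) (vertex Q (ordS i)) phi.
rewrite (wE _ sphi) (sum_centered A (A (inord 0)) w0).
rewrite mulr_sumr; apply: ler_sum => i _; apply: le_trans (ler_norm _) _.
rewrite normrM mulrC ler_wpM2r//.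
have := edge_mean_diff gamma_gt0 gQ sphi (sqrtr_ge0 _) integral_grad_mollify_le i.
by rewrite -/(A _) -/(A _) mulrC -ler_pdivlMr// mulrAC.
Qed.

End Mollified.

(** Letting l tend to 1 gives N^2 <= (4 / gamma) N W, which is then divided by N. *)
Lemma norm_le_weights (v : R * R -> R) (tau : R * R -> R * R) (w : 'I_4 -> R) :
  L2 E v -> L2vec E tau -> weak_grad E v tau ->
  (forall phi, smooth phi ->
    ip E tau (grad phi) = \sum_i w i * seg_mean (vertex Q i) (vertex Q (ordS i)) phi) ->
  L2norm E tau <= 4 / gamma * \sum_i `|w i|.
Proof.
move=> lv ltau vtau wE; have [l1 l2] := ltau.
set W := \sum_i _; have W0 : 0 <= W by apply: sumr_ge0.
have N0 := sqrtr_ge0 (ip E tau tau); rewrite -L2normE in N0.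
set N := L2norm E tau in N0 *.
pose X := 4 / gamma * N * W; have g4 : 0 < 4 / gamma by rewrite divr_gt0.
have X0 : 0 <= X by apply: mulr_ge0 => //; apply: mulr_ge0 => //; exact: ltW.
suff : N ^+ 2 <= X.
  rewrite /X mulrAC -mulrA expr2 mulrA; move: N0; rewrite le_eqVlt => /predU1P[<- _|N0].
    by apply: mulr_ge0 => //; exact: ltW.
  by rewrite ler_pM2r.
(* The weak convergence loses [d] for each component, and the passage to l < 1 loses 2 d X. The
   total d (2 (1 + X)) has to be at most [e]. *)
apply/ler_addgt0Pr => e e0; pose d := Num.min (1 / 2) (e / (2 * (1 + X))).
have X1 : 0 < 2 * (1 + X) by rewrite mulr_gt0// ltr_pwDl.
have d0 : 0 < d by rewrite lt_min !divr_gt0.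
have [k1 k11 H1] := mollify_weak_cvg oE leb2_region_lty EB s_gt0 region_star_max_ball l1 d0.
have [k2 k21 H2] := mollify_weak_cvg oE leb2_region_lty EB s_gt0 region_star_max_ball l2 d0.
pose l := Num.max (Num.max (1 / 2) (1 - d)) (Num.max k1 k2).
have ll : l < 1 by rewrite !gt_max k11 k21 ltrBlDr ltrDl d0 !andbT; lra.
have lh : 1 / 2 <= l by rewrite !le_max lexx.
have ld : 1 - d <= l by rewrite !le_max lexx orbT.
have l0 : 0 < l by rewrite (lt_le_trans _ lh)// divr_gt0.
have := H1 l lh _ ll; rewrite !le_max lexx !orbT => /(_ isT).
have := H2 l lh _ ll; rewrite !le_max lexx !orbT => /(_ isT).
have := ip_tau_weights_le lv ltau vtau l0 ll wE; rewrite -/N -/W -/X.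
rewrite ip_tau_grad_mollify//.
have -> : N ^+ 2 = sqint E (fst \o tau) + sqint E (snd \o tau).
  by rewrite /N sqr_L2norm ip_sqint.
set a1 := sqint _ _; set a2 := sqint _ _.
set b1 := int2 _ _; set b2 := int2 _ _ => bX.
rewrite !ler_distl => /andP[b2a _] /andP[b1a _].
have bX2 : b1 + b2 <= X * (1 + 2 * d).
  rewrite -(ler_pM2l l0); apply: le_trans bX _.
  (* From l >= 1 - d and l >= 1/2: l + 2 d l >= (1 - d) + d. *)
  have : 1 <= l * (1 + 2 * d).
    have : 1 / 2 * d <= l * d by rewrite ler_pM2r.
    by lra.
  by move=> /(ler_wpM2l X0); rewrite mulr1 mulrCA.
have dX : d * (2 * (1 + X)) <= e.
  by rewrite -ler_pdivlMr// /d ge_min lexx orbT.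
by lra.
Qed.

(** The projection replaces tau because the field is the gradient of a harmonic quadratic. Then
    [K * (2 * h)] bounds the norm of the field, its sup bound times the square root of the area. *)
Lemma moment_bound tau (a b d e K : R) : L2vec E tau -> 0 <= K ->
  (forall x, E x -> dot (hfield c a b d e x) (hfield c a b d e x) <= K ^+ 2) ->
  `|ip E tau (hfield c a b d e)| <= K * (2 * h) * L2norm E (Pi_hat Q tau).
Proof.
move=> lt K0 hK; have Efin := leb2_region_lty; have h0 := gq_h gQ.
have lh := L2vec_hfield oE Efin EB c a b d e.
rewrite (Pi_hat_hfield oE Efin EB)//.
apply: le_trans (ip_le_norm mE (Pi_hat_L2 oE Efin EB lt) lh) _.
rewrite mulrC ler_wpM2r ?sqrtr_ge0//.
rewrite -ler_sqr ?nnegrE ?sqrtr_ge0 ?mulr_ge0// ?(ltW h0)// sqr_L2norm.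
apply: (@le_trans _ _ (int2 E (cst (K ^+ 2)))).
  apply: le_Rintegral => //.
  - exact: dot_integrable.
  - exact: (L2_integrable mE Efin (L2_cst _ mE Efin)).
rewrite /int2 Rintegral_cst// (_ : (K * (2 * h)) ^+ 2 = K ^+ 2 * (4 * h ^+ 2)); last by ring.
rewrite ler_wpM2l ?sqr_ge0// -lee_fin fineK; first exact: leb2_region.
by rewrite ge0_fin_numE// measure_ge0.
Qed.

(** The four test polynomials are the coordinates and the real and imaginary parts of the complex
    square, all centred at [c]. Their gradients have length at most 1 and 2 h on E, whence moments
    at most 2 h N and 4 h^2 N, with N the norm of the projection. *)
Lemma weights_bound tau (w : 'I_4 -> R) : L2vec E tau ->
  (forall phi, smooth phi ->
    ip E tau (grad phi) = \sum_i w i * seg_mean (vertex Q i) (vertex Q (ordS i)) phi) ->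
  \sum_i `|w i| <= (40 / gamma ^+ 2 + 192 / gamma ^+ 4) * L2norm E (Pi_hat Q tau).
Proof.
move=> lt wE; have h0 := gq_h gQ.
have N0 := sqrtr_ge0 (ip E (Pi_hat Q tau) (Pi_hat Q tau)); rewrite -L2normE in N0.
pose z i := vertex Q i - c.
have zx i : `|(z i).1| <= h by exact: le_trans (fst_le_enorm _) (gq_vertex gQ i).
have zy i : `|(z i).2| <= h by exact: le_trans (snd_le_enorm _) (gq_vertex gQ i).
have w0 := weights_sum wE.
have mom a b d e := wE _ (smooth_hpoly c a b d e).
have S0 : ordS (inord 0 : 'I_4) = inord 1 by rewrite ordS_inord.
have S1 : ordS (inord 1 : 'I_4) = inord 2 by rewrite ordS_inord.
have S2 : ordS (inord 2 : 'I_4) = inord 3 by rewrite ordS_inord.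
have lin a b : a ^+ 2 + b ^+ 2 <= 1 ->
    `|\sum_i w i * seg_mean (vertex Q i) (vertex Q (ordS i)) (hpoly c a b 0 0)| <=
    2 * h * L2norm E (Pi_hat Q tau).
  move=> ab; rewrite -mom grad_hpoly.
  have -> : 2 * h * L2norm E (Pi_hat Q tau) = 1 * (2 * h) * L2norm E (Pi_hat Q tau) by rewrite mul1r.
  apply: moment_bound => // x _; rewrite expr1n /dot /hfield/=.
  by rewrite !(mulr0, mul0r, addr0, subr0) -!expr2.
have quadr d e : d ^+ 2 + e ^+ 2 <= 1 ->
    `|\sum_i w i * seg_mean (vertex Q i) (vertex Q (ordS i)) (hpoly c 0 0 d e)| <=
    4 * h ^+ 2 * L2norm E (Pi_hat Q tau).
  move=> de; rewrite -mom grad_hpoly.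
  have -> : 4 * h ^+ 2 = 2 * h * (2 * h) by ring.
  apply: moment_bound => //; first by rewrite mulr_ge0// ltW.
  move=> x Ex.
  have -> : dot (hfield c 0 0 d e x) (hfield c 0 0 d e x) =
      (2 ^+ 2 * dot (x - c) (x - c)) * (d ^+ 2 + e ^+ 2).
    by rewrite /dot /hfield/=; ring.
  rewrite -[leRHS]mulr1 exprMn ler_pM//.
  - by rewrite mulr_ge0// dot_ge0.
  - by rewrite addr_ge0// sqr_ge0.
  - by rewrite ler_wpM2l// -sqr_enorm lerXn2r ?nnegrE ?enorm_ge0 ?(ltW h0)// (gq_bound gQ).
rewrite sum_ord4.
apply: (@quad_weights_bound R gamma h _ (z (inord 0)).1 (z (inord 0)).2 (z (inord 1)).1 (z (inord 1)).2
  (z (inord 2)).1 (z (inord 2)).2 (z (inord 3)).1 (z (inord 3)).2) => //.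
- have := gq_diag gQ; rewrite /cross_diag /cross/=.
  by congr (_ <= `|_|); rewrite /z/=; ring.
- by rewrite -sum_ord4.
- have := lin 1 0; rewrite expr1n expr0n/= addr0 lexx => /(_ isT); rewrite sum_ord4.
  rewrite !seg_mean_hpoly S0 S1 S2 ordS_inord3 -!/(z _).
  by rewrite !(mul1r, mul0r, addr0).
- have := lin 0 1; rewrite expr1n expr0n/= add0r lexx => /(_ isT); rewrite sum_ord4.
  rewrite !seg_mean_hpoly S0 S1 S2 ordS_inord3 -!/(z _).
  by rewrite !(mul1r, mul0r, addr0, add0r).
- have := quadr 1 0; rewrite expr1n expr0n/= addr0 lexx => /(_ isT); rewrite sum_ord4.
  rewrite !seg_mean_hpoly S0 S1 S2 ordS_inord3 -!/(z _).
  by rewrite !(mul1r, mul0r, addr0, add0r).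
- have := quadr 0 1; rewrite expr1n expr0n/= add0r lexx => /(_ isT); rewrite sum_ord4.
  rewrite !seg_mean_hpoly S0 S1 S2 ordS_inord3 -!/(z _).
  by rewrite !(mul1r, mul0r, addr0, add0r).
Qed.

Lemma Pi_hat_coercive tau : E c -> Sigma0_h Q tau ->
  L2norm E tau <= 4 / gamma * (40 / gamma ^+ 2 + 192 / gamma ^+ 4) * L2norm E (Pi_hat Q tau).
Proof.
move=> Ec S0; have [[[lt _] _ _] _] := S0.
have [w wE [v lv vtau]] := Sigma0_weights Ec S0.
apply: le_trans (norm_le_weights lv lt vtau wE) _.
by rewrite -[leRHS]mulrA ler_wpM2l ?weights_bound// divr_ge0// ltW.
Qed.

Lemma a_h_le sigma tau : Sigma_h Q sigma -> Sigma_h Q tau ->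
  a_h Q sigma tau <= L2norm E sigma * L2norm E tau.
Proof.
by move=> [[ls _] _ _] [[lt _] _ _]; exact: (a_h_continuous oE leb2_region_lty EB).
Qed.

End Coercivity.

Theorem theorem1 (R : realType) (Omega : set (R * R))
    (Omega_open : open Omega) (Omega_connected : connected Omega)
    (Omega_nonempty : Omega !=set0)
    (I : Type) (M : I -> set (quad R))
    (M_tess : forall h, tessellation Omega (M h))
    (gamma : R) (gamma_gt0 : 0 < gamma)
    (A1 : forall h Q, M h Q -> mesh_star gamma Q)
    (A2 : forall h Q, M h Q -> mesh_edge gamma Q) :
  exists alpha_lo alpha_up : R,
    [/\ 0 < alpha_lo, 0 < alpha_up
      & forall h Q, M h Q ->
        (forall tau sigma, Sigma_h Q tau -> Sigma_h Q sigma ->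
           a_h Q tau sigma <=
           alpha_up * L2norm (region Q) tau * L2norm (region Q) sigma) /\
        (forall tau, Sigma0_h Q tau ->
           alpha_lo * L2norm (region Q) tau ^+ 2 <= a_h Q tau tau)].
Proof.
pose K := 4 / gamma * (40 / gamma ^+ 2 + 192 / gamma ^+ 4).
have K0 : 0 < K by rewrite mulr_gt0 ?addr_gt0 ?divr_gt0 ?exprn_gt0.
exists (K ^- 2), 1; split=> //; first by rewrite invr_gt0 exprn_gt0.
move=> h Q MQ; have [_ /(_ Q MQ) qQ _ _] := M_tess h.
have [c [r [k gQ]]] := quad_geometry gamma_gt0 qQ (A1 h Q MQ) (A2 h Q MQ).
split=> [tau sigma St Ss|tau St]; first by rewrite mul1r; exact: (a_h_le gQ).
(* The region is nonempty because a vertex lies in its closure; star-shapedness then puts the centre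
   in it. *)
have Ec : region Q c.
  apply: (region_center gQ).
  have [_ _ _ bdE] := qQ.
  have [clv _] : (closure (region Q) `\` region Q) (vertex Q (inord 0)).
    by rewrite bdE; exists (inord 0) => //; exact: segment_l.
  by have [x [Ex _]] := clv setT filterT; exists x.
rewrite a_h_diag -ler_pdivlMl ?invr_gt0 ?exprn_gt0// invrK -exprMn.
rewrite lerXn2r ?nnegrE//; first exact: sqrtr_ge0.
  by rewrite mulr_ge0 ?(ltW K0)// sqrtr_ge0.
exact: (Pi_hat_coercive gamma_gt0 gQ).
Qed.
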